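(* Let $\mathcal{T}_h$ be a regular triangulation of a bounded polyhedral Lipschitz domain $\Omega\subset\mathbb{R}^d$ with boundary partition $\partial\Omega=\Gamma_D\cup\Gamma_N$. Assume that $\phi\in C(\mathbb{R}^d)$ is convex and that $\psi_h:\Omega\times\mathbb{R}\to\mathbb{R}\cup\{+\infty\}$ is elementwise constant in the first argument and convex with respect to the second argument. For $u_h\in\mathcal{S}^{1,cr}_D(\mathcal{T}_h)$ and $z_h\in\mathcal{R}T^0_N(\mathcal{T}_h)$ define $$I_h(u_h)=\int_\Omega\phi(\nabla_h u_h)+\psi_h(x,\Pi_h u_h)\,dx,$$ $$D_h(z_h)=-\int_\Omega\phi^*(\Pi_h z_h)+\psi_h^*(x,\operatorname{div} z_h)\,dx.$$ Then $$\inf_{u_h\in\mathcal{S}^{1,cr}_D(\mathcal{T}_h)}I_h(u_h)\ \ge\ \sup_{z_h\in\mathcal{R}T^0_N(\mathcal{T}_h)}D_h(z_h).$$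
   Context: Let $d$ be a positive integer and $\Omega\subset\mathbb{R}^d$ a bounded polyhedral Lipschitz domain (in particular connected). Let $\mathcal{T}_h$ be a regular (conforming, finite) triangulation of $\Omega$ into closed nondegenerate $d$-simplices, called elements. $\mathcal{S}_h$ is the set of sides ($(d-1)$-dimensional faces) of elements; $x_S$ and $x_T$ are the barycenters (midpoints) of a side $S$ and an element $T$. The boundary $\partial\Omega$ is partitioned into $\Gamma_D$ and $\Gamma_N$: $\Gamma_D$ is a (possibly empty) union of boundary sides and $\Gamma_N$ is the union of the remaining boundary sides (possibly empty). $n$ is the outer unit normal on $\partial\Omega$. $P_k(T)$ is the set of polynomials of total degree at most $k$ on $T$, and $\mathcal{L}^k(\mathcal{T}_h)^\ell=\{w_h\in L^\infty(\Omega;\mathbb{R}^\ell): w_h|_T\in P_k(T)$ (componentwise) for all $T\in\mathcal{T}_h\}$; the superscript $\ell$ is omitted if $\ell=1$. $\Pi_h:L^1(\Omega;\mathbb{R}^\ell)\to\mathcal{L}^0(\mathcal{T}_h)^\ell$ is the $L^2$ projection onto elementwise constants, i.e. $\Pi_h v|_T=|T|^{-1}\int_T v\,dx$. Crouzeix--Raviart space: $\mathcal{S}^{1,cr}(\mathcal{T}_h)=\{v_h\in\mathcal{L}^1(\mathcal{T}_h): v_h$ is continuous at $x_S$ for all $S\in\mathcal{S}_h\}$ (for an interior side, the values at $x_S$ from the two adjacent elements agree), and $\mathcal{S}^{1,cr}_D(\mathcal{T}_h)=\{v_h\in\mathcal{S}^{1,cr}(\mathcal{T}_h): v_h(x_S)=0$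 for all $S\in\mathcal{S}_h$ with $S\subset\Gamma_D\}$. The elementwise gradient $\nabla_h v_h\in\mathcal{L}^0(\mathcal{T}_h)^d$ is defined by $\nabla_h v_h|_T=\nabla(v_h|_T)$. Raviart--Thomas space: $\mathcal{R}T^0(\mathcal{T}_h)=\{y_h\in H(\operatorname{div};\Omega): y_h|_T(x)=a_T+b_T(x-x_T),\ a_T\in\mathbb{R}^d,\ b_T\in\mathbb{R},$ for all $T\in\mathcal{T}_h\}$, where $H(\operatorname{div};\Omega)$ is the set of $L^2$ vector fields with distributional divergence in $L^2(\Omega)$, and $\mathcal{R}T^0_N(\mathcal{T}_h)=\{y_h\in\mathcal{R}T^0(\mathcal{T}_h): y_h\cdot n=0$ on $\Gamma_N\}$. Convex conjugates: $\phi^*(s)=\sup_{r\in\mathbb{R}^d}\big(s\cdot r-\phi(r)\big)$ for $s\in\mathbb{R}^d$, and $\psi_h^*$ is the conjugate with respect to the second argument, $\psi_h^*(x,s)=\sup_{r\in\mathbb{R}}\big(s\,r-\psi_h(x,r)\big)$ for $s\in\mathbb{R}$. In $I_h$ and $D_h$ the integral extends over the sum of both terms. Infima and suprema are taken in the extended real line. *)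

(* Defs.v *)
From HB Require Import structures.
From mathcomp Require Import all_boot all_order all_algebra.
From mathcomp Require Import all_classical all_reals all_analysis.

Set Implicit Arguments.
Unset Strict Implicit.
Unset Printing Implicit Defensive.

Import Order.TTheory GRing.Theory Num.Theory.
Import numFieldNormedType.Exports.

Local Open Scope classical_set_scope.
Local Open Scope ring_scope.

(* Borel (= product) sigma-algebra on R^n, generated by the coordinates. *)
Definition rV_display : measure_display -> measure_display.
Proof. exact. Qed.

Section rV_measurable.
Context d (T : sigmaRingType d) (n : nat).

Let coords : 'I_n -> 'rV[T]_n -> T := fun i x => x ord0 i.

Let rV_set0 : g_sigma_preimage coords set0.
Proof. exact: sigma_algebra0. Qed.

Let rV_setC A : g_sigma_preimage coords A -> g_sigma_preimage coords (~` A).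
Proof. exact: sigma_algebraC. Qed.

Let rV_bigcup (F : _^nat) : (forall i, g_sigma_preimage coords (F i)) ->
  g_sigma_preimage coords (\bigcup_i (F i)).
Proof. exact: sigma_algebra_bigcup. Qed.

HB.instance Definition _ := @isMeasurable.Build (rV_display d)
  'rV[T]_n (g_sigma_preimage coords) rV_set0 rV_setC rV_bigcup.

End rV_measurable.

Section rV_measurable_fun.
Context {d : measure_display} {T : measurableType d}.

Lemma measurable_rV_coord n (i : 'I_n) :
  measurable_fun [set: 'rV[T]_n] (fun x : 'rV[T]_n => x ord0 i).
Proof.
move=> _ Y mY; rewrite setTI; apply: sub_sigma_algebra => /=.
rewrite -bigcup_seq/=; exists i => /=; first by rewrite mem_index_enum.
by exists Y => //; rewrite setTI.
Qed.

Lemma measurable_fun_rV d' (S : measurableType d') n (f : S -> 'rV[T]_n) :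
  (forall i, measurable_fun [set: S] (fun s => f s ord0 i)) ->
  measurable_fun [set: S] f.
Proof.
move=> mf _ A mA; rewrite setTI.
have : sigma_algebra [set: 'rV[T]_n] [set B | measurable (f @^-1` B)].
  split => /=.
  - by rewrite preimage_set0.
  - by move=> B mB; rewrite setTD preimage_setC; exact: measurableC.
  - by move=> F mF; rewrite preimage_bigcup; exact: bigcupT_measurable.
move=> sA; suff /(_ A mA) : measurable `<=` [set B | measurable (f @^-1` B)] by [].
apply: smallest_sub => // B; rewrite -bigcup_seq/= => -[i _ [C mC <-]].
by rewrite setTI/= -[X in measurable X]setTI; exact: mf.
Qed.

End rV_measurable_fun.

Section lebesgue_rV.
Context {R : realType}.

Definition rV_cons n (p : R * 'rV[R]_n) : 'rV[R]_n.+1 :=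
  row_mx (p.1%:M : 'rV[R]_1) p.2.

Lemma measurable_rV_cons n : measurable_fun [set: R * 'rV[R]_n] (@rV_cons n).
Proof.
apply: measurable_fun_rV => i; rewrite /rV_cons.
case: (splitP (i : 'I_(1 + n))) => j ij.
  rewrite (_ : (fun _ => _) = fst); first exact: measurable_fst.
  apply/funext => p; rewrite (_ : i = lshift n j); last exact: val_inj.
  by rewrite (row_mxEl (p.1%:M : 'rV[R]_1)) ord1 mxE [j]ord1 eqxx mulr1n.
rewrite (_ : (fun _ => _) = (fun x : 'rV[R]_n => x ord0 j) \o snd).
  by apply: measurableT_comp; [exact: measurable_rV_coord|exact: measurable_snd].
apply/funext => p; rewrite (_ : i = rshift 1 j); last exact: val_inj.
by rewrite (row_mxEr (p.1%:M : 'rV[R]_1)).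
Qed.

HB.instance Definition _ n :=
  isMeasurableFun.Build _ _ _ _ (@rV_cons n) (@measurable_rV_cons n).

Section step.
Variables (n : nat) (mu : {sigma_finite_measure set 'rV[R]_n -> \bar R}).

Definition lebesgue_rVS : set 'rV[R]_n.+1 -> \bar R :=
  pushforward (lebesgue_measure \x mu)%E (@rV_cons n).

Let lebesgue_rVS0 : lebesgue_rVS set0 = 0%E.
Proof. by rewrite /lebesgue_rVS /pushforward preimage_set0 measure0. Qed.

Let lebesgue_rVS_ge0 A : (0 <= lebesgue_rVS A)%E.
Proof. by rewrite /lebesgue_rVS /pushforward. Qed.

Let lebesgue_rVS_sigma_additive : semi_sigma_additive lebesgue_rVS.
Proof.
move=> F mF tF mUF; rewrite /lebesgue_rVS /pushforward preimage_bigcup.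
apply: measure_semi_sigma_additive.
- move=> k; rewrite -[X in measurable X]setTI; exact: measurable_rV_cons.
- apply/trivIsetP => /= i j _ _ ij; rewrite -preimage_setI.
  by move/trivIsetP : tF => /(_ _ _ _ _ ij) ->//; rewrite preimage_set0.
- rewrite -preimage_bigcup -[X in measurable X]setTI; exact: measurable_rV_cons.
Qed.

HB.instance Definition _ := isMeasure.Build _ _ _ lebesgue_rVS
  lebesgue_rVS0 lebesgue_rVS_ge0 lebesgue_rVS_sigma_additive.

Let lebesgue_rVS_sigma_finite : sigma_finite [set: 'rV[R]_n.+1] lebesgue_rVS.
Proof.
have /sigma_finiteP[F [TF ndF Foo]] := sigma_finiteT (@lebesgue_measure R).
have /sigma_finiteP[G [TG ndG Goo]] := sigma_finiteT mu.
pose uncons (x : 'rV[R]_n.+1) : measurableTypeR R * 'rV[R]_n :=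
  (x ord0 ord0, \row_j x ord0 (rshift 1 j)).
have consK : cancel (@rV_cons n) uncons.
  move=> [a v]; rewrite /uncons /rV_cons; congr pair.
    rewrite (_ : ord0 = lshift n (ord0 : 'I_1)) ?(row_mxEl (a%:M : 'rV[R]_1))//.
      by rewrite mxE.
    exact: val_inj.
  by apply/rowP => j; rewrite mxE (row_mxEr (a%:M : 'rV[R]_1)).
have muncons : measurable_fun setT uncons.
  apply: measurable_fun_pair; first exact: measurable_rV_coord.
  apply: measurable_fun_rV => i; under eq_fun do rewrite mxE.
  exact: measurable_rV_coord.
exists (fun k => uncons @^-1` (F k `*` G k)) => [|k].
  rewrite -preimage_bigcup -[LHS](preimage_setT uncons); congr (_ @^-1` _).
  rewrite -setXTT TF TG predeqE => -[x y]; split.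
    move=> [/= [k _ Fkx] [l _ Gly]]; exists (maxn k l) => //; split.
    - by move: x Fkx; exact/subsetPset/ndF/leq_maxl.
    - by move: y Gly; exact/subsetPset/ndG/leq_maxr.
  by move=> [k _ []/= ? ?]; split; exists k.
have [mF Fk] := Foo k; have [mG Gk] := Goo k; split.
  by rewrite -[X in measurable X]setTI; apply: muncons => //; exact: measurableX.
rewrite /lebesgue_rVS /pushforward -comp_preimage (_ : uncons \o _ = id).
  by rewrite preimage_id product_measure1E// lte_mul_pinfty// ge0_fin_numE.
by apply/funext => p; exact: consK.
Qed.

HB.instance Definition _ :=
  Measure_isSigmaFinite.Build _ _ _ lebesgue_rVS lebesgue_rVS_sigma_finite.
End step.

Fixpoint lebesgue_rV (n : nat) : {sigma_finite_measure set 'rV[R]_n -> \bar R} :=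
  match n return {sigma_finite_measure set 'rV[R]_n -> \bar R} with
  | 0 => \d_(0 : 'rV[R]_0)
  | m.+1 => @lebesgue_rVS m (lebesgue_rV m)
  end.

End lebesgue_rV.

Section euclidean.
Context {R : realType} {d : nat}.
Implicit Types (x y s : 'rV[R]_d) (A : set 'rV[R]_d).

Definition dot x y : R := \sum_i x ord0 i * y ord0 i.

Definition grad (f : 'rV[R]_d -> R) x : 'rV[R]_d :=
  \row_i 'D_(delta_mx ord0 i) f x.

Definition boundary A : set 'rV[R]_d := closure A `\` interior A.

(* Near each boundary point and for a suitable unit direction e, Omega is the
   strict epigraph of a Lipschitz function of the component orthogonal to e. *)
Definition lipschitz_boundary (Omega : set 'rV[R]_d) :=
  forall x, boundary Omega x ->
  exists (r : R) (e : 'rV[R]_d) (gamma : 'rV[R]_d -> R),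
    [/\ 0 < r, dot e e = 1, exists k : R, k.-lipschitz gamma &
        forall y, ball x r y ->
          (Omega y <-> gamma (y - dot y e *: e) < dot y e)].

End euclidean.

Section simplices.
Context {R : realType} {d k : nat}.
Implicit Types (P : 'M[R]_(k, d)) (I : {set 'I_k}).

(* P lists points as its rows; face P I is the convex hull of the rows in I. *)
Definition face P I : set 'rV[R]_d :=
  [set x | exists c : 'rV[R]_k,
    [/\ forall j, 0 <= c ord0 j, forall j, j \notin I -> c ord0 j = 0,
        \sum_j c ord0 j = 1 & x = c *m P]].

Definition simplex P : set 'rV[R]_d := face P [set: 'I_k]%SET.

Definition affinely_independent P :=
  forall c : 'rV[R]_k, \sum_j c ord0 j = 0 -> c *m P = 0 -> c = 0.

Definition barycenter P I : 'rV[R]_d :=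
  (#|I|%:R)^-1 *: \sum_(j in I) row j P.

End simplices.

Definition polyhedral (R : realType) (d : nat) (Omega : set 'rV[R]_d) :=
  exists (m : nat) (k : 'I_m -> nat) (P : forall i, 'M[R]_(k i, d)),
    closure Omega = \bigcup_i simplex (P i).

Definition polyhedral_lipschitz_domain (R : realType) (d : nat)
    (Omega : set 'rV[R]_d) :=
  [/\ [/\ open Omega, connected Omega & Omega !=set0], bounded_set Omega,
      polyhedral Omega & lipschitz_boundary Omega].

Section mesh.
Context {R : realType} {d : nat} {E : finType}.
Implicit Types (Omega : set 'rV[R]_d) (Th : E -> 'M[R]_(d.+1, d)).

(* The elements are the simplices with vertex matrices Th e, e : E. *)
Definition regular_triangulation Omega Th :=
  [/\ forall e, affinely_independent (Th e),
      closure Omega = \bigcup_e simplex (Th e),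
      injective (fun e => simplex (Th e)) &
      forall e e', exists I J : {set 'I_d.+1},
        simplex (Th e) `&` simplex (Th e') = face (Th e) I /\
        face (Th e) I = face (Th e') J].

(* The side of Th e opposite to its i-th vertex. *)
Definition side Th e i : set 'rV[R]_d := face (Th e) [set~ i]%SET.

Definition side_mid Th e i : 'rV[R]_d := barycenter (Th e) [set~ i]%SET.

Definition elt_mid Th e : 'rV[R]_d := barycenter (Th e) [set: 'I_d.+1]%SET.

Definition sides Th : set (set 'rV[R]_d) :=
  [set S | exists e i, S = side Th e i].

Definition boundary_sides Omega Th : set (set 'rV[R]_d) :=
  [set S | sides Th S /\ S `<=` boundary Omega].

Definition boundary_partition Omega Th (GammaD GammaN : set 'rV[R]_d) :=
  exists D : set (set 'rV[R]_d),
    [/\ D `<=` boundary_sides Omega Th, GammaD = \bigcup_(S in D) S &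
        GammaN = \bigcup_(S in boundary_sides Omega Th `\` D) S].

Definition outer_unit_normal Th e i (n : 'rV[R]_d) :=
  dot n n = 1 /\
  forall x y, simplex (Th e) x -> side Th e i y -> dot n (x - y) <= 0.

(* Elementwise defined functions are given by representatives on R^d whose
   values on the skeleton, a null set, are irrelevant: only the restrictions to
   the open elements (Th e)^o matter. trace Th w e x is the value at the point x
   of the closed element of the continuous extension of that restriction. *)
Definition trace (V : ptopologicalType) Th (w : 'rV[R]_d -> V) e
    (x : 'rV[R]_d) : V :=
  lim (w y @[y --> within (simplex (Th e))° (nbhs x)]).

Definition elementwise (V : lmodType R) Th (f : E -> 'rV[R]_d -> V)
    (x : 'rV[R]_d) : V :=
  \sum_e \1_(simplex (Th e))° x *: f e x.

Definition elt_grad Th (v : 'rV[R]_d -> R) : 'rV[R]_d -> 'rV[R]_d :=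
  elementwise Th (fun _ => grad v).

Definition elt_mean Th (v : 'rV[R]_d -> R) : 'rV[R]_d -> R :=
  elementwise (V := R^o) Th (fun e _ =>
    (fine (lebesgue_rV d (simplex (Th e))))^-1 *
    \int[lebesgue_rV d]_(y in simplex (Th e)) v y).

Definition elt_mean_vec Th (y : 'rV[R]_d -> 'rV[R]_d) (x : 'rV[R]_d) :
    'rV[R]_d :=
  \row_j elt_mean Th (fun z => y z ord0 j) x.

Definition poly_degree_le (k : nat) (p : 'rV[R]_d -> R) :=
  exists c : {ffun 'I_d -> 'I_k.+1} -> R, forall x,
    p x = \sum_(m : {ffun 'I_d -> 'I_k.+1} | (\sum_i m i <= k)%N)
            c m * \prod_i x ord0 i ^+ m i.

Definition Linfty Omega (w : 'rV[R]_d -> R) :=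
  measurable_fun Omega w /\
  exists M : R, {ae lebesgue_rV d, forall x, Omega x -> `|w x| <= M}.

Definition L2 Omega (w : 'rV[R]_d -> R) :=
  measurable_fun Omega w /\
  (\int[lebesgue_rV d]_(x in Omega) (w x ^+ 2)%:E < +oo)%E.

Definition elt_poly Omega Th (k : nat) : set ('rV[R]_d -> R) :=
  [set w | Linfty Omega w /\
    forall e, exists2 p, poly_degree_le k p &
      forall x, (simplex (Th e))° x -> w x = p x].

Definition CR Omega Th : set ('rV[R]_d -> R) :=
  [set v | elt_poly Omega Th 1 v /\
    forall e i e' i', side Th e i = side Th e' i' ->
      trace Th v e (side_mid Th e i) = trace Th v e' (side_mid Th e i)].

Definition CR_D Omega Th (GammaD : set 'rV[R]_d) : set ('rV[R]_d -> R) :=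
  [set v | CR Omega Th v /\
    forall e i, side Th e i `<=` GammaD ->
      trace Th v e (side_mid Th e i) = 0].

Definition smooth (f : 'rV[R]_d -> R) :=
  forall (vs : seq 'rV[R]_d) x,
    differentiable (foldr (fun v g => 'D_v g) f vs) x.

Definition test_function Omega (f : 'rV[R]_d -> R) :=
  [/\ smooth f, compact (closure [set x | f x != 0]) &
      closure [set x | f x != 0] `<=` Omega].

Definition weak_div Omega (y : 'rV[R]_d -> 'rV[R]_d) (g : 'rV[R]_d -> R) :=
  L2 Omega g /\
  forall f, test_function Omega f ->
    \int[lebesgue_rV d]_(x in Omega) dot (y x) (grad f x) =
    - \int[lebesgue_rV d]_(x in Omega) (g x * f x).

Definition Hdiv Omega : set ('rV[R]_d -> 'rV[R]_d) :=
  [set y : 'rV[R]_d -> 'rV[R]_d |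
    (forall j, L2 Omega (fun x => y x ord0 j)) /\
    exists g, weak_div Omega y g].

(* A representative in L^2 of the distributional divergence, which is unique up
   to null sets. *)
Definition div Omega (y : 'rV[R]_d -> 'rV[R]_d) : 'rV[R]_d -> R :=
  xget (cst 0) [set g | weak_div Omega y g].

Definition RT Omega Th : set ('rV[R]_d -> 'rV[R]_d) :=
  [set y | Hdiv Omega y /\
    forall e, exists (a : 'rV[R]_d) (b : R), forall x,
      (simplex (Th e))° x -> y x = a + b *: (x - elt_mid Th e)].

Definition RT_N Omega Th (GammaN : set 'rV[R]_d) :
    set ('rV[R]_d -> 'rV[R]_d) :=
  [set y | RT Omega Th y /\
    forall e i n x, side Th e i `<=` GammaN -> outer_unit_normal Th e i n ->
      side Th e i x -> dot (trace Th y e x) n = 0].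

End mesh.

Section energies.
Context {R : realType} {d : nat} {E : finType}.
Implicit Types (Omega : set 'rV[R]_d) (Th : E -> 'M[R]_(d.+1, d)).
Implicit Types (phi : 'rV[R]_d -> R) (psi : 'rV[R]_d -> R -> \bar R).
Local Open Scope ereal_scope.

Definition convex_ereal (f : R -> \bar R) :=
  forall (t a b : R), (0 <= t <= 1)%R ->
    f (t * a + (1 - t) * b)%R <= t%:E * f a + (1 - t)%:E * f b.

Definition elementwise_constant Th psi :=
  forall e x y r, (simplex (Th e))° x -> (simplex (Th e))° y ->
    psi x r = psi y r.

Definition conj_phi phi (s : 'rV[R]_d) : \bar R :=
  ereal_sup [set (dot s r - phi r)%:E | r in [set: 'rV[R]_d]].

Definition conj_psi psi (x : 'rV[R]_d) (s : R) : \bar R :=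
  ereal_sup [set (s * r)%:E - psi x r | r in [set: R]].

Definition I_h Omega Th phi psi (u : 'rV[R]_d -> R) : \bar R :=
  \int[lebesgue_rV d]_(x in Omega)
    ((phi (elt_grad Th u x))%:E + psi x (elt_mean Th u x)).

(* If psi x is identically +oo, then conj_psi psi x is identically -oo, and a sum
   with the value +oo of conj_phi phi is -oo by the convention of adde. *)
Definition D_h Omega Th phi psi (z : 'rV[R]_d -> 'rV[R]_d) : \bar R :=
  - \int[lebesgue_rV d]_(x in Omega)
      (conj_phi phi (elt_mean_vec Th z x) + conj_psi psi x (div Omega z x)).

End energies.

(* Main.v *)
From HB Require Import structures.
From mathcomp Require Import all_boot all_order all_algebra.
From mathcomp Require Import all_classical all_reals all_analysis.
From mathcomp Require Import perm measurable_realfun ring lra.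
Require Import Defs.

Set Implicit Arguments.
Unset Strict Implicit.
Unset Printing Implicit Defensive.

Import Order.TTheory GRing.Theory Num.Theory.
Import numFieldNormedType.Exports.

Local Open Scope classical_set_scope.
Local Open Scope ring_scope.

(** The energies see only elementwise constants: on the open element T_e they
    depend on the gradient G_e of u, the value m_e of u at the barycenter, the
    value a_e of z at the barycenter and the divergence b_e d of z. So both
    energies are finite sums over the elements ([integral_piecewise]), and
    Fenchel's inequality on each element gives
      I(u) - D(z) >= sum_e |T_e| (G_e . a_e + b_e d m_e).
    Weak duality holds because the right-hand side is 0 ([flux_balance]): it is
    the discrete integration by parts of Crouzeix-Raviart functions against
    Raviart-Thomas fields, whose pairing is exact although u jumps across sides.

    For the integration by parts, the summand of e is the sum over the sides of
    T_e of the flux of u z ([element_flux]): on a side, z has a constant normal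
    component and u may be replaced by its value at the midpoint. The area of a
    side times its outer normal is - d |T_e| times the gradient of a barycentric
    coordinate, so that fluxes are expressed by volumes alone. The two fluxes
    through an interior side cancel, since u is continuous at the midpoint, the
    normal component of z is continuous, and the scaled normals are opposite
    ([volume_bgrad_adjacent]). On a boundary side u vanishes at the midpoint or z
    has normal component 0.

    Membership of z in H(div) enters through the weak divergence only, so two
    facts about z have to be deduced by testing: the weak divergence is b_e d
    almost everywhere on T_e ([divergence_on_simplex]), and the normal component
    is continuous at the midpoints ([normal_trace_continuous]). The test functions
    are polynomials in functions t^-k exp(-1/t) of affine functions. All that is
    used about their integrals is that the integral of a derivative over the space
    vanishes, and so does its integral over a half-space if the direction is
    tangential or the function is 0 on the boundary; this follows from the
    translation invariance of the Lebesgue measure ([integral_half_space]). The behaviour of that measure under the few linear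
    maps that occur is derived from translation invariance as well
    ([lebesgue_linear], [lebesgue_rank1]).

    The geometric input is that a side whose midpoint is in the domain has exactly
    one further element at it ([exists_neighbor], [neighbor_unique]), and that any
    other side is contained in the boundary ([boundary_side]). *)

(** Instance resolution does not unfold the neighbourhoods of a row vector to
    those of the underlying matrix space by itself. *)
#[global] Instance rV_nbhs_filter (R : realType) d (x : 'rV[R]_d) :
  ProperFilter (nbhs x).
Proof. exact: nbhs_pfilter. Qed.

(** * Borel sets of R^n *)

Section measurability.
Context {R : realType}.

Lemma rV_ballE n (x y : 'rV[R]_n) e : 0 < e ->
  ball x e y <-> forall i, `|x ord0 i - y ord0 i| < e.
Proof.
move=> e0; split=> [[_ xy] i|xy]; first exact: xy.
by split=> // i j; rewrite ord1; exact: xy.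
Qed.

Lemma coord_le_norm n (x : 'rV[R]_n) i : `|x ord0 i| <= `|x|.
Proof.
rewrite [leRHS]/Num.Def.normr /= mx_normrE; apply/bigmax_geP; right => /=.
by exists (ord0, i).
Qed.

Lemma norm_le_coord n (x : 'rV[R]_n) M : 0 <= M ->
  (forall i, `|x ord0 i| <= M) -> `|x| <= M.
Proof.
move=> M0 xM; rewrite [leLHS]/Num.Def.normr /= mx_normrE; apply/bigmax_leP; split=> //=.
by move=> [i j] _ /=; rewrite ord1.
Qed.

Lemma measurable_fun_coord_itv n (i : 'I_n) (r s : R) :
  measurable [set x : 'rV[R]_n | r < x ord0 i < s].
Proof.
rewrite (_ : [set x | _] = setT `&` (fun x : 'rV[R]_n => x ord0 i) @^-1` `]r, s[%classic).
  by apply: measurable_rV_coord => //; exact: measurable_itv.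
by rewrite setTI; apply/seteqP; split=> x /=; rewrite in_itv.
Qed.

Lemma measurable_forall (I : finType) d (T : measurableType d)
    (P : I -> set T) :
  (forall i, measurable (P i)) -> measurable [set x | forall i, P i x].
Proof.
move=> mP; rewrite (_ : [set x | _] = \big[setI/setT]_(i : I) P i).
  by apply: bigsetI_measurable => i _; exact: mP.
rewrite -bigcap_seq; apply/seteqP; split=> [x Px i _|x Px i]; first exact: Px.
by apply: Px; rewrite /= mem_index_enum.
Qed.

(** The sigma-algebra is generated by the coordinates; an open set is the
    countable union of the rational boxes that it contains. *)
Lemma open_measurable_rV n (U : set 'rV[R]_n) : open U -> measurable U.
Proof.
move=> oU.
pose box (p : {ffun 'I_n -> rat * rat}) : set 'rV[R]_n :=
  [set x | forall i, ratr (p i).1 < x ord0 i < ratr (p i).2].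
rewrite (_ : U = \bigcup_p (if `[< box p `<=` U >] then box p else set0)).
  apply: countable_bigcupT_measurable => // p.
  case: ifP => _; last exact: measurable0.
  by apply: (@measurable_forall 'I_n) => i; exact: measurable_fun_coord_itv.
apply/seteqP; split=> [x Ux|x [p _]]; last by case: asboolP => // + px; exact.
have [e /= e0 eU] : nbhs_ball x U by apply/nbhs_ballP; rewrite nbhsE; exists U.
have lft i : exists q : rat, x ord0 i - e < ratr q < x ord0 i.
  have /rat_in_itvoo[q] : x ord0 i - e < x ord0 i by lra.
  by rewrite in_itv /=; exists q.
have rgt i : exists q : rat, x ord0 i < ratr q < x ord0 i + e.
  have /rat_in_itvoo[q] : x ord0 i < x ord0 i + e by lra.
  by rewrite in_itv /=; exists q.
pose p := [ffun i => (projT1 (cid (lft i)), projT1 (cid (rgt i)))].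
have pE i : x ord0 i - e < ratr (p i).1 < x ord0 i /\
            x ord0 i < ratr (p i).2 < x ord0 i + e.
  by rewrite ffunE /=; case: cid => ? ?; case: cid.
exists p => //; case: asboolP => [_|[]].
  by move=> i; have [/andP[_ ->] /andP[-> _]] := pE i.
move=> y py; apply: eU; apply/rV_ballE => // i.
have /andP[yl yr] := py i; have [/andP[? ?] /andP[? ?]] := pE i.
by rewrite ltr_norml; apply/andP; split; lra.
Qed.

Lemma continuous_measurable_rV n (f : 'rV[R]_n -> R) : continuous f ->
  measurable_fun setT f.
Proof.
move=> cf; apply: (measurability _ (RGenOInfty.measurableE R)) => //.
move=> /= _ [_ [x ->] <-]; rewrite setTI; apply: open_measurable_rV.
by apply: open_comp => // y _; exact: cf.
Qed.

End measurability.

(** * Invariance of the Lebesgue measure *)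

Section lebesgue_translation.
Context {R : realType}.

(** The translated measure agrees with the Lebesgue measure on intervals, which
    determine it. *)
Lemma lebesgue_measure_translate (a : R) (A : set R) : measurable A ->
  pushforward lebesgue_measure (fun x : R => (x + a : measurableTypeR R)) A =
  lebesgue_measure A.
Proof.
pose g : measurableTypeR R -> measurableTypeR R := fun x : R => x + a.
have mg : measurable_fun [set: measurableTypeR R] g.
  by apply: measurable_funD => //; exact: measurable_cst.
move=> mA; apply/esym.
pose f : {mfun (measurableTypeR R) >-> (measurableTypeR R)} :=
  HB.pack g (isMeasurableFun.Build _ _ _ _ _ mg).
apply: (lebesgue_measure_unique (mu := pushforward lebesgue_measure f)) mA => _ [[b c]] _ <-.
transitivity (lebesgue_measure (`]b - a, c - a]%classic : set R)).
  rewrite !lebesgue_measure_itv/= !lte_fin ltrD2r; case: ifP => // _.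
  by rewrite -!EFinB; congr EFin; ring.
congr (lebesgue_measure _).
by apply/seteqP; split => x /=; rewrite !in_itv /= /g ltrBlDr lerBrDr.
Qed.

Lemma rV_cons_head n x (w : 'rV[R]_n) : rV_cons (x, w) ord0 ord0 = x.
Proof.
rewrite /rV_cons (_ : ord0 = lshift n (ord0 : 'I_1)); last exact: val_inj.
by rewrite (row_mxEl (_ : 'rV[R]_1)) mxE.
Qed.

Lemma rV_cons_tail n x (w : 'rV[R]_n) j :
  rV_cons (x, w) ord0 (rshift 1 j) = w ord0 j.
Proof. by rewrite /rV_cons (row_mxEr (_ : 'rV[R]_1)). Qed.

Lemma rV_head_tail n (P : 'I_n.+1 -> Prop) :
  P ord0 -> (forall j : 'I_n, P (rshift 1 j)) -> forall i, P i.
Proof.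
move=> P0 PS i; case: (splitP (i : 'I_(1 + n))) => j ij.
  by rewrite (_ : i = ord0)//; apply: val_inj; rewrite [LHS]ij [j]ord1.
by rewrite (_ : i = rshift 1 j)//; exact: val_inj.
Qed.

Lemma lebesgue_rVSE n (A : set 'rV[R]_n.+1) :
  lebesgue_rV n.+1 A =
  (\int[lebesgue_measure]_(x in [set: R]) lebesgue_rV n (xsection (@rV_cons R n @^-1` A) x))%E.
Proof. by []. Qed.

(** Induction on the dimension: the inner integral is invariant by hypothesis,
    the outer one by invariance on the line. *)
Lemma lebesgue_rV_translate n (v : 'rV[R]_n) A : measurable A ->
  lebesgue_rV n [set x | A (x + v)] = lebesgue_rV n A.
Proof.
elim: n v A => [|n IH] v A mA.
  by congr (lebesgue_rV 0 _); apply/funext => x; rewrite /= (thinmx0 v) addr0.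
rewrite !lebesgue_rVSE.
set h := fun x : R => lebesgue_rV n (xsection (@rV_cons R n @^-1` A) x).
have mA' : measurable (@rV_cons R n @^-1` A).
  by rewrite -[X in measurable X]setTI; exact: measurable_rV_cons.
pose v' : 'rV[R]_n := \row_j v ord0 (rshift 1 j).
have vE x w : rV_cons (x, w) + v = rV_cons (x + v ord0 ord0, w + v').
  apply/rowP; apply: rV_head_tail => [|j].
    by rewrite mxE !rV_cons_head.
  by rewrite mxE !rV_cons_tail !mxE.
transitivity (\int[lebesgue_measure]_(x in [set: R]) h (x + v ord0 ord0)%R)%E.
  apply: eq_integral => x _; rewrite /h -[RHS](IH v'); last exact: measurable_xsection.
  congr (lebesgue_rV n _); by apply/seteqP; split=> w; rewrite /xsection /= !inE /= vE.
have mh : measurable_fun [set: R] h by exact: measurable_fun_xsection.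
pose g : measurableTypeR R -> measurableTypeR R := fun x : R => x + v ord0 ord0.
have mg : measurable_fun [set: measurableTypeR R] g.
  by apply: measurable_funD => //; exact: measurable_cst.
transitivity (\int[pushforward lebesgue_measure g]_(x in setT) h x)%E; last first.
  apply: eq_measure_integral => B mB _.
  exact: (lebesgue_measure_translate (v ord0 ord0)).
by rewrite (ge0_integral_pushforward mg).
Qed.

Lemma lebesgue_rV_box n (I : set R) (B : set 'rV[R]_n) :
  measurable I -> measurable B ->
  lebesgue_rV n.+1 [set x | I (x ord0 ord0) /\ B (\row_j x ord0 (rshift 1 j))] =
  (lebesgue_measure I * lebesgue_rV n B)%E.
Proof.
move=> mI mB; rewrite -[RHS]product_measure1E//.
congr ((lebesgue_measure \x lebesgue_rV n)%E _).
apply/seteqP; split=> -[x w] /=; rewrite rV_cons_head => -[Ix Bw]; split=> //.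
  by move: Bw; congr B; apply/rowP => j; rewrite mxE rV_cons_tail.
by move: Bw; congr B; apply/rowP => j; rewrite mxE rV_cons_tail.
Qed.

Definition cube n (r : R) : set 'rV[R]_n := [set x | forall i, `|x ord0 i| <= r].

Lemma measurable_coord_le n (i : 'I_n) (a : R) (r : R) :
  measurable [set x : 'rV[R]_n | `|a * x ord0 i| <= r].
Proof.
rewrite (_ : [set x | _] =
  setT `&` (fun x : 'rV[R]_n => a * x ord0 i) @^-1` `[- r, r]%classic).
  have : measurable_fun setT (fun x : 'rV[R]_n => a * x ord0 i).
    by apply: measurable_funM; [exact: measurable_cst|exact: measurable_rV_coord].
  by apply => //; exact: measurable_itv.
by rewrite setTI; apply/seteqP; split=> x /=; rewrite in_itv /= ler_norml.
Qed.

Lemma measurable_cube n r : measurable (@cube n r).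
Proof.
apply: measurable_forall => i; have := measurable_coord_le i 1 r.
by congr measurable; apply/seteqP; split => x /=; rewrite mul1r.
Qed.

(** The cube squeezed by 1 / a in its first coordinate, from which
    [lebesgue_rank1] reads off the factor of a diagonal map. *)
Lemma lebesgue_cube_scale n (a r : R) : a != 0 -> 0 <= r ->
  lebesgue_rV n.+1 [set x | `|a * x ord0 ord0| <= r /\
                            cube r (\row_j x ord0 (rshift 1 j))] =
  ((2 * r / `|a|)%:E * lebesgue_rV n (cube r))%E.
Proof.
move=> a0 r0; have a_gt0 : 0 < `|a| by rewrite normr_gt0.
have IE : [set x : R | `|a * x| <= r] = `[- (r / `|a|), r / `|a|]%classic.
  apply/seteqP; split => x /=; rewrite in_itv /= -ler_norml ler_pdivlMr// normrM;
    by rewrite mulrC.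
have mI : measurable [set x : R | `|a * x| <= r].
  by rewrite IE; exact: measurable_itv.
rewrite [LHS](lebesgue_rV_box mI (@measurable_cube n r)); congr (_ * _)%E.
rewrite IE lebesgue_measure_itv/= lte_fin.
have ra0 : 0 <= r / `|a| by rewrite divr_ge0// ltW.
case: ifPn => [_|]; first by rewrite -EFinB; congr EFin; field; rewrite gt_eqF.
rewrite -leNgt => ?; have ra00 : r / `|a| = 0 by apply/eqP; rewrite eq_le ra0 andbT; lra.
by congr EFin; rewrite -mulrA ra00 mulr0.
Qed.

Lemma cubeSE n (r : R) :
  @cube n.+1 r = [set x | `|1 * x ord0 ord0| <= r /\
                          cube r (\row_j x ord0 (rshift 1 j))].
Proof.
apply/seteqP; split=> x /=; rewrite /cube /=.
  by move=> xr; rewrite mul1r; split=> // i; rewrite mxE.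
by rewrite mul1r => -[x0 xr]; apply: rV_head_tail => // j; have := xr j; rewrite mxE.
Qed.

Lemma lebesgue_cube n (r : R) : 0 <= r ->
  lebesgue_rV n (cube r) = ((2 * r) ^+ n)%:E.
Proof.
move=> r0; elim: n => [|n IH].
  have -> : @cube 0 r = setT by apply/seteqP; split=> // x _ [].
  by rewrite /= diracT.
rewrite cubeSE [LHS](@lebesgue_cube_scale n 1)// IH.
by rewrite -EFinM; congr EFin; rewrite normr1 divr1 exprS.
Qed.

Lemma bounded_subset_cube n (A : set 'rV[R]_n) : bounded_set A ->
  exists2 r, 0 < r & A `<=` cube r.
Proof.
move=> [M [_ hM]]; exists (`|M| + 1); first by rewrite ltr_wpDl.
move=> x Ax i; apply: le_trans (coord_le_norm _ _) _.
by apply: hM => //; rewrite (le_lt_trans (ler_norm _))// ltrDl.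
Qed.

Lemma lebesgue_rV_bounded n (A : set 'rV[R]_n) : measurable A -> bounded_set A ->
  (lebesgue_rV n A < +oo)%E.
Proof.
move=> mA /bounded_subset_cube[r r0 Ar].
apply: (@le_lt_trans _ _ (lebesgue_rV n (cube r))).
  by apply: le_measure; rewrite ?inE//; exact: measurable_cube.
by rewrite lebesgue_cube ?ltry// ltW.
Qed.

Lemma lebesgue_rV_open n (A : set 'rV[R]_n) : open A -> A !=set0 ->
  (0 < lebesgue_rV n A)%E.
Proof.
move=> oA [x Ax].
have [e /= e0 eA] : nbhs_ball x A by apply/nbhs_ballP; rewrite nbhsE; exists A.
apply: (@lt_le_trans _ _ (lebesgue_rV n (cube (e / 2)))).
  by rewrite lebesgue_cube ?divr_ge0 ?lte_fin ?exprn_gt0 ?mulr_gt0 ?divr_gt0 ?ltW.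
have mA := open_measurable_rV oA.
rewrite -(lebesgue_rV_translate (- x) (@measurable_cube n (e / 2))).
apply: le_measure; rewrite ?inE//.
  rewrite (_ : [set y | _] = [set y : 'rV[R]_n | forall i, `|y ord0 i - x ord0 i| <= e / 2]).
    apply: (@measurable_forall 'I_n) => i.
    rewrite [X in measurable X](_ : _ = setT `&` (fun y : 'rV[R]_n => y ord0 i) @^-1`
      `[x ord0 i - e / 2, x ord0 i + e / 2]%classic).
      by apply: measurable_rV_coord => //; exact: measurable_itv.
    by rewrite setTI; apply/seteqP; split=> y /=; rewrite in_itv /= ler_distl.
  by apply/seteqP; split=> y /= h i; have := h i; rewrite !mxE.
move=> y /= h; apply: eA; apply/rV_ballE => // i.
by have := h i; rewrite !mxE distrC => /le_lt_trans; apply; lra.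
Qed.

Lemma measurable_rV_shift n (v : 'rV[R]_n) :
  measurable_fun setT (fun x : 'rV[R]_n => x + v).
Proof.
apply: measurable_fun_rV => i; under eq_fun do rewrite mxE.
by apply: measurable_funD; [exact: measurable_rV_coord|exact: measurable_cst].
Qed.

(** A change of variables needs only the effect of the map on measures of
    sets. *)
Lemma ge0_integral_scaling n (g : 'rV[R]_n -> 'rV[R]_n) (c : {nonneg R})
    (f : 'rV[R]_n -> \bar R) :
  measurable_fun setT g ->
  (forall B, measurable B -> lebesgue_rV n (g @^-1` B) = c%:num%:E * lebesgue_rV n B)%E ->
  measurable_fun setT f -> (forall x, 0 <= f x)%E ->
  (\int[lebesgue_rV n]_x f (g x) = c%:num%:E * \int[lebesgue_rV n]_x f x)%E.
Proof.
move=> mg gc mf f0.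
rewrite -(ge0_integral_pushforward mg (lebesgue_rV n) measurableT mf)//.
rewrite -ge0_integral_mscale//.
by apply: eq_measure_integral => B mB _; exact: gc.
Qed.

Lemma ge0_integral_shift n (v : 'rV[R]_n) (f : 'rV[R]_n -> \bar R) :
  measurable_fun setT f -> (forall x, 0 <= f x)%E ->
  (\int[lebesgue_rV n]_x f (x + v)%R = \int[lebesgue_rV n]_x f x)%E.
Proof.
move=> mf f0; rewrite (ge0_integral_scaling (c := 1%:nng)) ?mul1e//.
  exact: measurable_rV_shift.
by move=> B mB /=; rewrite mul1e; exact: lebesgue_rV_translate.
Qed.

End lebesgue_translation.

(** * Linear images of the Lebesgue measure *)

Section linear_change.
Context {R : realType}.

Lemma measurable_mulmx n m (A : 'M[R]_(n, m)) :
  measurable_fun setT (fun x : 'rV[R]_n => x *m A).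
Proof.
apply: measurable_fun_rV => i; under eq_fun do rewrite mxE.
apply: measurable_sum => j.
by apply: measurable_funM; [exact: measurable_rV_coord|exact: measurable_cst].
Qed.

Lemma measurable_addrV d (T : measurableType d) n (f g : T -> 'rV[R]_n) :
  measurable_fun setT f -> measurable_fun setT g ->
  measurable_fun setT (fun x => f x + g x).
Proof.
move=> mf mg; apply: measurable_fun_rV => i; under eq_fun do rewrite mxE.
by apply: measurable_funD;
  [apply: (measurableT_comp (measurable_rV_coord i) mf)
  |apply: (measurableT_comp (measurable_rV_coord i) mg)].
Qed.

Lemma measurable_preim d d' (T : measurableType d) (T' : measurableType d')
    (f : T -> T') (B : set T') :
  measurable_fun setT f -> measurable B -> measurable [set x | B (f x)].
Proof. by move=> mf mB; rewrite -[X in measurable X]setTI; exact: mf. Qed.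

Lemma tonelli_set n m (W : set ('rV[R]_n * 'rV[R]_m)) : measurable W ->
  (\int[lebesgue_rV n]_x lebesgue_rV m [set y | W (x, y)] =
   \int[lebesgue_rV m]_y lebesgue_rV n [set x | W (x, y)])%E.
Proof.
move=> mW; have := indic_fubini_tonelli (lebesgue_rV n) (lebesgue_rV m) mW.
rewrite indic_fubini_tonelli_FE// indic_fubini_tonelli_GE//=.
set a := integral _ _ _; set b := integral _ _ _ => ab.
transitivity a; [|transitivity b => //]; apply: eq_integral => x _;
  by congr (_ _); apply/seteqP; split=> y;
    rewrite /xsection /ysection /= inE.
Qed.

Lemma integral_set_cond n m (X : set 'rV[R]_n) (P : 'rV[R]_n -> set 'rV[R]_m) c :
  measurable X -> (forall y, X y -> lebesgue_rV m (P y) = c) ->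
  (\int[lebesgue_rV n]_y lebesgue_rV m [set x | X y /\ P y x] =
   c * lebesgue_rV n X)%E.
Proof.
move=> mX Pc; rewrite -(integral_cst _ mX) [RHS]integral_mkcond.
apply: eq_integral => y _; rewrite patchE; case: ifPn => [|]; rewrite ?inE ?notin_setE => Xy.
  by rewrite -(Pc _ Xy); congr (_ _); apply/seteqP; split=> x /=; [case|].
by rewrite (_ : [set x | _] = set0) ?measure0//; apply/seteqP; split=> x //= -[].
Qed.

(** The uniqueness argument for translation-invariant measures. Compute the
    measure of the pairs (x, y) with y in the cube Y and x A + y in X in two
    ways by Tonelli. Integrating over x first gives |A^-1 X| |Y|, by translation
    invariance in x; substituting y := y - x A and integrating over x first gives
    |A^-1 (- Y)| |X|. Hence |A^-1 X| is a multiple of |X|, and the factor is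
    finite since A^-1 (- Y) is bounded. *)
Lemma lebesgue_linear n (A : 'M[R]_n) : A \in unitmx ->
  exists2 c : R, 0 <= c & forall X, measurable X ->
    lebesgue_rV n [set x | X (x *m A)] = (c%:E * lebesgue_rV n X)%E.
Proof.
move=> uA; pose Y : set 'rV[R]_n := cube 1.
have mY : measurable Y by exact: measurable_cube.
pose L := lebesgue_rV (R := R) n.
have mxA := measurable_mulmx A.
have m1 : measurable_fun setT (fst : 'rV[R]_n * 'rV[R]_n -> _) by exact: measurable_fst.
have m2 : measurable_fun setT (snd : 'rV[R]_n * 'rV[R]_n -> _) by exact: measurable_snd.
pose D := [set x | Y (- (x *m A))].
have key X : measurable X ->
    (L [set x | X (x *m A)%R] * L Y = L D * L X)%E.
  move=> mX.
  rewrite -(@integral_set_cond n n Y (fun y => [set x | X (x *m A + y)]))//; last first.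
    move=> y _; rewrite -[RHS](lebesgue_rV_translate (y *m invmx A)).
      by congr (_ _); apply/seteqP; split=> x /=; rewrite mulmxDl mulmxKV.
    exact: measurable_preim.
  rewrite -(@integral_set_cond n n X (fun y => [set x | Y (y - x *m A)]))//; last first.
    move=> y _; rewrite -[LHS](lebesgue_rV_translate (y *m invmx A)).
      congr (_ _); apply/seteqP; split=> x /=; rewrite mulmxDl mulmxKV//;
        by rewrite opprD addrCA subrr addr0.
    apply: (measurable_preim (f := fun x : 'rV[R]_n => y - x *m A) (B := Y)) => //.
    apply: measurable_addrV => //.
    rewrite (_ : (fun x => _) = (fun x => x *m (- A))); first exact: measurable_mulmx.
    by apply/funext => x; rewrite mulmxN.
  rewrite -(@tonelli_set n n [set p | Y p.2 /\ X (p.1 *m A + p.2)]); last first.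
    apply: (@measurableI _ _ [set p | Y p.2] [set p | X (p.1 *m A + p.2)]).
      exact: measurable_preim.
    apply: (measurable_preim (f := fun p : 'rV[R]_n * 'rV[R]_n => p.1 *m A + p.2)) => //.
    by apply: measurable_addrV => //; exact: (measurableT_comp mxA m1).
  rewrite -(@tonelli_set n n [set p | X p.2 /\ Y (p.2 - p.1 *m A)]); last first.
    apply: (@measurableI _ _ [set p | X p.2] [set p | Y (p.2 - p.1 *m A)]).
      exact: measurable_preim.
    apply: (measurable_preim (f := fun p : 'rV[R]_n * 'rV[R]_n => p.2 - p.1 *m A)) => //.
    apply: measurable_addrV => //.
    rewrite (_ : (fun x => _) = (fun x => x *m (- A)) \o fst).
      exact: (measurableT_comp (measurable_mulmx (- A)) m1).
    by apply/funext => x /=; rewrite mulmxN.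
  apply: eq_integral => x _ /=.
  rewrite -[RHS](lebesgue_rV_translate (x *m A)) /=.
    congr (_ _); apply/seteqP; split=> y /=; rewrite addrK; first by move=> [? ?]; rewrite addrC.
    by rewrite addrC => -[].
  apply: (@measurableI _ _ X [set y | Y (y - x *m A)]) => //.
  apply: (measurable_preim (f := fun y : 'rV[R]_n => y - x *m A)) => //.
  exact: measurable_rV_shift.
have LY : L Y = (2 ^+ n)%:E by rewrite /L /Y lebesgue_cube// mulr1.
pose c := fine (L D) / 2 ^+ n.
have mD : measurable D.
  apply: (measurable_preim (f := fun x : 'rV[R]_n => - (x *m A))) => //.
  rewrite (_ : (fun x => _) = (fun x => x *m (- A))); first exact: measurable_mulmx.
  by apply/funext => x; rewrite mulmxN.
have Dfin : L D \is a fin_num.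
  rewrite ge0_fin_numE//; apply: lebesgue_rV_bounded => //.
  pose r := \sum_i \sum_j `|invmx A i j|.
  have r0 : 0 <= r by rewrite /r; apply: sumr_ge0 => i _; apply: sumr_ge0.
  exists r; split; first exact: num_real.
  move=> s rs x /= Yx; apply: (le_trans _ (ltW rs)).
  apply: norm_le_coord => // j.
  rewrite -[x](mulmxK uA) mxE; apply: (le_trans (ler_norm_sum _ _ _)).
  rewrite /r; apply: ler_sum => i _; rewrite normrM.
  rewrite (bigD1 j)//= -[leLHS]addr0; apply: lerD; last exact: sumr_ge0.
  by apply: ler_piMl => //; have := Yx i; rewrite !mxE normrN.
exists c; first by rewrite divr_ge0// fine_ge0.
move=> X mX; have /= := key X mX; rewrite LY.
have p2 : (2 ^+ n : R) != 0 by rewrite expf_neq0.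
rewrite -(fineK Dfin) => /(congr1 (fun z => z * (2 ^+ n)^-1%:E)%E).
rewrite -muleA -EFinM divff// mule1 => ->.
by rewrite muleAC -EFinM.
Qed.

Lemma lebesgue_coord_hyperplane m (c : R) :
  lebesgue_rV m.+1 [set x | x ord0 ord0 = c] = 0%E.
Proof.
transitivity (lebesgue_rV m.+1 [set x | [set c] (x ord0 ord0) /\
                             [set: 'rV[R]_m] (\row_j x ord0 (rshift 1 j))]).
  by congr (lebesgue_rV m.+1 _); apply/seteqP; split => x //=; case.
rewrite [LHS](@lebesgue_rV_box _ _ [set c] setT)//.
by rewrite lebesgue_measure_set1 mul0e.
Qed.

(** A basis, given by the rows of B, in which the functional l is the first
    coordinate and w the first basis vector. It is built from the Gaussian
    elimination of l, followed by a shear that moves w into place. *)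
Lemma adapted_basis m (l : 'cV[R]_(1 + m)) (w : 'rV[R]_(1 + m)) :
  w *m l = 1%:M ->
  exists2 B : 'M[R]_(1 + m), B \in unitmx &
    w = row_mx 1%:M 0 *m B /\ B *m l = col_mx 1%:M 0.
Proof.
move=> wl1.
have l0 : l != 0.
  apply: contra_eq_neq wl1 => ->; rewrite mulmx0 eq_sym.
  exact: oner_neq0.
have rl : \rank l = 1%N.
  by apply/eqP; rewrite eqn_leq rank_leq_col lt0n mxrank_eq0.
pose U := invmx (row_ebase l 0 0 *: col_ebase l).
have a0 : row_ebase l 0 0 != 0.
  by have := row_ebase_unit l; rewrite unitmxE det_mx11 unitfE.
have uV : row_ebase l 0 0 *: col_ebase l \in unitmx.
  by rewrite unitmxZ ?unitfE// col_ebase_unit.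
have Ul : U *m l = col_mx 1%:M 0.
  rewrite -[l in LHS]mulmx_ebase rl [row_ebase l]mx11_scalar mul_mx_scalar.
  rewrite scalemxAl mulKmx//.
  exact: (pid_mx_col R m 1).
pose w' := w *m invmx U.
have w'1 : lsubmx w' = 1%:M.
  have : w' *m (U *m l) = 1%:M by rewrite mulmxA mulmxKV// unitmx_inv.
  by rewrite Ul -{1}[w']hsubmxK mul_row_col mulmx1 mulmx0 addr0.
exists (block_mx 1%:M (rsubmx w') 0 1%:M *m U).
  rewrite unitmx_mul unitmx_inv uV andbT unitmxE.
  by rewrite det_ublock !det1 mulr1 unitr1.
split; last by rewrite -mulmxA Ul mul_block_col !mulmx1 !mulmx0 !addr0.
rewrite mulmxA mul_row_block !mul1mx !mul0mx !addr0 -w'1 hsubmxK.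
by rewrite /w' mulmxKV// unitmx_inv.
Qed.

(** In an adapted basis the map x + l(x) w multiplies the first coordinate by
    1 + s, so it is conjugate to a diagonal map D. The factors of the change of
    basis B and of its inverse cancel, and the factor of D is found by measuring
    a cube. *)
Lemma lebesgue_rank1 m (l : 'cV[R]_(1 + m)) (w : 'rV[R]_(1 + m)) (s : R) X :
  w *m l = s%:M -> s != 0 -> 1 + s != 0 -> measurable X ->
  lebesgue_rV (1 + m) [set x | X (x + x *m l *m w)] =
  ((`|1 + s|^-1)%:E * lebesgue_rV (1 + m) X)%E.
Proof.
move=> wl s0 s1 mX.
have [B uB [wB Bl]] : exists2 B : 'M[R]_(1 + m), B \in unitmx &
    s^-1 *: w = row_mx 1%:M 0 *m B /\ B *m l = col_mx 1%:M 0.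
  by apply: adapted_basis; rewrite -scalemxAl wl scale_scalar_mx mulVf//.
pose D : 'M[R]_(1 + m) := block_mx (1 + s)%:M 0 0 1%:M.
have wE : w = s *: (row_mx 1%:M 0 *m B).
  by rewrite -wB scalerA divff// scale1r.
have DE : D = 1%:M + s *: (col_mx 1%:M 0 *m row_mx 1%:M 0).
  rewrite mul_col_row !mulmx1 !mul0mx mulmx0 scale_block_mx !scaler0.
  rewrite scalar_mx_block add_block_mx !addr0 scale_scalar_mx mulr1.
  by rewrite /D -raddfD.
have BM x : x + x *m l *m w = x *m invmx B *m D *m B.
  rewrite DE mulmxDr mulmx1 mulmxDl mulmxKV//; congr (_ + _).
  rewrite wE -scalemxAr -(scalemxAr s) -scalemxAl; congr (_ *: _).
  by rewrite -Bl !mulmxA mulmxKV.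
have uD : D \in unitmx.
  by rewrite unitmxE det_ublock det_scalar det1 mulr1 expr1 unitfE.
have [c c0 cE] := lebesgue_linear uD.
have [b b0 bE] := lebesgue_linear uB.
have uB' : invmx B \in unitmx by rewrite unitmx_inv.
have [b' b'0 b'E] := lebesgue_linear uB'.
pose Y : set 'rV[R]_(1 + m) := cube 1.
have mY : measurable Y by exact: measurable_cube.
have LY r : 0 <= r -> lebesgue_rV (1 + m) (cube r) = ((2 * r) ^+ (1 + m))%:E by exact: lebesgue_cube.
have mpre (A : 'M[R]_(1 + m)) (Z : set 'rV[R]_(1 + m)) : measurable Z ->
    measurable [set x | Z (x *m A)].
  by move=> mZ; apply: measurable_preim => //; exact: measurable_mulmx.
have bb' : b' * b = 1.
  have : lebesgue_rV (1 + m) [set x | Y (x *m invmx B *m B)] = lebesgue_rV (1 + m) Y.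
    by congr (_ _); apply/seteqP; split=> x /=; rewrite mulmxKV.
  rewrite (b'E [set x | Y (x *m B)] (mpre _ _ mY)) bE// LY// -!EFinM => -[].
  rewrite mulrA mulr1 => /eqP; rewrite -subr_eq0 -{2}[_ ^+ _]mul1r -mulrBl mulf_eq0.
  by rewrite subr_eq0 expf_eq0 pnatr_eq0 andbF orbF => /eqP.
have cE' : c = `|1 + s|^-1.
  have := cE Y mY; rewrite LY// mulr1.
  rewrite (_ : [set x | Y (x *m D)] = [set x | `|(1 + s) * x ord0 ord0| <= 1 /\
      cube 1 (\row_j x ord0 (rshift 1 j))]).
    rewrite [X in X = _ -> _](@lebesgue_cube_scale _ m (1 + s) 1)// lebesgue_cube//.
    rewrite -!EFinM => -[] /esym; rewrite !mulr1 exprS mulrA.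
    have p2 : (2 ^+ m : R) != 0 by rewrite expf_neq0.
    move=> /(mulIf p2) /(congr1 (fun z => z / 2)); rewrite mulfK// => ->.
    by field; rewrite normr_eq0.
  have xD x : x *m D = row_mx ((1 + s) *: lsubmx x) (rsubmx x).
    rewrite -[x in LHS]hsubmxK mul_row_block !mulmx0 addr0 add0r mulmx1.
    by rewrite mul_mx_scalar.
  have xD0 x : (x *m D) ord0 ord0 = (1 + s) * x ord0 ord0.
    rewrite xD (_ : ord0 = lshift m (ord0 : 'I_1)); last exact: val_inj.
    by rewrite row_mxEl !mxE.
  have xDS x : \row_j (x *m D) ord0 (rshift 1 j) = \row_j x ord0 (rshift 1 j).
    by apply/rowP => j; rewrite [LHS]mxE [RHS]mxE xD row_mxEr !mxE.
  rewrite /Y [cube 1](@cubeSE R m); apply/seteqP.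
  by split=> x /=; rewrite xD0 mul1r xDS.
have BX : [set x | X (x + x *m l *m w)] = [set x | X (x *m invmx B *m D *m B)].
  by apply/seteqP; split=> x /=; rewrite BM.
rewrite BX (b'E [set y | X (y *m D *m B)]); last first.
  exact: (mpre D [set y | X (y *m B)] (mpre _ _ _)).
rewrite (cE [set y | X (y *m B)]); last exact: mpre.
by rewrite bE// !muleA -!EFinM mulrAC bb' mul1r cE'.
Qed.

End linear_change.

(** * Barycentric coordinates *)

Section dot_product.
Context {R : realType} {d : nat}.
Implicit Types (x y v g : 'rV[R]_d).

Lemma dotC x y : dot x y = dot y x.
Proof. by apply: eq_bigr => i _; rewrite mulrC. Qed.

Lemma dotDl x y g : dot (x + y) g = dot x g + dot y g.
Proof. by rewrite -big_split /=; apply: eq_bigr => i _; rewrite mxE mulrDl. Qed.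

Lemma dotZl a x g : dot (a *: x) g = a * dot x g.
Proof. by rewrite /dot mulr_sumr; apply: eq_bigr => i _; rewrite mxE mulrA. Qed.

Lemma dotNl x g : dot (- x) g = - dot x g.
Proof. by rewrite -scaleN1r dotZl mulN1r. Qed.

Lemma dotBl x y g : dot (x - y) g = dot x g - dot y g.
Proof. by rewrite dotDl dotNl. Qed.

Lemma dot0l g : dot 0 g = 0.
Proof. by rewrite -(scale0r (0 : 'rV_d)) dotZl mul0r. Qed.

Lemma dotDr x g y : dot x (g + y) = dot x g + dot x y.
Proof. by rewrite !(dotC x) dotDl. Qed.

Lemma dotZr a x g : dot x (a *: g) = a * dot x g.
Proof. by rewrite !(dotC x) dotZl. Qed.

Lemma dotNr x g : dot x (- g) = - dot x g.
Proof. by rewrite !(dotC x) dotNl. Qed.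

Lemma dot0r g : dot g 0 = 0.
Proof. by rewrite dotC dot0l. Qed.

Lemma dot_suml (I : Type) (r : seq I) (F : I -> 'rV[R]_d) g :
  dot (\sum_(i <- r) F i) g = \sum_(i <- r) dot (F i) g.
Proof.
by elim: r => [|i r IH]; rewrite ?big_nil ?dot0l// !big_cons dotDl IH.
Qed.

Lemma dot_mulmx x g : x *m g^T = (dot x g)%:M.
Proof.
apply/matrixP => i j; rewrite !ord1 !mxE eqxx mulr1n.
by apply: eq_bigr => k _; rewrite !mxE.
Qed.

Lemma dot_delta i x : dot (delta_mx ord0 i) x = x ord0 i.
Proof.
rewrite /dot (bigD1 i)//= big1 => [|j ji]; rewrite !mxE ?eqxx ?mul1r ?addr0//.
by rewrite (negbTE ji) mul0r.
Qed.

Lemma dot_gt0 g : g != 0 -> 0 < dot g g.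
Proof.
move=> g0; rewrite lt_def sumr_ge0 ?andbT => [|i _]; last by rewrite -expr2 sqr_ge0.
apply: contra g0 => /eqP/psumr_eq0P gg; apply/eqP/rowP => i.
have /eqP := gg (fun i _ => sqr_ge0 _) i isT.
by rewrite mulf_eq0 orbb mxE => /eqP.
Qed.

Lemma continuous_dot g : continuous (fun x => dot x g).
Proof.
suff H (x : 'rV[R]_d) r : (fun y : 'rV[R]_d => \sum_(i <- r) y ord0 i * g ord0 i) @ x --> \sum_(i <- r) x ord0 i * g ord0 i.
  by move=> x; exact: (H x).
elim: r => [|i r IH].
  rewrite big_nil; under eq_fun do rewrite big_nil.
  exact: cvg_cst.
rewrite big_cons; under eq_fun do rewrite big_cons.
by apply: cvgD => //; apply: cvgM; [exact: coord_continuous|exact: cvg_cst].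
Qed.

End dot_product.

Section barycentric.
Context {R : realType} {d : nat} (P : 'M[R]_(d.+1, d)).
Hypothesis P_free : affinely_independent P.
Implicit Types (x v : 'rV[R]_d).

(** Prefixing the vertices with a column of ones turns affine independence into
    invertibility; inverting the matrix gives the barycentric coordinates and
    their gradients [bgrad j]. *)
Definition augmented : 'M[R]_(1 + d) := row_mx (const_mx 1 : 'cV[R]_(1 + d)) P.

Definition bary x : 'rV[R]_(d.+1) := row_mx 1%:M x *m invmx augmented.

Definition bgrad j : 'rV[R]_d := \row_k invmx augmented (rshift 1 k) j.

Lemma mul_const1 (c : 'rV[R]_d.+1) :
  c *m (const_mx 1 : 'cV[R]_d.+1) = (\sum_j c ord0 j)%:M.
Proof.
apply/matrixP => i j; rewrite !ord1 !mxE eqxx mulr1n.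
by apply: eq_bigr => k _; rewrite !mxE mulr1.
Qed.

Lemma augmented_unit : augmented \in unitmx.
Proof.
rewrite -row_free_unit; apply: inj_row_free => v.
rewrite /augmented mul_mx_row => /eqP; rewrite row_mx_eq0 => /andP[/eqP v1 /eqP vP].
apply: P_free => //; move: v1; rewrite (mul_const1 v) => /matrixP/(_ ord0 ord0).
by rewrite !mxE eqxx mulr1n.
Qed.

Lemma bary_aug x : bary x *m augmented = row_mx 1%:M x.
Proof. by rewrite mulmxKV// augmented_unit. Qed.

Lemma sum_bary x : \sum_j bary x ord0 j = 1.
Proof.
have := bary_aug x; rewrite /augmented mul_mx_row => /eq_row_mx[].
by rewrite mul_const1 => /matrixP/(_ ord0 ord0); rewrite !mxE eqxx !mulr1n.
Qed.

Lemma bary_mulmx x : bary x *m P = x.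
Proof. by have := bary_aug x; rewrite /augmented mul_mx_row => /eq_row_mx[]. Qed.

Lemma bary_unique (c : 'rV[R]_d.+1) : \sum_j c ord0 j = 1 -> bary (c *m P) = c.
Proof.
move=> c1; rewrite /bary -[RHS](mulmxK augmented_unit); congr (_ *m _).
by rewrite /augmented mul_mx_row mul_const1 c1.
Qed.

Lemma bary_affine x j :
  bary x ord0 j = invmx augmented (lshift d ord0) j + dot x (bgrad j).
Proof.
rewrite /bary mxE big_split_ord /= big_ord1 row_mxEl mxE eqxx mul1r.
by congr (_ + _); apply: eq_bigr => k _; rewrite row_mxEr mxE.
Qed.

Lemma bary_shift x v t j :
  bary (x + t *: v) ord0 j = bary x ord0 j + t * dot v (bgrad j).
Proof. by rewrite !bary_affine dotDl dotZl addrA. Qed.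

Lemma bary_sub x y j : bary y ord0 j - bary x ord0 j = dot (y - x) (bgrad j).
Proof. by rewrite !bary_affine dotBl opprD addrACA subrr add0r. Qed.

(** The gradient of the constant function 1, which is the sum of the barycentric
    coordinates. *)
Lemma sum_bgrad : \sum_j bgrad j = 0.
Proof.
apply/rowP => k; rewrite -!dot_delta dot0r dotC dot_suml.
rewrite -[RHS](subrr 1) -{1}(sum_bary (delta_mx ord0 k)) -(sum_bary 0) -sumrB.
by apply: eq_bigr => j _; rewrite bary_sub subr0 dotC.
Qed.

Lemma bary_vertex i j : bary (row i P) ord0 j = (i == j)%:R.
Proof.
rewrite rowE bary_unique; last first.
  by rewrite (bigD1 i)//= mxE !eqxx big1 ?addr0// => k ki; rewrite mxE (negbTE ki) andbF.
by rewrite mxE eqxx /= eq_sym.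
Qed.

Lemma bary_inj x y : bary x = bary y -> x = y.
Proof. by move=> xy; rewrite -(bary_mulmx x) xy bary_mulmx. Qed.

Lemma bgrad_neq0 j : (0 < d)%N -> bgrad j != 0.
Proof.
move=> d0; have [i ij] : exists i : 'I_d.+1, i != j.
  have [j0|j0] := eqVneq j ord0; last by exists ord0; rewrite eq_sym.
  by exists ord_max; rewrite j0 -val_eqE /= -lt0n.
apply/eqP => g0; have := bary_sub (row j P) (row i P) j.
by rewrite g0 dot0r !bary_vertex eqxx (negbTE ij) sub0r => /eqP; rewrite oppr_eq0 oner_eq0.
Qed.

Lemma continuous_bary j : continuous (fun x => bary x ord0 j).
Proof.
move=> x; under eq_fun do rewrite bary_affine.
by apply: cvgD; [exact: cvg_cst|exact: continuous_dot].
Qed.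

Lemma face_bary (I : {set 'I_d.+1}) x : face P I x <->
  (forall j, 0 <= bary x ord0 j) /\ forall j, j \notin I -> bary x ord0 j = 0.
Proof.
split=> [[c [c0 cI c1 ->]]|[x0 xI]]; first by rewrite bary_unique.
by exists (bary x); split=> //; rewrite ?sum_bary ?bary_mulmx.
Qed.

Lemma simplex_bary x : simplex P x <-> forall j, 0 <= bary x ord0 j.
Proof.
split=> [/face_bary[]//|x0]; apply/face_bary; split=> // j.
by rewrite finset.inE.
Qed.

Lemma bary_barycenter (I : {set 'I_d.+1}) j : I != finset.set0 ->
  bary (barycenter P I) ord0 j = (#|I|%:R)^-1 * (j \in I)%:R.
Proof.
move=> I0; have cI : #|I|%:R != 0 :> R by rewrite pnatr_eq0 cards_eq0.
have -> : barycenter P I = (#|I|%:R^-1 *: \sum_(i in I) delta_mx ord0 i) *m P.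
  rewrite -scalemxAl mulmx_suml; congr (_ *: _).
  by apply: eq_bigr => i _; rewrite rowE.
have E k : (\sum_(i in I) delta_mx ord0 i : 'rV[R]_d.+1) ord0 k = (k \in I)%:R.
  rewrite summxE; have [kI|kI] := boolP (k \in I).
    rewrite (bigD1 k)//= big1 => [|i /andP[_ ik]]; rewrite mxE ?eqxx ?addr0//.
    by rewrite eq_sym (negbTE ik) andbF.
  apply: big1 => i iI; rewrite mxE /=; case: eqP => // ki.
  by move: kI; rewrite ki iI.
rewrite bary_unique; first by rewrite mxE E.
under eq_bigr do rewrite mxE E.
rewrite -mulr_sumr -[RHS](mulVf cI); congr (_ * _).
rewrite -sum1_card natr_sum [RHS]big_mkcond; apply: eq_bigr => k _.
by case: ifP.
Qed.

Lemma bary_elt_mid j : bary (barycenter P [set: 'I_d.+1]%SET) ord0 j = (d.+1%:R)^-1.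
Proof.
rewrite bary_barycenter ?cardsT ?card_ord ?finset.inE ?mulr1//.
by rewrite -cards_eq0 cardsT card_ord.
Qed.

Lemma bary_side_mid i j : (0 < d)%N ->
  bary (barycenter P [set~ i]%SET) ord0 j = d%:R^-1 * (j != i)%:R.
Proof.
move=> d0; have cI : #|[set~ i]%SET| = d by rewrite cardsC1 card_ord.
by rewrite bary_barycenter ?cI ?finset.inE// -cards_eq0 cI -lt0n.
Qed.

(** At a point of the simplex with j-th coordinate 0, moving away from the j-th
    vertex makes that coordinate negative, so the point is not interior. *)
Lemma interior_simplex x : (simplex P)° x <-> forall j, 0 < bary x ord0 j.
Proof.
split=> [xP j|x0].
  have xs : simplex P x by exact: interior_subset.
  have := (simplex_bary x).1 xs j; rewrite le_eqVlt => /predU1P[xj|//].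
  pose v := x - row j P.
  have vj : dot v (bgrad j) = -1.
    by rewrite -bary_sub bary_vertex eqxx -xj sub0r.
  have cv : x + t *: v @[t --> 0] --> x.
    rewrite -[X in _ --> X]addr0 -(scale0r v).
    by apply: cvgD; [exact: cvg_cst|apply: cvgZr_tmp; exact: cvg_id].
  have /cv := xP => -[e /= e0 /(_ (e / 2))] /=.
  rewrite /ball /= sub0r normrN gtr0_norm ?divr_gt0// => /(_ _)/simplex_bary.
  rewrite ltr_pdivrMr// ltr_pMr// ltr1n => /(_ isT j).
  by rewrite bary_shift -xj vj add0r mulrN1 oppr_ge0 leNgt divr_gt0.
have : \forall y \near x, forall j, 0 < bary y ord0 j.
  apply: (@filter_forall _ 'I_d.+1 (fun j y => 0 < bary y ord0 j) (nbhs x)) => j.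
  exact: cvgr_gt (@continuous_bary j x) _ (x0 j).
by apply: filterS => y y0; apply/simplex_bary => j; exact: ltW.
Qed.

Lemma interior_simplex_neq0 : (simplex P)° !=set0.
Proof.
exists (barycenter P [set: 'I_d.+1]%SET); apply/interior_simplex => j.
by rewrite bary_elt_mid invr_gt0.
Qed.

Lemma closed_simplex : closed (simplex P).
Proof.
have -> : simplex P = \bigcap_(j in [set: 'I_d.+1]) [set x | 0 <= bary x ord0 j].
  by apply/seteqP; split=> x; [move/simplex_bary=> h j _|move=> h; apply/simplex_bary => j];
    exact: h.
apply: closed_bigI => j _.
apply: (closed_comp (f := fun x => bary x ord0 j)) (@closed_ge R 0) => x _.
exact: continuous_bary.
Qed.

Lemma bounded_simplex : bounded_set (simplex P).
Proof.
pose r := \sum_i \sum_j `|P i j|.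
have r0 : 0 <= r by apply: sumr_ge0 => i _; apply: sumr_ge0.
exists r; split; first exact: num_real.
move=> s rs x /simplex_bary x0; apply: (le_trans _ (ltW rs)).
apply: norm_le_coord => // j; rewrite -(bary_mulmx x) mxE.
apply: (le_trans (ler_norm_sum _ _ _)); apply: ler_sum => i _.
rewrite normrM ger0_norm// (bigD1 j)//= -[leLHS]addr0.
apply: lerD; last exact: sumr_ge0.
apply: ler_piMl => //; rewrite -(sum_bary x) (bigD1 i)//= lerDl.
exact: sumr_ge0.
Qed.

Lemma measurable_simplex : measurable (simplex P).
Proof.
rewrite -[simplex P]setCK; apply: measurableC; apply: open_measurable_rV.
exact/closed_openC/closed_simplex.
Qed.

Lemma measurable_interior_simplex : measurable (simplex P)°.
Proof. by apply: open_measurable_rV; exact: open_interior. Qed.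

Lemma simplex_segment x t : simplex P x -> 0 < t <= 1 ->
  (simplex P)° (x + t *: (barycenter P [set: 'I_d.+1]%SET - x)).
Proof.
move=> /simplex_bary x0 /andP[t0 t1]; apply/interior_simplex => j.
rewrite bary_shift -bary_sub bary_elt_mid.
have d0 : 0 < (d.+1%:R : R)^-1 by rewrite invr_gt0.
have := x0 j; move: (bary x ord0 j) => b b0.
move: (_^-1) d0 => e e0; have te := mulr_gt0 t0 e0.
have tb : 0 <= (1 - t) * b by rewrite mulr_ge0// subr_ge0.
rewrite (_ : b + _ = (1 - t) * b + t * e); last by ring.
by rewrite ltr_wpDl.
Qed.

(** Every point of the simplex is a limit of interior points, so that the trace
    on a closed element is taken along a proper filter. *)
Lemma simplex_closure_interior x : simplex P x -> closure (simplex P)° x.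
Proof.
move=> Px; pose v := barycenter P [set: 'I_d.+1]%SET - x.
have cv : x + t *: v @[t --> (0 : R)^'+] --> x.
  rewrite -[X in _ --> X]addr0 -(scale0r v).
  apply: cvg_at_right_filter; apply: cvgD; first exact: cvg_cst.
  by apply: cvgZr_tmp; exact: cvg_id.
move=> B /cv Bt; near (0 : R)^'+ => t.
exists (x + t *: v); split; last by near: t; exact: Bt.
by apply: simplex_segment => //; apply/andP; split; near: t;
  [exact: nbhs_right_gt|exact: nbhs_right_le].
Unshelve. all: by end_near.
Qed.

(** An affine function is determined by its values at the vertices. *)
Lemma affine_bary x (c : R) g :
  c + dot x g = \sum_j bary x ord0 j * (c + dot (row j P) g).
Proof.
under eq_bigr do rewrite mulrDr.
rewrite big_split /= -mulr_suml sum_bary mul1r; congr (_ + _).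
rewrite -{1}(bary_mulmx x) mulmx_sum_row dot_suml.
by apply: eq_bigr => j _; rewrite dotZl.
Qed.

End barycentric.

(** * Volumes of simplices *)

Section simplex_measure.
Context {R : realType} {d : nat}.
Local Notation L := (lebesgue_rV (R := R) d).
Implicit Types (P : 'M[R]_(d.+1, d)).

(** A linear change of variables moves the hyperplane to the set where the first
    coordinate is constant. *)
Lemma null_hyperplane (g : 'rV[R]_d) (c : R) : g != 0 ->
  L [set x | dot x g = c] = 0%E.
Proof.
case: d g => [|m] g g0; first by rewrite (thinmx0 g) eqxx in g0.
have gg := dot_gt0 g0.
have [B uB [_ Bl]] : exists2 B : 'M[R]_(1 + m), B \in unitmx &
    (dot g g)^-1 *: g = row_mx 1%:M 0 *m B /\ B *m g^T = col_mx 1%:M 0.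
  by apply: adapted_basis; rewrite dot_mulmx dotZl mulVf// gt_eqF.
have uB' : invmx B \in unitmx by rewrite unitmx_inv.
have [b _ bE] := lebesgue_linear uB'.
transitivity (lebesgue_rV m.+1 [set x : 'rV[R]_(1 + m) |
    [set y : 'rV[R]_m.+1 | y ord0 ord0 = c] (x *m invmx B)]).
  congr (_ _); apply/seteqP.
  suff E (x : 'rV[R]_(1 + m)) : dot x g = (x *m invmx B) ord0 ord0.
    by split=> x /=; rewrite E.
  have := dot_mulmx x g; rewrite -{1}[x](mulmxKV uB) -(mulmxA _ B) Bl.
  set v := x *m invmx B; rewrite -{1}[v]hsubmxK mul_row_col mulmx0 mulmx1 addr0.
  move=> /matrixP/(_ ord0 ord0); rewrite mxE [RHS]mxE eqxx mulr1n => <-.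
  by congr (v _ _); exact: val_inj.
rewrite bE; first by rewrite lebesgue_coord_hyperplane mule0.
apply: (@measurable_preim _ _ _ _ (fun y : 'rV[R]_m.+1 => y ord0 ord0) [set c]).
  exact: measurable_rV_coord.
exact: measurable_set1.
Qed.

Lemma skeleton_subset P : affinely_independent P ->
  simplex P `\` (simplex P)° `<=` \bigcup_j [set x | bary P x ord0 j = 0].
Proof.
move=> Pf x [/(simplex_bary Pf) x0 Nx].
have /existsNP[j /negP xj] : ~ forall j, 0 < bary P x ord0 j.
  by move=> h; apply: Nx; exact/interior_simplex.
by exists j => //=; apply/eqP; rewrite eq_le x0 andbT leNgt.
Qed.

Lemma measurable_dot (g : 'rV[R]_d) : measurable_fun setT (fun x => dot x g).
Proof. by apply: continuous_measurable_rV; exact: continuous_dot. Qed.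

Lemma measurable_hyperplane (g : 'rV[R]_d) c : measurable [set x | dot x g = c].
Proof.
apply: (@measurable_preim _ _ _ _ (fun y => dot y g) [set c]).
  exact: measurable_dot.
exact: measurable_set1.
Qed.

Lemma null_bary_hyperplane P j : (0 < d)%N -> affinely_independent P ->
  L.-negligible [set x | bary P x ord0 j = 0].
Proof.
move=> d0 Pf.
have -> : [set x | bary P x ord0 j = 0] =
    [set x | dot x (bgrad P j) = - invmx (augmented P) (lshift d ord0) j].
  by apply/seteqP; split=> x /=; rewrite bary_affine => h; lra.
apply/negligibleP; first exact: measurable_hyperplane.
by apply: null_hyperplane; exact: bgrad_neq0.
Qed.

Lemma negligible_skeleton P : (0 < d)%N -> affinely_independent P ->
  L.-negligible (simplex P `\` (simplex P)°).
Proof.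
move=> d0 Pf; apply: negligibleS (skeleton_subset Pf) _.
rewrite (_ : \bigcup_j _ = \big[setU/set0]_(j : 'I_d.+1) [set x | bary P x ord0 j = 0]).
  elim/big_ind : _ => [|A B|j _]; [exact: negligible_set0|exact: negligibleU|].
  exact: null_bary_hyperplane.
by rewrite -bigcup_seq; apply/seteqP; split=> x [j _ xj]; exists j => //=;
  rewrite mem_index_enum.
Qed.

Lemma simplex_fin P : affinely_independent P -> L (simplex P) \is a fin_num.
Proof.
move=> Pf; rewrite ge0_fin_numE//; apply: lebesgue_rV_bounded.
  exact: measurable_simplex.
exact: bounded_simplex.
Qed.

Definition volume P : R := fine (L (simplex P)).

Lemma volume_gt0 P : affinely_independent P -> 0 < volume P.
Proof.
move=> Pf; apply: fine_gt0; rewrite ltey_eq simplex_fin// andbT.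
apply: (@lt_le_trans _ _ (L (simplex P)°)).
  by apply: lebesgue_rV_open; [exact: open_interior|exact: interior_simplex_neq0].
apply: le_measure; rewrite ?inE; [exact: measurable_interior_simplex|
  exact: measurable_simplex|exact: interior_subset].
Qed.

(** The affine map that sends the i-th vertex of P to the i-th vertex of Q. *)
Definition affmap P (Q : 'M[R]_(d.+1, d)) x := bary P x *m Q.

Lemma affmapK P Q : affinely_independent P -> affinely_independent Q ->
  cancel (affmap P Q) (affmap Q P).
Proof.
by move=> Pf Qf x; rewrite /affmap bary_unique// ?sum_bary// bary_mulmx.
Qed.

Lemma bary_affmap P Q x : affinely_independent P -> affinely_independent Q ->
  bary Q (affmap P Q x) = bary P x.
Proof. by move=> Pf Qf; rewrite /affmap bary_unique// sum_bary. Qed.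

Lemma affmap_linear P Q : affinely_independent P -> affinely_independent Q ->
  exists (A : 'M[R]_d) b, A \in unitmx /\ forall x, affmap P Q x = x *m A + b.
Proof.
move=> Pf Qf.
pose A0 (P Q : 'M[R]_(d.+1, d)) : 'M[R]_d := (dsubmx (invmx (augmented P) : 'M[R]_(1 + d, d.+1))) *m Q.
pose b0 (P Q : 'M[R]_(d.+1, d)) : 'rV[R]_d := (usubmx (invmx (augmented P) : 'M[R]_(1 + d, d.+1))) *m Q.
have E P' Q' x : affmap P' Q' x = x *m A0 P' Q' + b0 P' Q'.
  rewrite /affmap /bary -[invmx _]vsubmxK mul_row_col mul1mx mulmxDl.
  by rewrite addrC mulmxA.
exists (A0 P Q), (b0 P Q); split=> //.
suff : A0 P Q *m A0 Q P = 1%:M by case/mulmx1_unit.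
apply/row_matrixP => i; rewrite !rowE mulmx1 mulmxA.
have K x : x *m A0 P Q *m A0 Q P + (b0 P Q *m A0 Q P + b0 Q P) = x.
  by rewrite -[RHS](affmapK Pf Qf) !E mulmxDl addrA.
have := K 0; rewrite !mul0mx add0r => K0.
by rewrite -[RHS]K K0 addr0.
Qed.

Lemma measurable_affmap P Q : affinely_independent P -> affinely_independent Q ->
  measurable_fun setT (affmap P Q).
Proof.
move=> Pf Qf; have [A [b [_ /funext E]]] := affmap_linear Pf Qf; rewrite E.
by apply: measurable_addrV => //; exact: measurable_mulmx.
Qed.

Lemma lebesgue_affmap P Q : affinely_independent P -> affinely_independent Q ->
  exists2 c : R, 0 <= c & forall X, measurable X ->
  L [set x | X (affmap P Q x)] = (c%:E * L X)%E.
Proof.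
move=> Pf Qf; have [A [b [uA E]]] := affmap_linear Pf Qf.
have [c c0 cE] := lebesgue_linear uA; exists c => // X mX.
rewrite -(lebesgue_rV_translate b mX) -cE; last first.
  by apply: (measurable_preim (f := fun x : 'rV[R]_d => x + b)) => //; exact: measurable_rV_shift.
by congr (_ _); apply/seteqP; split=> x /=; rewrite E.
Qed.

Lemma simplex_affmap P Q : affinely_independent P -> affinely_independent Q ->
  [set x | simplex Q (affmap P Q x)] = simplex P.
Proof.
move=> Pf Qf; apply/seteqP; split=> x /=.
  by move=> /(simplex_bary Qf); rewrite bary_affmap// => /(simplex_bary Pf).
by move=> /(simplex_bary Pf) h; apply/(simplex_bary Qf); rewrite bary_affmap.
Qed.

End simplex_measure.

(** * Permuting vertices, and the midpoint rule *)

Section vertex_permutation.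
Context {R : realType} {d : nat}.
Local Notation L := (lebesgue_rV (R := R) d).
Implicit Types (P Q : 'M[R]_(d.+1, d)).

Lemma augmented_free P : augmented P \in unitmx -> affinely_independent P.
Proof.
rewrite -row_free_unit => Pf c c1 cP.
have : c *m augmented P = 0 *m augmented P.
  by rewrite mul0mx /augmented mul_mx_row cP mul_const1 c1 raddf0 row_mx0.
exact: row_free_inj.
Qed.

Lemma affinely_independent_perm (s : 'S_d.+1) P :
  affinely_independent P -> affinely_independent (row_perm s P).
Proof.
move=> Pf; apply: augmented_free.
have -> : augmented (row_perm s P) = row_perm s (augmented P).
  rewrite /augmented row_permE row_permE mul_mx_row; congr row_mx.
  rewrite -(row_permE s (const_mx 1)).
  by apply/matrixP => i j; rewrite !mxE.
by rewrite row_permE unitmx_mul unitmx_perm augmented_unit.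
Qed.

Lemma bary_perm (s : 'S_d.+1) P x j : affinely_independent P ->
  bary (row_perm s P) x ord0 j = bary P x ord0 (s j).
Proof.
move=> Pf; pose c : 'rV[R]_d.+1 := \row_k bary P x ord0 (s k).
have -> : bary (row_perm s P) x = c; last by rewrite mxE.
have c1 : \sum_k c ord0 k = 1.
  rewrite -(sum_bary Pf x) [RHS](reindex_inj (@perm_inj _ s)).
  by apply: eq_bigr => k _; rewrite mxE.
have E : x = c *m row_perm s P.
  rewrite -{1}(bary_mulmx Pf x) !mulmx_sum_row [LHS](reindex_inj (@perm_inj _ s)).
  apply: eq_bigr => k _; rewrite [c _ _]mxE; congr (_ *: _).
  by apply/rowP => l; rewrite !mxE.
by rewrite {1}E bary_unique//; exact: affinely_independent_perm.
Qed.

Lemma simplex_perm (s : 'S_d.+1) P : affinely_independent P ->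
  simplex (row_perm s P) = simplex P.
Proof.
move=> Pf; have Pf' := @affinely_independent_perm s _ Pf.
apply/seteqP; split=> x.
  move=> /(simplex_bary Pf') h; apply/(simplex_bary Pf) => j.
  by have := h ((s^-1)%g j); rewrite bary_perm// permKV.
by move=> /(simplex_bary Pf) h; apply/(simplex_bary Pf') => j; rewrite bary_perm.
Qed.

Lemma bgrad_perm (s : 'S_d.+1) P j : affinely_independent P ->
  bgrad (row_perm s P) j = bgrad P (s j).
Proof.
move=> Pf; have Pf' := @affinely_independent_perm s _ Pf.
apply/rowP => k; rewrite -!dot_delta -[X in dot X _]subr0 -[in RHS](subr0 (delta_mx _ _)).
by rewrite -!bary_sub// !bary_perm.
Qed.

(** The affine map that exchanges the vertices j and k maps the simplex to
    itself, hence preserves measure, and it exchanges the two coordinates. *)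
Lemma integral_bary P j k : affinely_independent P ->
  (\int[L]_(x in simplex P) (bary P x ord0 j)%:E =
   \int[L]_(x in simplex P) (bary P x ord0 k)%:E)%E.
Proof.
move=> Pf; pose s := tperm k j; pose Q := row_perm s P.
have Qf : affinely_independent Q := @affinely_independent_perm s _ Pf.
have [c c0 cE] := lebesgue_affmap Pf Qf.
have mS := measurable_simplex Pf.
have SE : [set x | simplex P (affmap P Q x)] = simplex P.
  by rewrite -{1}(@simplex_perm s _ Pf) simplex_affmap.
have c1 : c = 1.
  have /= := cE _ mS; rewrite SE -(fineK (simplex_fin Pf)) -EFinM => -[].
  move=> /(congr1 (fun z => z / volume P)); rewrite mulfK ?divff//;
    by rewrite gt_eqF// volume_gt0.
rewrite [RHS]integral_mkcond; set f := _ \_ _; rewrite [LHS]integral_mkcond.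
have mf : measurable_fun setT f.
  apply/(measurable_restrictT _ _).1 => //.
  apply/measurable_EFinP; apply: measurable_funTS.
  by apply: continuous_measurable_rV; exact: continuous_bary.
have f0 x : (0 <= f x)%E.
  rewrite /f patchE; case: ifPn => // /[!inE] /(simplex_bary Pf) h.
  by rewrite lee_fin.
have gc B : measurable B -> L (affmap P Q @^-1` B) = ((1%:nng%:num)%:E * L B)%E.
  by move=> mB; rewrite [LHS]cE// c1.
have := ge0_integral_scaling (measurable_affmap Pf Qf) gc mf f0.
rewrite mul1e => h; rewrite -[RHS]h.
apply: eq_integral => x _; rewrite /f !patchE.
have -> : (affmap P Q x \in simplex P) = (x \in simplex P).
  by apply/idP/idP; rewrite !inE; [rewrite -{2}SE|rewrite -{1}SE].
case: ifP => // _; congr EFin.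
by rewrite -(bary_affmap x Pf Qf) bary_perm// /s tpermR.
Qed.

Lemma integrable_affine P (c : R) g : affinely_independent P ->
  L.-integrable (simplex P) (EFin \o (fun x => c + dot x g)).
Proof.
move=> Pf; apply: measurable_bounded_integrable.
- exact: measurable_simplex.
- by rewrite -ge0_fin_numE// simplex_fin.
- apply: measurable_funTS; apply: measurable_funD; first exact: measurable_cst.
  exact: measurable_dot.
- pose r := `|c| + \sum_j `|c + dot (row j P) g|.
  exists r; split; first exact: num_real.
  move=> s rs x /= /(simplex_bary Pf) x0; apply: (le_trans _ (ltW rs)).
  rewrite (affine_bary Pf) /r -[leLHS]add0r lerD//.
  apply: (le_trans (ler_norm_sum _ _ _)); apply: ler_sum => j _.
  rewrite normrM ger0_norm//; apply: ler_piMl => //.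
  by rewrite -(sum_bary Pf x) (bigD1 j)//= lerDl sumr_ge0.
Qed.

(** All barycentric coordinates have the same integral and they sum to 1, so
    each has the integral |P| / (d + 1); the rule follows by expanding the affine
    function in them. This yields the elementwise means without any iterated
    integral. *)
Lemma integral_affine P (c : R) g : affinely_independent P ->
  \int[L]_(x in simplex P) (c + dot x g) =
  volume P * (c + dot (barycenter P [set: 'I_d.+1]%SET) g).
Proof.
move=> Pf; have mS := measurable_simplex Pf.
have ib j : L.-integrable (simplex P) (EFin \o (fun x => bary P x ord0 j)).
  under [X in _ \o X]eq_fun do rewrite bary_affine.
  exact: integrable_affine.
pose I j := \int[L]_(x in simplex P) (bary P x ord0 j).
have IE j : I j = I ord0 by rewrite /I /Rintegral (integral_bary j ord0 Pf).
have Isum (a : 'I_d.+1 -> R) :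
    \int[L]_(x in simplex P) (\sum_j bary P x ord0 j * a j) = \sum_j I j * a j.
  rewrite /Rintegral; under eq_integral do rewrite -sumEFin.
  rewrite integral_sum//; last first.
    move=> j; have := integrableZr mS (a j) (ib j).
    by apply: eq_integrable => // x _ /=; rewrite EFinM.
  rewrite -sum_fine => [|j _]; last first.
    apply: integrable_fin_num => //.
    have := integrableZr mS (a j) (ib j).
    by apply: eq_integrable => // x _ /=; rewrite EFinM.
  by apply: eq_bigr => j _; rewrite -(RintegralZr _ mS (ib j)).
have I0 : volume P = d.+1%:R * I ord0.
  have := Isum (fun=> 1); under eq_Rintegral do rewrite -mulr_suml sum_bary// mul1r.
  rewrite Rintegral_cst// mul1r -/(volume P) => ->.
  rewrite (eq_bigr (fun=> I ord0)) => [|j _]; last by rewrite IE mulr1.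
  by rewrite sumr_const card_ord mulr_natl.
under eq_Rintegral do rewrite (affine_bary Pf).
rewrite Isum (affine_bary Pf) mulr_sumr I0; apply: eq_bigr => j _.
by rewrite IE bary_elt_mid// mulrA (mulrC (d.+1%:R)) mulfK.
Qed.

Lemma lebesgue_rank1_dot (g w : 'rV[R]_d) (s : R) X :
  dot w g = s -> s != 0 -> 1 + s != 0 -> measurable X ->
  L [set x | X (x + dot x g *: w)] = ((`|1 + s|^-1)%:E * L X)%E.
Proof.
case: d g w X => [|m] g w X wg s0 s1 mX.
  by rewrite -wg (thinmx0 w) dot0l eqxx in s0.
rewrite -(@lebesgue_rank1 _ m g^T w)//; last by rewrite dot_mulmx wg.
congr (_ _); apply/seteqP.
suff E (x : 'rV[R]_m.+1) : dot x g *: w = (x : 'rV[R]_(1 + m)) *m g^T *m w.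
  by split=> x /=; rewrite E.
by rewrite dot_mulmx mul_scalar_mx.
Qed.

Section adjacent.
Variables (P Q : 'M[R]_(d.+1, d)) (i : 'I_d.+1).
Hypotheses (Pf : affinely_independent P) (Qf : affinely_independent Q).
Hypothesis PQ : forall j, j != i -> row j P = row j Q.
Let delta := bary P (row i Q) ord0 i.

Lemma affmap_adjacent x :
  affmap P Q x = x + bary P x ord0 i *: (row i Q - row i P).
Proof.
rewrite /affmap -{2}(bary_mulmx Pf x) !mulmx_sum_row (bigD1 i)//=.
rewrite [in RHS](bigD1 i)//= scalerBr addrAC addrCA subrr addr0.
by congr (_ + _); apply: eq_bigr => j ji; rewrite PQ.
Qed.

(** Both sides vanish at the common vertices and agree at the i-th vertex of Q,
    and they are affine. *)
Lemma bary_adjacent x : bary P x ord0 i = bary Q x ord0 i * delta.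
Proof.
rewrite -{1}(bary_mulmx Qf x) mulmx_sum_row.
have E c : bary P c ord0 i = invmx (augmented P) (lshift d ord0) i + dot c (bgrad P i).
  exact: bary_affine.
rewrite E dot_suml -[X in X + _]mul1r -(sum_bary Qf x) mulr_suml -big_split /=.
rewrite (bigD1 i)//= dotZl -mulrDr -E -/delta big1 ?addr0// => j ji.
by rewrite dotZl -mulrDr -E -PQ// bary_vertex// (negbTE ji) mulr0.
Qed.

Lemma delta_neq0 : delta != 0.
Proof.
apply/eqP => d0; have := bary_adjacent (row i P).
by rewrite d0 mulr0 bary_vertex// eqxx => /eqP; rewrite oner_eq0.
Qed.

Lemma bgrad_adjacent : bgrad P i = delta *: bgrad Q i.
Proof.
apply/rowP => k; rewrite [RHS]mxE -[LHS]dot_delta -[X in dot X _]subr0.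
rewrite -bary_sub// !bary_adjacent -mulrBl bary_sub// subr0 dot_delta.
by rewrite mulrC.
Qed.

(** The affine map from P to Q fixes the common side and moves the i-th vertex.
    With the origin on that side it is x + (x . g) w with x . g the i-th coordinate,
    so [lebesgue_rank1] applies, with 1 + w . g = delta. *)
Lemma volume_adjacent : (0 < d)%N -> delta < 0 -> volume Q = - delta * volume P.
Proof.
move=> d0 dlt0.
have [k ki] : exists k : 'I_d.+1, k != i.
  have [i0|i0] := eqVneq i ord0; last by exists ord0; rewrite eq_sym.
  by exists ord_max; rewrite i0 -val_eqE /= -lt0n.
pose x1 := row k P; pose g := bgrad P i; pose w := row i Q - row i P.
have x1i : bary P x1 ord0 i = 0 by rewrite bary_vertex// (negbTE ki).
have wg : dot w g = delta - 1.
  by rewrite -bary_sub// [X in _ - X]bary_vertex// eqxx.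
have mQ := measurable_simplex Qf.
have mQ' : measurable [set z | simplex Q (z + x1)].
  exact: (measurable_preim (measurable_rV_shift x1) mQ).
have mP := measurable_simplex Pf.
have key : L (simplex P) = ((`|delta|^-1)%:E * L (simplex Q))%E.
  rewrite -(lebesgue_rV_translate x1 mP) -(lebesgue_rV_translate x1 mQ).
  have -> : [set x | simplex P (x + x1)] =
      [set y | [set z | simplex Q (z + x1)] (y + dot y g *: w)].
    rewrite -(simplex_affmap Pf Qf); apply/seteqP.
    suff E y : affmap P Q (y + x1) = y + dot y g *: w + x1.
      by split=> y /=; rewrite E.
    rewrite affmap_adjacent addrAC -/w.
    congr (_ + _ *: _ + _); have := bary_sub P x1 (y + x1) i.
    by rewrite x1i subr0 addrK.
  have s0 : delta - 1 != 0 by rewrite subr_eq0 lt_eqF// (lt_trans dlt0).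
  have s1 : 1 + (delta - 1) = delta by rewrite addrC subrK.
  by rewrite (lebesgue_rank1_dot wg s0 _ mQ') s1// lt_eqF.
have dd : 0 < `|delta| by rewrite normr_gt0 lt_eqF.
rewrite -(ltr0_norm dlt0) /volume key -(fineK (simplex_fin Qf)) -EFinM /=.
by rewrite mulrA divff ?mul1r// gt_eqF.
Qed.

(** Up to the factor - d, the vector |P| grad(lambda_i) is the outer unit normal
    of the i-th side times its area. For two simplices on opposite sides of a
    common side these vectors are opposite; stating this with volumes and
    barycentric gradients avoids surface measures altogether. *)
Lemma volume_bgrad_adjacent : (0 < d)%N -> delta < 0 ->
  volume P *: bgrad P i = - (volume Q *: bgrad Q i).
Proof.
move=> d0 dlt0; rewrite volume_adjacent// bgrad_adjacent scalerA mulNr scaleNr opprK.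
by rewrite mulrC.
Qed.
End adjacent.

End vertex_permutation.

(** * Test functions *)

Section bump.
Context {R : realType}.

(** t^-k exp(-1/t), extended by 0: the family of these functions is closed under
    derivation up to linear combinations, see [is_derive_rho]. *)
Definition rho (k : nat) (t : R) : R :=
  if 0 < t then t^-1 ^+ k * expR (- t^-1) else 0.

Lemma rho_le0 k t : t <= 0 -> rho k t = 0.
Proof. by rewrite /rho; case: ltrP => // t0 /(lt_le_trans t0); rewrite ltxx. Qed.

Lemma rho_gt0 k t : 0 < t -> 0 < rho k t.
Proof. by move=> t0; rewrite /rho t0 mulr_gt0 ?expR_gt0// exprn_gt0// invr_gt0. Qed.

Lemma rho_ge0 k t : 0 <= rho k t.
Proof. by case: (ltrP 0 t) => [/rho_gt0/ltW|/rho_le0->]. Qed.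

(** One term of the exponential series gives exp(1/t) >= t^-(k+2) / (k+2)!; the
    quadratic bound makes the derivative at 0 vanish. *)
Lemma rho_le_sqr k : exists2 C, 0 < C & forall t, rho k t <= C * t ^+ 2.
Proof.
exists (k.+2`!%:R); first by rewrite ltr0n fact_gt0.
move=> t; case: (ltrP 0 t) => t0; last by rewrite rho_le0// mulr_ge0 ?sqr_ge0.
have C0 : 0 < k.+2`!%:R :> R by rewrite ltr0n fact_gt0.
have tV : 0 < t^-1 by rewrite invr_gt0.
have E : t^-1 ^+ k.+2 / k.+2`!%:R <= expR (t^-1).
  by apply: le_trans (expR_ge1Dxn k.+1 (ltW tV)); rewrite lerDr.
rewrite /rho t0 expRN ler_pdivrMr ?expR_gt0//.
apply: le_trans (ler_wpM2l _ E); last by rewrite mulr_ge0 ?sqr_ge0// ltW.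
rewrite !exprS le_eqVlt; apply/orP; left; apply/eqP.
by field; rewrite !gt_eqF// exprn_gt0.
Qed.

Lemma is_derive_rho (k : nat) (t : R) : is_derive t 1 (rho k) (- k%:R * rho k.+1 t + rho k.+2 t).
Proof.
have [t0|t0|t0] := ltrgtP 0 t.
- pose f y : R := y^-1 ^+ k * expR (- y^-1).
  apply: (@near_eq_is_derive _ _ _ f).
    near=> y; rewrite /rho ifT//; near: y; exact: lt_nbhsr.
  have iV : is_derive t 1 (fun y : R => y^-1) (- t ^- 2).
    apply: DeriveDef; first by apply: derivableV; rewrite ?gt_eqF.
    by rewrite deriveV ?gt_eqF//= derive_id /GRing.scale /= mulr1.
  have iE : is_derive t 1 (fun y => expR (- y^-1)) (expR (- t^-1) * - - t ^- 2).
    exact: (is_derive1_comp (f := expR) (g := fun y => - y^-1)).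
  have iX : is_derive t 1 (fun y : R => y^-1 ^+ k) (k%:R * t^-1 ^+ k.-1 * - t ^- 2).
    have -> : (fun y : R => y^-1 ^+ k) = (fun y : R => y^-1) ^+ k.
      by apply/funext => y; rewrite exprfctE.
    by have := is_deriveX k iV.
  have -> : f = (fun y : R => y^-1 ^+ k) * (fun y => expR (- y^-1)) by [].
  have := is_deriveM iX iE; congr is_derive.
  rewrite /GRing.scale /= /rho t0 -!exprVn !exprS.
  case: k {f iX} => [|k]; first by rewrite /= !mul0r mulr0; ring.
  by rewrite /= exprS; ring.
- rewrite !rho_le0 ?ltW// mulr0 addr0.
  apply: (@near_eq_is_derive _ _ _ (cst 0)).
    near=> y; rewrite rho_le0// ltW//; near: y; exact: lt_nbhsl.
- rewrite -t0 !rho_le0// mulr0 addr0.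
  have [C C0 rC] := rho_le_sqr k.
  have cv : h^-1 *: (rho k (h *: 1 + 0) - rho k 0) @[h --> (0 : R)^'] --> (0 : R).
    apply/cvgr0Pnorm_lt => e e0; near=> h.
    have h0 : h != 0 by near: h; exact: nbhs_dnbhs_neq.
    rewrite addr0 (rho_le0 k (lexx 0)) subr0 {2}/GRing.scale /= mulr1 normrZ.
    rewrite normfV (ger0_norm (rho_ge0 _ _)) mulrC ltr_pdivrMr ?normr_gt0//.
    apply: (le_lt_trans (rC h)); rewrite -normr_id -real_normK ?num_real// normr_id expr2 mulrA.
    rewrite ltr_pM2r ?normr_gt0// mulrC -ltr_pdivlMr//.
    near: h; apply: dnbhs0_lt; exact: divr_gt0.
  by apply: DeriveDef; [apply/cvg_ex; exists 0|exact: cvg_lim].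
Unshelve. all: by end_near.
Qed.

End bump.

Section smooth_functions.
Context {R : realType} {d : nat}.
Implicit Types (f h : 'rV[R]_d -> R) (v x : 'rV[R]_d).

Definition dotl (g x : 'rV[R]_d) : R^o := dot x g.

Let dotl_is_linear g : linear (dotl g).
Proof. by move=> a x y; rewrite /dotl dotDl dotZl. Qed.

HB.instance Definition _ (g : 'rV[R]_d) :=
  GRing.isLinear.Build R 'rV[R]_d R^o _ (dotl g) (dotl_is_linear g).

Lemma differentiable_dot g x : differentiable (fun y : 'rV[R]_d => dot y g) x.
Proof. by apply: (@linear_differentiable _ _ _ (dotl g)); exact: continuous_dot. Qed.

Lemma derive_dot g v x : 'D_v (fun y => dot y g) x = dot v g.
Proof.
rewrite deriveE; last exact: differentiable_dot.
have := @diff_lin _ _ _ (dotl g) x (@continuous_dot _ _ g).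
by move=> /(congr1 (fun F => F v)).
Qed.

(** Closed under directional derivatives by the chain rule and [is_derive_rho],
    hence smooth, and rich enough to contain all the cutoff functions below. *)
Inductive elementary : ('rV[R]_d -> R) -> Prop :=
| elementary_affine c g : elementary (fun x => c + dot x g)
| elementary_add f h : elementary f -> elementary h ->
    elementary (fun x => f x + h x)
| elementary_mul f h : elementary f -> elementary h ->
    elementary (fun x => f x * h x)
| elementary_rho k f : elementary f -> elementary (fun x => rho k (f x)).

Lemma elementary_cst c : elementary (cst c).
Proof.
have := elementary_affine c 0; congr elementary.
by apply/funext => x; rewrite dot0r addr0.
Qed.

Lemma elementary_scale c f : elementary f -> elementary (fun x => c * f x).
Proof. by move=> ef; apply: elementary_mul => //; exact: elementary_cst. Qed.

Lemma elementary_prod (I : Type) (r : seq I) (F : I -> 'rV[R]_d -> R) :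
  (forall i, elementary (F i)) -> elementary (fun x => \prod_(i <- r) F i x).
Proof.
move=> eF; elim: r => [|i r IH].
  by under eq_fun do rewrite big_nil; exact: elementary_cst.
by under eq_fun do rewrite big_cons; exact: elementary_mul.
Qed.

Lemma derive_rho_comp k f v x : differentiable f x ->
  differentiable (fun y => rho k (f y)) x /\
  'D_v (fun y => rho k (f y)) x =
    (- k%:R * rho k.+1 (f x) + rho k.+2 (f x)) * 'D_v f x.
Proof.
move=> df; have drho := is_derive_rho k (f x).
have dr : differentiable (rho k) (f x).
  by apply/derivable1_diffP; exact: ex_derive.
have dc : differentiable (rho k \o f) x by exact: differentiable_comp.
split=> //; rewrite deriveE// diff_comp//= deriv1E; last exact: ex_derive.
by rewrite -deriveE// derive1E derive_val /GRing.scale /= mulrC.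
Qed.

Lemma elementary_derive f : elementary f ->
  (forall x, differentiable f x) /\ forall v, elementary (fun x => 'D_v f x).
Proof.
elim=> [c g|{}f h _ [df ef] _ [dh eh]|{}f h ef0 [df ef] eh0 [dh eh]|k {}f ef0 [df ef]].
- split=> [x|v]; first by apply: differentiableD => //; exact: differentiable_dot.
  have := elementary_cst (dot v g); congr elementary; apply/funext => x /=.
  rewrite deriveD ?derive_cst ?add0r ?derive_dot//.
  by apply: diff_derivable; exact: differentiable_dot.
- split=> [x|v]; first by apply: differentiableD.
  have := elementary_add (ef v) (eh v); congr elementary; apply/funext => x /=.
  by rewrite deriveD//; exact: diff_derivable.
- split=> [x|v]; first by apply: differentiableM.
  have := elementary_add (elementary_mul ef0 (eh v)) (elementary_mul eh0 (ef v)).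
  congr elementary; apply/funext => x /=.
  by rewrite deriveM//; exact: diff_derivable.
- split=> [x|v]; first by have [] := derive_rho_comp k 0 (df x).
  have e1 := elementary_rho k.+1 ef0; have e2 := elementary_rho k.+2 ef0.
  have := elementary_mul (elementary_add (elementary_scale (- k%:R) e1) e2) (ef v).
  congr elementary; apply/funext => x /=.
  by have [_ ->] := derive_rho_comp k v (df x).
Qed.

Lemma elementary_differentiable f x : elementary f -> differentiable f x.
Proof. by case/elementary_derive. Qed.

Lemma elementary_continuous f : elementary f -> continuous f.
Proof.
by move=> ef x; apply: differentiable_continuous; exact: elementary_differentiable.
Qed.

Lemma elementary_smooth f : elementary f -> smooth f.
Proof.
move=> ef vs x; apply: elementary_differentiable.
elim: vs => //= v vs IH; have [_] := elementary_derive IH; exact.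
Qed.

Lemma closed_cube r : closed (@cube R d r).
Proof.
have -> : @cube R d r = \bigcap_(i in [set: 'I_d]) [set x | `|x ord0 i| <= r].
  by apply/seteqP; split=> x /= h i => [_|]; apply: h.
apply: closed_bigI => i _.
apply: (closed_comp (f := fun x : 'rV[R]_d => `|x ord0 i|)) (@closed_le R r) => x _.
by apply: cvg_norm; exact: coord_continuous.
Qed.

Lemma elementary_bounded f (K : set 'rV[R]_d) : elementary f -> bounded_set K ->
  (forall x, ~ K x -> f x = 0) -> exists2 M, 0 <= M & forall x, `|f x| <= M.
Proof.
move=> ef bK f0.
have [r r0 Kr] := bounded_subset_cube bK.
have cr : compact (@cube R d r).
  apply: bounded_closed_compact; last exact: closed_cube.
  exists r; split; first exact: num_real.
  by move=> s rs x xr; apply: (le_trans _ (ltW rs)); apply: norm_le_coord => //; exact: ltW.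
have /compact_bounded[M [_ hM]] : compact (f @` cube r).
  apply: continuous_compact => //; apply: continuous_subspaceT.
  exact: elementary_continuous.
exists (`|M| + 1) => [|x]; first by rewrite addr_ge0.
have [xr|xr] := pselect (cube r x).
  by apply: (hM (`|M| + 1)); [rewrite (le_lt_trans (ler_norm _))// ltrDl|exists x].
by rewrite f0 ?normr0 ?addr_ge0// => /Kr.
Qed.

End smooth_functions.

(** * Integrals of derivatives *)

Section divergence.
Context {R : realType} {d : nat}.
Local Notation L := (lebesgue_rV (R := R) d).
Implicit Types (f h k : 'rV[R]_d -> R) (v x g : 'rV[R]_d).

Lemma cubeP r x : 0 <= r -> cube r x <-> `|x| <= r.
Proof.
move=> r0; split=> [xr|xr i]; first exact: norm_le_coord.
exact: le_trans (coord_le_norm _ _) xr.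
Qed.

Lemma integrable_supported f r M : measurable_fun setT f -> 0 <= r ->
  (forall x, ~ cube r x -> f x = 0) -> (forall x, `|f x| <= M) ->
  L.-integrable setT (EFin \o f).
Proof.
move=> mf r0 f0 fM.
have mc := @measurable_cube R d r.
have Lc : (L (cube r) < +oo)%E by rewrite lebesgue_cube// ltry.
have -> : EFin \o f = (EFin \o f) \_ (cube r).
  apply/funext => x; rewrite patchE; case: ifPn => //; rewrite notin_setE => xr.
  by rewrite /= f0.
apply/(integrable_mkcond _ mc).
apply: measurable_bounded_integrable => //.
- exact: measurable_funTS.
- exists M; split; first exact: num_real.
  by move=> s Ms x _; exact: le_trans (fM x) (ltW Ms).
Qed.

Lemma integral_shift f v : L.-integrable setT (EFin \o f) ->
  (\int[L]_x (f (x + v)%R)%:E = \int[L]_x (f x)%:E)%E.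
Proof.
move=> fi; have mf : measurable_fun setT (EFin \o f) by case/integrableP: fi.
rewrite [LHS]integralE [RHS]integralE; congr (_ - _)%E.
- rewrite -[RHS](ge0_integral_shift v (measurable_funepos mf))//.
  by apply: eq_integral => x _; rewrite !funeposE.
- rewrite -[RHS](ge0_integral_shift v (measurable_funeneg mf))//.
  by apply: eq_integral => x _; rewrite !funenegE.
Qed.

Lemma integrable_shift f v : L.-integrable setT (EFin \o f) ->
  L.-integrable setT (EFin \o (fun x => f (x + v))).
Proof.
move=> /integrableP[mf fi]; apply/integrableP; split.
  exact: (measurableT_comp mf (measurable_rV_shift v)).
have mf' : measurable_fun setT (abse \o (EFin \o f)) by exact: measurableT_comp.
by have /= -> := ge0_integral_shift v mf' (fun x => abse_ge0 _).
Qed.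

(** The difference quotients of an integrable function have integral 0 by
    translation invariance, and dominated convergence passes to the limit. The
    quotients are taken along the steps 1 / (n + 1), with n.+1%:R as inverse step. *)
Lemma integral_difference_quotient f k v r M C : measurable_fun setT f -> 0 <= r ->
  (forall x, ~ cube r x -> f x = 0) -> (forall x, `|f x| <= M) ->
  (forall n x, `|f (x + n.+1%:R^-1 *: v) - f x| <= C * n.+1%:R^-1) ->
  (forall x, n.+1%:R * (f (x + n.+1%:R^-1 *: v) - f x) @[n --> \oo] --> k x) ->
  L.-integrable setT (EFin \o k) /\ (\int[L]_x (k x)%:E = 0)%E.
Proof.
move=> mf r0 f0 fM fC fk.
pose q n x := n.+1%:R * (f (x + n.+1%:R^-1 *: v) - f x).
have fi := integrable_supported mf r0 f0 fM.
have qi n : L.-integrable setT (EFin \o q n).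
  have := integrableZl measurableT n.+1%:R
    (integrableB measurableT (integrable_shift (n.+1%:R^-1 *: v) fi) fi).
  by apply: eq_integrable.
have q0 n : (\int[L]_x (q n x)%:E = 0)%E.
  under eq_integral do rewrite EFinM EFinB.
  have si := integrable_shift (n.+1%:R^-1 *: v) fi.
  rewrite integralZl//; last exact: (integrableB measurableT si fi).
  by rewrite integralB// integral_shift// subee ?mule0// integrable_fin_num.
have mq n : measurable_fun setT (q n).
  by have /integrableP[/measurable_EFinP] := qi n.
have mk : measurable_fun setT k.
  by apply: (measurable_fun_cvg mq) => x _; exact: fk.
pose r' := r + `|v|; have r'0 : 0 <= r' by rewrite addr_ge0.
pose b x := C * \1_(@cube R d r') x.
have C0 : 0 <= C by have := fC 0%N 0; rewrite invr1 mulr1; exact: le_trans.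
have bi : L.-integrable setT (EFin \o b).
  apply: (@integrable_supported _ r' C) => //.
  - apply: measurable_funM; first exact: measurable_cst.
    by apply: measurable_indic; exact: measurable_cube.
  - by move=> x xr; rewrite /b indicE memNset// mulr0.
  - move=> x; rewrite /b indicE ger0_norm ?mulr_ge0//.
    by case: (_ \in _); rewrite ?mulr1 ?mulr0.
have qb n x : `|q n x| <= b x.
  rewrite /b indicE; have [xr|xr] := boolP (x \in _).
    rewrite mulr1 /q normrM ger0_norm// mulrC -ler_pdivlMr ?ltr0n//.
  rewrite mulr0 normr_le0 /q !f0 ?subrr ?mulr0//.
    move/(cubeP _ r0) => xr'; move: xr; rewrite notin_setE; apply.
    by apply/(cubeP _ r'0); apply: (le_trans xr'); rewrite lerDl.
  move/(cubeP _ r0) => xr'; move: xr; rewrite notin_setE; apply.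
  apply/(cubeP _ r'0); pose w := n.+1%:R^-1 *: v.
  have : `|x + w - w| <= `|x + w| + `|w| by exact: ler_normB.
  rewrite addrK => /le_trans; apply; apply: lerD; first exact: xr'.
  rewrite /w normrZ ger0_norm ?invr_ge0//; apply: ler_piMl => //.
  by rewrite invf_le1 ?ltr0n// ler1n.
have [] := @dominated_convergence _ _ _ L setT measurableT
  (fun n x => (q n x)%:E) (fun x => (k x)%:E) (fun x => (b x)%:E).
- by move=> n; exact/measurable_EFinP.
- exact/measurable_EFinP.
- by apply: aeW => x _; apply: cvg_EFin; [exact: nearW|exact: fk].
- exact: bi.
- by apply: aeW => x n _; rewrite /= lee_fin.
move=> ki _; rewrite /= => cv; split=> //.
have {cv} : (fun _ : nat => 0%E : \bar R) @ \oo --> (\int[L]_x (k x)%:E)%E.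
  by move: cv; under eq_fun do rewrite q0.
by move/cvg_lim => <-//; rewrite lim_cst.
Qed.

End divergence.

Section half_space.
Context {R : realType} {d : nat}.
Local Notation L := (lebesgue_rV (R := R) d).
Implicit Types (f h k : 'rV[R]_d -> R) (v x g : 'rV[R]_d).

Lemma derive_line f v x (t : R) : differentiable f (x + t *: v) ->
  is_derive t 1 (fun s : R => f (x + s *: v)) ('D_v f (x + t *: v)).
Proof.
move=> df; have dv : derivable f (x + t *: v) v by exact: diff_derivable.
have E : (fun s : R => s^-1 *: (f (x + (s *: (1 : R) + t) *: v) - f (x + t *: v))) =
    (fun s : R => s^-1 *: (f (s *: v + (x + t *: v)) - f (x + t *: v))).
  apply/funext => s; congr (_ *: (f _ - _)).
  have -> : s *: (1 : R) = s by rewrite /GRing.scale /= mulr1.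
  by rewrite scalerDl addrCA.
by apply: DeriveDef; [rewrite /derivable /= E|rewrite /derive /= E].
Qed.

Lemma cvg_difference_quotient f v x : differentiable f x ->
  n.+1%:R * (f (x + n.+1%:R^-1 *: v) - f x) @[n --> \oo] --> 'D_v f x.
Proof.
move=> df; have dv : derivable f x v by exact: diff_derivable.
have /(cvgr_dnbhsP _ _ _).1/(_ (@harmonic R)) := dv.
have hn : (forall n, @harmonic R n != 0) /\ (@harmonic R) @ \oo --> (0 : R).
  by split=> [n|]; [rewrite gt_eqF// harmonic_gt0|exact: cvg_harmonic].
move/(_ hn); rewrite -/('D_v f x); apply: cvg_trans; apply: near_eq_cvg.
by apply: nearW => n /=; rewrite invrK [x + _]addrC.
Qed.

(** The mean value theorem on the segment from x to x + t v. *)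
Lemma lipschitz_along f v C x t : (forall y, differentiable f y) ->
  (forall y, `|'D_v f y| <= C) -> 0 <= t -> `|f (x + t *: v) - f x| <= C * t.
Proof.
move=> df dC t0.
have dl s := derive_line (df (x + s *: v)).
have [|c _] := @MVT_segment _ (fun s : R => f (x + s *: v))
  (fun s => 'D_v f (x + s *: v)) 0 t t0.
- apply: continuous_subspaceT => s; apply: differentiable_continuous.
  by apply/derivable1_diffP; have [] := dl s.
rewrite scale0r addr0 subr0 => ->; rewrite normrM (ger0_norm t0).
exact: ler_wpM2r.
Qed.

Lemma derive_supported f v r : (forall x, ~ cube r x -> f x = 0) ->
  forall x, ~ cube r x -> 'D_v f x = 0.
Proof.
move=> f0 x xr; rewrite (@near_eq_derive _ _ _ _ (cst 0)) ?derive_cst//.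
have : open (~` @cube R d r) by apply: closed_openC; exact: closed_cube.
rewrite openE => /(_ _ xr); apply: filterS => y yr; exact: f0.
Qed.

(** Apply [integral_difference_quotient] to f restricted to the half-space. As v
    points into the half-space, a step along v can enter it but not leave it; the
    last hypothesis bounds the jump on entering by the length of the step. It
    holds when v is tangent to the boundary, where no step enters, and when f
    vanishes on the boundary. *)
Lemma integral_half_space f v c g r B : elementary f -> 0 <= r -> 0 <= B ->
  (forall x, ~ cube r x -> f x = 0) -> 0 <= dot v g ->
  (forall x t, 0 <= t -> c + dot x g < 0 -> 0 <= c + dot (x + t *: v) g ->
     `|f (x + t *: v)| <= B * t) ->
  let k x := (0 <= c + dot x g)%R%:R * 'D_v f x in
  L.-integrable setT (EFin \o k) /\ (\int[L]_x (k x)%:E = 0)%E.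
Proof.
move=> ef r0 B0 f0 vg fB k.
have [df dfe] := elementary_derive ef.
have bK : bounded_set (@cube R d r).
  exists r; split; first exact: num_real.
  by move=> s rs x /(cubeP _ r0) xr; exact: le_trans xr (ltW rs).
have [M M0 fM] := elementary_bounded ef bK f0.
have [C C0 fC] := elementary_bounded (dfe v) bK (derive_supported v f0).
pose H x := 0 <= c + dot x g.
pose G x := (H x)%:R * f x.
have mH : measurable [set x | H x].
  rewrite (_ : [set x | H x] = (fun x => dot x g) @^-1` `[- c, +oo[%classic).
    by rewrite -[X in measurable X]setTI; apply: measurable_dot => //; exact: measurable_itv.
  by apply/seteqP; split=> x /=; rewrite /H in_itv /= andbT => h; lra.
have lamE x t : c + dot (x + t *: v) g = c + dot x g + t * dot v g.
  by rewrite dotDl dotZl addrA.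
have Hup x t : 0 <= t -> H x -> H (x + t *: v).
  by move=> t0 Hx; rewrite /H lamE addr_ge0// mulr_ge0.
apply: (@integral_difference_quotient _ _ G k v r M (C + B)) => //.
- apply: measurable_funM; last by apply: continuous_measurable_rV; exact: elementary_continuous.
  rewrite (_ : (fun x => _) = \1_[set x | H x]); first exact: measurable_indic.
  by apply/funext => x; rewrite indicE; congr (nat_of_bool _)%:R; apply/idP/idP; rewrite inE.
- by move=> x xr; rewrite /G f0// mulr0.
- move=> x; rewrite /G; case: (H x); rewrite ?mul1r// mul0r normr0.
  exact: le_trans (fM x).
- move=> n x; have n0 : 0 <= n.+1%:R^-1 :> R by rewrite invr_ge0.
  rewrite /G mulrDl; have [Hx|Hx] := boolP (H x).
    rewrite Hup// !mul1r; apply: (le_trans (lipschitz_along x df fC n0)).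
    by rewrite lerDl mulr_ge0.
  have [Hxt|_] := boolP (H (x + _)); last by rewrite !mul0r subrr normr0 addr_ge0 ?mulr_ge0.
  rewrite mul0r mul1r subr0 (le_trans (fB x _ n0 _ Hxt)) ?lerDr ?mulr_ge0//.
  by rewrite ltNge.
- move=> x; rewrite /G /k -/(H x); have [Hx|Hx] := boolP (H x).
    rewrite !mul1r; apply: cvg_trans (cvg_difference_quotient (v := v) (df x)).
    apply: near_eq_cvg; apply: nearW => n; rewrite Hup ?mul1r// invr_ge0//.
  rewrite !mul0r; apply: cvg_near_cst.
  have lx : 0 < - (c + dot x g) by rewrite oppr_gt0 ltNge.
  suff : \forall n \near \oo, n.+1%:R^-1 * dot v g < - (c + dot x g).
    apply: filterS => n; set a := _ * dot v g => h.
    rewrite (_ : H (x + _) = false) ?mul0r ?subrr ?mulr0//.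
    by apply/negbTE; rewrite /H lamE -ltNge -/a; lra.
  apply: (cvgr_lt 0) lx.
  rewrite -(mul0r (dot v g)); apply: cvgMl; exact: cvg_harmonic.
Qed.

End half_space.

Section null_sets.
Local Open Scope ereal_scope.
Context {disp : measure_display} {T : measurableType disp} {R : realType}.
Variable mu : {measure set T -> \bar R}.
Import HBNNSimple.

(** A simple function below f can be cut off to 0 on N without changing its
    integral, and is then below h; so the supremum that defines the integral does not see N. *)
Lemma ge0_le_integral_null (N : set T) (f h : T -> \bar R) :
  measurable N -> mu N = 0 -> (forall x, 0 <= f x) -> (forall x, 0 <= h x) ->
  (forall x, ~ N x -> f x = h x) -> \int[mu]_x f x <= \int[mu]_x h x.
Proof.
move=> mN N0 f0 h0 fh; rewrite ge0_integralTE//; apply: ub_ereal_sup => _ [s /= sf <-].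
have mCN : measurable (~` N) by exact: measurableC.
pose s' := proj_nnsfun s mCN.
have -> : sintegral mu s = sintegral mu s'.
  rewrite -!integralT_nnsfun.
  rewrite (@ge0_negligible_integral _ _ _ mu setT N)//; last 2 first.
    by apply/measurable_EFinP; exact: measurable_funP.
    by move=> x _; rewrite lee_fin.
  rewrite [RHS](@ge0_negligible_integral _ _ _ mu setT N)//; last 2 first.
    by apply/measurable_EFinP; exact: measurable_funP.
    by move=> x _; rewrite lee_fin.
  apply: eq_integral => x /[!inE] -[_ Nx]; congr EFin.
  by rewrite /s' /= mindicE mem_set// mulr1.
rewrite [leRHS]ge0_integralTE//; apply: ereal_sup_ubound; exists s' => //= x.
have [Nx|Nx] := pselect (N x).
  by rewrite /s' mindicE memNset ?mulr0//=; exact.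
by rewrite -fh//; apply: le_trans (sf x); rewrite /s' mindicE mem_set// mulr1.
Qed.

(** The energies integrate functions that are prescribed on the open elements
    only. Their values on the null skeleton are arbitrary, and such functions are
    integrated by this lemma through a simple representative. *)
Lemma integral_congr_null (D N : set T) (f h : T -> \bar R) :
  measurable N -> mu N = 0 -> (forall x, D x -> ~ N x -> f x = h x) ->
  \int[mu]_(x in D) f x = \int[mu]_(x in D) h x.
Proof.
move=> mN N0 fh; rewrite [LHS]integralE [RHS]integralE.
have E k1 k2 : (forall x, D x -> ~ N x -> k1 x = k2 x) ->
    (forall x, 0 <= k1 x) -> (forall x, 0 <= k2 x) ->
    \int[mu]_(x in D) k1 x = \int[mu]_(x in D) k2 x.
  move=> k12 k10 k20; rewrite [LHS]integral_mkcond [RHS]integral_mkcond.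
  have p0 k x : (forall x, 0 <= k x) -> 0 <= (k \_ D) x.
    by move=> k0; rewrite patchE; case: ifP.
  apply/eqP; rewrite eq_le; apply/andP; split;
    apply: (@ge0_le_integral_null N) => // x; try (by apply: p0);
    by move=> Nx; rewrite !patchE; case: ifPn => // /[!inE] Dx; rewrite k12.
congr (_ - _); apply: E => [x Dx Nx|x|x]; rewrite ?funepos_ge0 ?funeneg_ge0//.
  by rewrite !funeposE fh.
by rewrite !funenegE fh.
Qed.

Lemma Rintegral_congr_null (D N : set T) (f h : T -> R) :
  measurable N -> mu N = 0 -> (forall x, D x -> ~ N x -> f x = h x) ->
  (\int[mu]_(x in D) f x = \int[mu]_(x in D) h x)%R.
Proof.
move=> mN N0 fh; congr fine; apply: (integral_congr_null mN N0) => x Dx Nx.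
by rewrite fh.
Qed.

End null_sets.

(** * Integration by parts for affine fields *)

Section affine_fields.
Context {R : realType} {d : nat}.
Local Notation L := (lebesgue_rV (R := R) d).
Implicit Types (f h k : 'rV[R]_d -> R) (v x g a : 'rV[R]_d).

Definition zero_integral k :=
  L.-integrable setT (EFin \o k) /\ (\int[L]_x (k x)%:E = 0)%E.

Lemma zero_integral0 : zero_integral (fun=> 0).
Proof.
split; first exact: integrable0.
by apply: integral0_eq.
Qed.

Lemma zero_integralD k h : zero_integral k -> zero_integral h ->
  zero_integral (fun x => k x + h x).
Proof.
move=> [ki k0] [hi h0]; split; first exact: (integrableD measurableT ki hi).
by under eq_integral do rewrite EFinD; rewrite integralD// k0 h0 adde0.
Qed.

Lemma zero_integralZ c k : zero_integral k -> zero_integral (fun x => c * k x).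
Proof.
move=> [ki k0]; split; first exact: (integrableZl measurableT c ki).
by under eq_integral do rewrite EFinM; rewrite integralZl// k0 mule0.
Qed.

Lemma zero_integral_sum (I : Type) (r : seq I) (F : I -> 'rV[R]_d -> R) :
  (forall i, zero_integral (F i)) -> zero_integral (fun x => \sum_(i <- r) F i x).
Proof.
move=> F0; elim: r => [|i r IH].
  under eq_fun do rewrite big_nil; exact: zero_integral0.
under eq_fun do rewrite big_cons; exact: zero_integralD.
Qed.

Lemma eq_zero_integral k h : k =1 h -> zero_integral k -> zero_integral h.
Proof. by move=> /funext ->. Qed.

Lemma derive_grad f v x : differentiable f x -> 'D_v f x = dot v (grad f x).
Proof.
move=> df; rewrite deriveE// {1}(row_sum_delta v) linear_sum.
by apply: eq_bigr => i _; rewrite linearZ /= mxE deriveE.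
Qed.

Definition supported_in r f := forall x, ~ cube r x -> f x = 0.

Lemma supported_mul r f h : supported_in r f -> supported_in r (fun x => h x * f x).
Proof. by move=> f0 x /f0 ->; rewrite mulr0. Qed.

Lemma zero_integral_derive f v r : elementary f -> 0 <= r -> supported_in r f ->
  zero_integral (fun x => 'D_v f x).
Proof.
move=> ef r0 f0.
have H1 : 0 <= dot v 0 by rewrite dot0r.
have H2 x t : 0 <= t -> 0 + dot x 0 < 0 -> 0 <= 0 + dot (x + t *: v) 0 ->
    `|f (x + t *: v)| <= 0 * t by rewrite dot0r addr0 ltxx.
have Z := integral_half_space ef r0 (lexx 0) f0 H1 H2.
apply: eq_zero_integral Z => x.
by rewrite dot0r addr0 lexx mul1r.
Qed.

(** No step along a tangential direction crosses the boundary of the half-space. *)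
Lemma zero_integral_half_tangent f v c g r : elementary f -> 0 <= r ->
  supported_in r f -> dot v g = 0 ->
  zero_integral (fun x => (0 <= c + dot x g)%R%:R * 'D_v f x).
Proof.
move=> ef r0 f0 vg; apply: (@integral_half_space _ _ f v c g r 0) => //.
  by rewrite vg.
move=> x t t0 lx; rewrite dotDl dotZl vg mulr0 addr0 => lx'.
by move: lx; rewrite ltNge lx'.
Qed.

(** The function is small of first order at the boundary because of its affine
    factor. *)
Lemma zero_integral_half_normal f w c g r : elementary f -> 0 <= r ->
  supported_in r f -> dot w g = 1 ->
  zero_integral (fun x => (0 <= c + dot x g)%R%:R * 'D_w (fun y => (c + dot y g) * f y) x).
Proof.
move=> ef r0 f0 wg.
have bK : bounded_set (@cube R d r).
  exists r; split; first exact: num_real.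
  by move=> s rs x /(cubeP _ r0) xr; exact: le_trans xr (ltW rs).
have [M M0 fM] := elementary_bounded ef bK f0.
apply: (@integral_half_space _ _ _ w c g r M) => //.
- by apply: elementary_mul => //; exact: elementary_affine.
- exact: supported_mul.
- by rewrite wg.
move=> x t t0 lx lx'; rewrite normrM mulrC (ger0_norm lx').
have lt : c + dot (x + t *: w) g <= t.
  by move: lx; rewrite dotDl dotZl wg mulr1 => lx; lra.
by apply: ler_pM.
Qed.

Definition affine_field a b x0 x : 'rV[R]_d := a + b *: (x - x0).

Lemma coord_affine i x x0 : (x - x0) ord0 i = - x0 ord0 i + dot x (delta_mx ord0 i).
Proof. by rewrite !mxE dotC dot_delta addrC. Qed.

Lemma elementary_coord_mul f i x0 : elementary f ->
  elementary (fun x => (x - x0) ord0 i * f x).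
Proof.
move=> ef; under eq_fun do rewrite coord_affine.
by apply: elementary_mul => //; exact: elementary_affine.
Qed.

Lemma derive_affine_mul f v c g x : differentiable f x ->
  'D_v (fun y => (c + dot y g) * f y) x = dot v g * f x + (c + dot x g) * 'D_v f x.
Proof.
move=> df.
have da : differentiable (fun y : 'rV[R]_d => c + dot y g) x.
  by apply: differentiableD => //; exact: differentiable_dot.
rewrite deriveM; [|exact: diff_derivable|exact: diff_derivable].
rewrite addrC /GRing.scale /= mulrC; congr (_ * _ + _).
rewrite deriveD ?derive_cst ?add0r ?derive_dot//.
by apply: diff_derivable; exact: differentiable_dot.
Qed.

Lemma derive_coord_mul f v i x x0 : differentiable f x ->
  'D_v (fun y => (y - x0) ord0 i * f y) x = v ord0 i * f x + (x - x0) ord0 i * 'D_v f x.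
Proof.
move=> df; under eq_fun do rewrite coord_affine.
by rewrite derive_affine_mul// -coord_affine (dotC v) dot_delta.
Qed.

(** The integrand is the divergence of f (a + b (x - x0)), written as a
    derivative of f along a plus the i-th derivatives of b (x - x0)_i f. *)
Lemma zero_integral_affine_field f a b x0 r : elementary f -> 0 <= r ->
  supported_in r f ->
  zero_integral (fun x => dot (affine_field a b x0 x) (grad f x) + b * d%:R * f x).
Proof.
move=> ef r0 f0; have [df _] := elementary_derive ef.
have Z1 := zero_integral_derive a ef r0 f0.
have Z2 i := zero_integral_derive (delta_mx ord0 i) (elementary_coord_mul i x0 ef) r0
  (@supported_mul r _ (fun x => (x - x0) ord0 i) f0).
apply: eq_zero_integral (zero_integralD Z1 (zero_integralZ b
  (zero_integral_sum (index_enum 'I_d) Z2))) => x /=.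
rewrite /affine_field dotDl dotZl derive_grad// -addrA; congr (_ + _).
rewrite -mulrA -mulrDr; congr (_ * _).
under eq_bigr do rewrite derive_coord_mul// mxE !eqxx mul1r.
rewrite big_split /= sumr_const card_ord addrC; congr (_ + _); last by rewrite mulr_natl.
by apply: eq_bigr => i _; rewrite derive_grad// dot_delta.
Qed.

(** The divergence theorem on a half-space without its boundary integral: that
    integral is represented by a . g times the half-space integral of the
    derivative of f along w. Split a and the unit vectors into a multiple of w and a vector
    tangent to the boundary. The tangential parts contribute nothing by
    [zero_integral_half_tangent]; the normal part of x - x0 is the affine
    function c + x . g itself, which vanishes at the boundary, so
    [zero_integral_half_normal] applies. Only the normal part of a is left. *)
Lemma zero_integral_half_affine_field f a b x0 w c g r : elementary f -> 0 <= r ->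
  supported_in r f -> dot w g = 1 -> c + dot x0 g = 0 ->
  zero_integral (fun x => (0 <= c + dot x g)%R%:R *
    (dot (affine_field a b x0 x) (grad f x) + b * d%:R * f x
     - dot a g * 'D_w f x)).
Proof.
move=> ef r0 f0 wg x0g; have [df _] := elementary_derive ef.
(* tangential parts of the i-th unit vector and of a *)
pose tau i : 'rV[R]_d := delta_mx ord0 i - g ord0 i *: w.
have tg i : dot (tau i) g = 0 by rewrite dotBl dotZl wg mulr1 dot_delta subrr.
pose ta := a - dot a g *: w.
have tag : dot ta g = 0 by rewrite dotBl dotZl wg mulr1 subrr.
have Z1 := zero_integral_half_tangent c ef r0 f0 tag.
have Z2 i := zero_integral_half_tangent c (elementary_coord_mul i x0 ef) r0
  (@supported_mul r _ (fun x => (x - x0) ord0 i) f0) (tg i).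
have Z3 := zero_integral_half_normal c ef r0 f0 wg.
apply: eq_zero_integral (zero_integralD Z1 (zero_integralZ b
  (zero_integralD Z3 (zero_integral_sum (index_enum 'I_d) Z2)))) => x /=.
rewrite -mulr_sumr -mulrDr mulrCA -mulrDr; congr (_ * _).
rewrite derive_affine_mul// wg mul1r.
under eq_bigr do rewrite derive_coord_mul//.
rewrite big_split /= -mulr_suml.
have -> : \sum_i tau i ord0 i = d%:R - 1.
  rewrite (eq_bigr (fun i => 1 - w ord0 i * g ord0 i)) => [|i _].
    by rewrite sumrB sumr_const card_ord -/(dot w g) wg.
  by rewrite !mxE !eqxx mulrC.
have -> : \sum_i (x - x0) ord0 i * 'D_(tau i) f x =
    dot (x - x0) (grad f x) - (c + dot x g) * 'D_w f x.
  rewrite (eq_bigr (fun i => (x - x0) ord0 i * grad f x ord0 i -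
      (x - x0) ord0 i * g ord0 i * 'D_w f x)) => [|i _]; last first.
    by rewrite !derive_grad// /tau dotBl dotZl dot_delta mulrBr mulrA.
  rewrite sumrB -mulr_suml; congr (_ - _ * _).
  by rewrite -/(dot (x - x0) g) dotBl -[c]addr0 -(subrr (dot x0 g)) addrA x0g; ring.
rewrite /affine_field /ta !derive_grad// !(dotDl, dotZl, dotNl).
by ring.
Qed.

End affine_fields.

(** * A function with vanishing integrals over cylinders *)

Section cylinders.
Context {R : realType} {d : nat}.
Local Notation L := (lebesgue_rV (R := R) d).

(** Conditions only on the coordinates in S make the whole space a member of a
    family that is stable under intersections and generates the Borel sets. *)
Definition cylinder (S : {set 'I_d}) (a : 'rV[R]_d) : set 'rV[R]_d :=
  [set x | forall i, i \in S -> a ord0 i < x ord0 i].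

Let cylinders : set (set 'rV[R]_d) := [set A | exists S a, A = cylinder S a].

Lemma cylinderI : setI_closed cylinders.
Proof.
move=> _ _ [S [a ->]] [S' [a' ->]].
pose b : 'rV[R]_d := \row_i (if i \in S then
  if i \in S' then Num.max (a ord0 i) (a' ord0 i) else a ord0 i else a' ord0 i).
exists (S :|: S')%SET, b; apply/seteqP; split=> x /=.
  move=> [xS xS'] i; rewrite finset.inE mxE.
  case: ifPn => iS /=; last by move=> iS'; exact: xS'.
  by case: ifPn => iS' _; [rewrite gt_max (xS _ iS) (xS' _ iS')|exact: xS].
move=> xb; split=> i iS; have := xb i; rewrite finset.inE iS ?orbT mxE iS => /(_ isT).
  by case: ifP => // _; rewrite gt_max => /andP[].
by case: ifP => // _; rewrite gt_max => /andP[].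
Qed.

Lemma measurable_cylinder S a : measurable (cylinder S a).
Proof.
apply: (@measurable_forall 'I_d) => i.
have [iS|iS] := boolP (i \in S); last first.
  by rewrite [X in measurable X](_ : _ = setT)//; apply/seteqP; split.
rewrite [X in measurable X](_ : _ = setT `&`
   (fun x : 'rV[R]_d => x ord0 i) @^-1` `]a ord0 i, +oo[%classic).
  by apply: measurable_rV_coord => //; exact: measurable_itv.
rewrite setTI; apply/seteqP; split=> x /=; rewrite in_itv /= andbT; first by apply.
by [].
Qed.

Lemma measurable_cylindersE : @measurable _ 'rV[R]_d `<=` <<s cylinders >>.
Proof.
apply: smallest_sub; first exact: smallest_sigma_algebra.
move=> B; rewrite -bigcup_seq/= => -[i _ [C mC <-]]; rewrite setTI.
have : sigma_algebra setT
    [set C : set R | <<s cylinders >> ((fun x : 'rV[R]_d => x ord0 i) @^-1` C)].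
  have [s0 sC sU] := smallest_sigma_algebra [set: 'rV[R]_d] cylinders.
  split=> /=.
  - by rewrite preimage_set0.
  - by move=> A sA; rewrite !setTD preimage_setC -setTD; exact: sC.
  - by move=> F sF; rewrite preimage_bigcup; exact: sU.
move=> sA; have {}mC : <<s @RGenOInfty.G R >> C.
  suff : (@RGenOInfty.G R).-sigma.-measurable C by [].
  by rewrite -RGenOInfty.measurableE.
move: C mC; apply: smallest_sub => //.
move=> _ [r ->] /=; apply: sub_sigma_algebra; exists [set i]%SET, (const_mx r).
apply/seteqP; split=> x /=; rewrite in_itv /= andbT.
  by move=> rx j; rewrite finset.inE mxE => /eqP ->.
by move=> /(_ i); rewrite finset.inE mxE; apply.
Qed.

(** The measurable sets over which W has integral 0 form a lambda-system, which
    contains the generated sigma-algebra by Dynkin's theorem. *)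
Lemma ae_eq0_cylinders (W : 'rV[R]_d -> R) : L.-integrable setT (EFin \o W) ->
  (forall S a, (\int[L]_(x in cylinder S a) (W x)%:E = 0)%E) ->
  {ae L, forall x, W x = 0}.
Proof.
move=> Wi W0.
pose H := [set A : set 'rV[R]_d | measurable A /\ (\int[L]_(x in A) (W x)%:E = 0)%E].
have WiS A : measurable A -> L.-integrable A (EFin \o W).
  by move=> mA; apply: integrableS Wi.
have HT : H setT.
  split=> //; have := W0 finset.set0 0; congr (integral _ _ _ = _).
  by apply/seteqP; split=> // x _ i; rewrite finset.inE.
have lH : lambda_system setT H.
  apply/dynkin_lambda_system; split=> //.
  - move=> A [mA A0]; split; first exact: measurableC.
    have : (\int[L]_(x in A `|` ~` A) (W x)%:E = 0)%E by rewrite setUv; case: HT.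
    rewrite integral_setU_EFin//; [|exact: measurableC| | ].
    + by rewrite A0 add0e.
    + by rewrite setUv; case/integrableP: Wi => /measurable_EFinP.
    + by apply/disj_set2P; rewrite setICr.
  - move=> F tF HF; split; first by apply: bigcupT_measurable => n; case: (HF n).
    rewrite integral_bigcup//.
    + by rewrite eseries0// => n _ _; case: (HF n).
    + by move=> n; case: (HF n).
    + by apply: WiS; apply: bigcupT_measurable => n; case: (HF n).
have sub : <<s cylinders >> `<=` H.
  apply: (lambda_system_subset cylinderI lH) => // _ [S [a ->]].
  by split; [exact: measurable_cylinder|exact: W0].
have mW : measurable_fun setT (EFin \o W) by case/integrableP: Wi.
have := @integral_ae_eq _ _ _ L setT measurableT (EFin \o W) (cst 0%E)
  (integrable0 L setT) mW.
have hE (A : set 'rV[R]_d) : A `<=` setT -> measurable A ->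
    (\int[L]_(x in A) (cst 0 x) = \int[L]_(x in A) (EFin \o W) x)%E.
  move=> _ mA; rewrite integral0; have [_] := sub _ (measurable_cylindersE mA).
  by move=> <-.
move=> /(_ hE); apply: filterS => x /(_ I) /= /esym []; exact.
Qed.

End cylinders.

(** * The distributional divergence on an element *)

Section weak_divergence.
Context {R : realType} {d : nat}.
Local Notation L := (lebesgue_rV (R := R) d).
Implicit Types (f : 'rV[R]_d -> R) (F Omega : set 'rV[R]_d).

Lemma elementary_test_function Omega F f : elementary f -> closed F ->
  bounded_set F -> F `<=` Omega -> (forall x, ~ F x -> f x = 0) ->
  test_function Omega f.
Proof.
move=> ef cF bF FO f0.
have sF : closure [set x | f x != 0] `<=` F.
  rewrite [F](closure_id _).1//; apply: closure_subset => x /= /eqP fx.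
  by apply: contrapT => /f0.
split; [exact: elementary_smooth| |exact: subset_trans FO].
apply: bounded_closed_compact; last exact: closed_closure.
by case: bF => M [Mr hM]; exists M; split=> // s Ms x /sF; exact: hM.
Qed.

Lemma grad_supported F f : closed F -> (forall x, ~ F x -> f x = 0) ->
  forall x, ~ F x -> grad f x = 0.
Proof.
move=> cF f0 x Fx; apply/rowP => i; rewrite !mxE.
rewrite (@near_eq_derive _ _ _ _ (cst 0)) ?derive_cst//.
have : open (~` F) by exact: closed_openC.
by rewrite openE => /(_ _ Fx); apply: filterS => y; exact: f0.
Qed.

(** |w| <= 1 + w^2 on a set of finite measure. *)
Lemma L2_integrable Omega (w : 'rV[R]_d -> R) : measurable Omega ->
  (L Omega < +oo)%E -> L2 Omega w -> L.-integrable Omega (EFin \o w).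
Proof.
move=> mO LO [mw w2]; apply/integrableP; split; first exact/measurable_EFinP.
apply: (@le_lt_trans _ _ (\int[L]_(x in Omega) (1%:E + (w x ^+ 2)%:E))%E).
  apply: ge0_le_integral => //.
  - by apply: measurableT_comp => //; exact/measurable_EFinP.
  - apply/measurable_EFinP; apply: measurable_funD; first exact: measurable_cst.
    exact: measurable_funX.
  - move=> x _ /=; rewrite -EFinD lee_fin -(real_normK (num_real (w x))).
    have := sqr_ge0 (`|w x| - 1); have := normr_ge0 (w x).
    by move: `|w x| => z; nra.
rewrite ge0_integralD//.
- by rewrite integral_cst// mul1e lte_add_pinfty.
- by move=> x _; rewrite lee_fin sqr_ge0.
- by apply/measurable_EFinP; exact: measurable_funX.
Qed.

Lemma bounded_lty Omega : bounded_set Omega -> measurable Omega -> (L Omega < +oo)%E.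
Proof. by move=> bO mO; exact: lebesgue_rV_bounded. Qed.

(** Only the values of the field on the support F of the test function matter, up
    to a null set, so the field may be replaced by one that is given by a formula
    on the whole space. *)
Lemma weak_div_test Omega y g F f (Y : 'rV[R]_d -> 'rV[R]_d) N : weak_div Omega y g ->
  elementary f -> closed F -> bounded_set F -> F `<=` Omega ->
  (forall x, ~ F x -> f x = 0) -> measurable N -> L N = 0%E ->
  (forall x, F x -> ~ N x -> y x = Y x) ->
  \int[L]_x dot (Y x) (grad f x) = - \int[L]_(x in Omega) (g x * f x).
Proof.
move=> [_ wd] ef cF bF FO f0 mN N0 yY.
rewrite -(wd f (elementary_test_function ef cF bF FO f0)) [RHS]Rintegral_mkcond.
apply: (Rintegral_congr_null mN N0) => x _ Nx; rewrite patchE.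
have [Fx|Fx] := pselect (F x); first by rewrite mem_set ?yY//; exact: FO.
by rewrite (grad_supported cF f0 Fx) !dot0r; case: ifP.
Qed.

Lemma bounded_supported F f : bounded_set F -> (forall x, ~ F x -> f x = 0) ->
  exists2 r, 0 <= r & supported_in r f.
Proof.
move=> /bounded_subset_cube[r r0 Fr] f0; exists r; first exact: ltW.
by move=> x xr; apply: f0 => /Fr.
Qed.

End weak_divergence.

Lemma cvg_bigprod {R : realType} (I : Type) (r : seq I) (u : I -> nat -> R) (l : I -> R) :
  (forall i, u i n @[n --> \oo] --> l i) ->
  \prod_(i <- r) u i n @[n --> \oo] --> \prod_(i <- r) l i.
Proof.
move=> ul; elim: r => [|i r IH].
  by rewrite big_nil; apply: cvg_near_cst; apply: nearW => n; rewrite big_nil.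
rewrite big_cons; under eq_fun do rewrite big_cons.
exact: cvgM.
Qed.

Section divergence_on_simplex.
Context {R : realType} {d : nat}.
Local Notation L := (lebesgue_rV (R := R) d).
Variables (Omega : set 'rV[R]_d) (P : 'M[R]_(d.+1, d)).
Hypotheses (oO : open Omega) (bO : bounded_set Omega).
Hypotheses (Pf : affinely_independent P) (PO : (simplex P)° `<=` Omega).
Variables (y : 'rV[R]_d -> 'rV[R]_d) (g : 'rV[R]_d -> R).
Variables (a x0 : 'rV[R]_d) (b : R).
Hypotheses (yg : weak_div Omega y g).
Hypotheses (yE : forall x, (simplex P)° x -> y x = affine_field a b x0 x).

Let mO : measurable Omega. Proof. exact: open_measurable_rV. Qed.

Let core (k : nat) : set 'rV[R]_d := [set x | forall j, k.+1%:R^-1 <= bary P x ord0 j].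
Let cutoff (k : nat) x := \prod_(j < d.+1) rho 0 (bary P x ord0 j - k.+1%:R^-1).

Lemma core_interior k : core k `<=` (simplex P)°.
Proof.
move=> x cx; apply/(interior_simplex Pf) => j; apply: lt_le_trans (cx j).
by rewrite invr_gt0.
Qed.

Lemma closed_core k : closed (core k).
Proof.
have -> : core k = \bigcap_(j in [set: 'I_d.+1]) [set x | k.+1%:R^-1 <= bary P x ord0 j].
  by apply/seteqP; split=> x /= h i => [_|]; apply: h.
apply: closed_bigI => j _.
apply: (closed_comp (f := fun x => bary P x ord0 j)) (@closed_ge R _) => x _.
exact: continuous_bary.
Qed.

Lemma bounded_core k : bounded_set (core k).
Proof.
case: (bounded_simplex Pf) => M [Mr hM]; exists M; split=> // s Ms x cx.
by apply: (hM s Ms); apply: interior_subset; exact: core_interior cx.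
Qed.

Lemma elementary_cutoff k : elementary (cutoff k).
Proof.
apply: elementary_prod => j; apply: elementary_rho.
under eq_fun do rewrite bary_affine addrAC.
exact: elementary_affine.
Qed.

Lemma cutoff_supported k x : ~ core k x -> cutoff k x = 0.
Proof.
move=> /existsNP[j /negP]; rewrite -ltNge => xj.
by rewrite /cutoff (bigD1 j)//= rho_le0 ?mul0r// subr_le0 ltW.
Qed.

(** Test the distributional and the classical divergence of the affine field with
    the same f. *)
Lemma weak_div_core k f : elementary f -> (forall x, ~ core k x -> f x = 0) ->
  \int[L]_(x in Omega) ((g x - b * d%:R) * f x) = 0.
Proof.
move=> ef f0.
have [r r0 fr] := bounded_supported (bounded_core k) f0.
have := @weak_div_test _ _ Omega y g (core k) f (affine_field a b x0) set0 yg ef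
  (@closed_core k) (@bounded_core k) (subset_trans (@core_interior k) PO) f0
  measurable0 (measure0 _) (fun x cx _ => yE (core_interior cx)).
have [Zi Z0] := zero_integral_affine_field a b x0 ef r0 fr.
have [df dfe] := elementary_derive ef.
have [M M0 fM] := elementary_bounded ef (bounded_core k) f0.
have mf : measurable_fun setT f.
  by apply: continuous_measurable_rV; exact: elementary_continuous.
have fi : L.-integrable setT (EFin \o f) by exact: (integrable_supported mf r0 fr fM).
have gi : L.-integrable Omega (EFin \o g).
  by apply: L2_integrable => //; [exact: bounded_lty|case: yg].
have fiO : L.-integrable Omega (EFin \o f) by apply: integrableS fi.
have gfi : L.-integrable Omega (EFin \o (fun x => g x * f x)).
  have := integrableMl mO gi (measurable_funTS mf).
  apply; exists M; split; first exact: num_real.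
  by move=> s Ms x _; exact: le_trans (fM x) (ltW Ms).
have -> : \int[L]_(x in Omega) ((g x - b * d%:R) * f x) =
    \int[L]_(x in Omega) (g x * f x) - b * d%:R * \int[L]_x f x.
  under eq_Rintegral do rewrite mulrBl.
  rewrite RintegralB//; last exact: (integrableZl mO (b * d%:R) fiO).
  rewrite RintegralZl//; congr (_ - _ * _).
  rewrite Rintegral_mkcond; apply: eq_Rintegral => x _; rewrite patchE.
  case: ifPn => //; rewrite notin_setE => Ox; apply/esym/f0 => cx; apply: Ox.
  exact/PO/(core_interior cx).
move=> E; have {E} -> : \int[L]_(x in Omega) (g x * f x) =
    - \int[L]_x dot (affine_field a b x0 x) (grad f x) by rewrite E opprK.
have bfi := integrableZl measurableT (b * d%:R) fi.
have dgi : L.-integrable setT (EFin \o (fun x => dot (affine_field a b x0 x) (grad f x))).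
  have := integrableB measurableT Zi bfi; apply: eq_integrable => // x _ /=.
  by rewrite -EFinD addrK.
have : \int[L]_x dot (affine_field a b x0 x) (grad f x) + b * d%:R * \int[L]_x f x = 0.
  by rewrite -RintegralZl// -RintegralD// /Rintegral Z0.
by move=> /eqP; rewrite addr_eq0 => /eqP ->; rewrite opprK subrr.
Qed.

(** Smooth approximations of the indicator of the positive half-line. *)
Lemma rho_scaled_cvg (t : R) :
  rho 0 (n.+1%:R * t) @[n --> \oo] --> ((0 < t)%R%:R : R).
Proof.
have [t0|t0] := ltrP 0 t; last first.
  by apply: cvg_near_cst; apply: nearW => n; rewrite rho_le0// mulr_ge0_le0.
have E : (fun n => rho 0 (n.+1%:R * t)) = (fun n => expR (- (@harmonic R n * t^-1))).
  apply/funext => n; rewrite /rho mulr_gt0// expr0 mul1r invfM.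
  by congr (expR (- (_ * _))).
rewrite E -[X in _ --> X]/(1 : R) -expR0 -oppr0 -(mul0r t^-1).
apply: (cvg_comp (fun n => - (harmonic n * t^-1)) (@expR R)); last exact: continuous_expR.
by apply: cvgN; apply: cvgMl; exact: cvg_harmonic.
Qed.

Lemma rho_le1 t : rho 0 t <= 1 :> R.
Proof.
rewrite /rho; case: ltrP => // t0; rewrite expr0 mul1r -expR0 ler_expR.
by rewrite oppr_le0 invr_ge0 ltW.
Qed.

(** Multiply the cutoff by smooth approximations of the indicator of a cylinder:
    in the limit (g - b d) cutoff has integral 0 over every cylinder, so it
    vanishes almost everywhere. *)
Lemma ae_divergence_core k :
  {ae L, forall x, Omega x -> 0 < cutoff k x -> g x = b * d%:R}.
Proof.
pose W x : R := if x \in Omega then (g x - b * d%:R) * cutoff k x else 0.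
have WE : EFin \o W = (fun x => ((g x - b * d%:R) * cutoff k x)%:E) \_ Omega.
  by apply/funext => x; rewrite patchE /W /=; case: ifP.
have ec := elementary_cutoff k.
have [M M0 cM] := elementary_bounded ec (bounded_core k) (@cutoff_supported k).
have Wi : L.-integrable setT (EFin \o W).
  rewrite WE; apply/(integrable_mkcond _ mO).
  have gi : L.-integrable Omega (EFin \o g).
    by apply: L2_integrable => //; [exact: bounded_lty|case: yg].
  have ci : L.-integrable Omega (cst (b * d%:R)%:E).
    apply: (@measurable_bounded_integrable _ _ _ L (cst (b * d%:R))) => //.
      exact: bounded_lty.
    exists `|b * d%:R|; split; first exact: num_real.
    by move=> s Ms x _; exact: ltW.
  have := @integrableMl _ _ _ L Omega mO _ (cutoff k) (integrableB mO gi ci).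
  apply.
    by apply: measurable_funTS; apply: continuous_measurable_rV; exact: elementary_continuous.
  exists M; split; first exact: num_real.
  by move=> s Ms x _; exact: le_trans (cM x) (ltW Ms).
have mW : measurable_fun setT W by have /integrableP[/measurable_EFinP] := Wi.
have : {ae L, forall x, W x = 0}.
  apply: ae_eq0_cylinders => // S c.
  pose q (n : nat) (x : 'rV[R]_d) : R :=
    \prod_(i < d) (if i \in S then rho 0 (n.+1%:R * (x ord0 i - c ord0 i)) else 1).
  have eq n : elementary (q n).
    apply: elementary_prod => i; case: (i \in S); last exact: elementary_cst.
    apply: elementary_rho; apply: elementary_scale.
    have := elementary_affine (- c ord0 i) (delta_mx ord0 i); congr elementary.
    by apply/funext => x; rewrite dotC dot_delta addrC.
  have q01 n x : 0 <= q n x <= 1.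
    apply/andP; split; first by apply: prodr_ge0 => i _; case: ifP => // _; exact: rho_ge0.
    apply: prodr_ile1 => i _; case: ifP => _; last by rewrite ler01 lexx.
    by apply/andP; split; [exact: rho_ge0|exact: rho_le1].
  have mq n : measurable_fun setT (q n).
    by apply: continuous_measurable_rV; exact: elementary_continuous.
  have qcvg x : q n x @[n --> \oo] --> (\1_(cylinder S c) x : R).
    rewrite indicE; have -> : (x \in cylinder S c)%:R =
        \prod_(i < d) (if i \in S then (0 < x ord0 i - c ord0 i)%R%:R else 1) :> R.
      have [xc|xc] := boolP (x \in _).
        rewrite big1// => i _; case: ifP => // iS; rewrite subr_gt0.
        by move: xc; rewrite inE => /(_ i iS) ->.
      move: xc; rewrite notin_setE => /existsNP[i /not_implyP[iS /negP]].
      by rewrite -subr_gt0 => /negbTE xc; rewrite (bigD1 i)//= iS xc mul0r.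
    apply: cvg_bigprod => i; case: (i \in S); last exact: cvg_cst.
    exact: rho_scaled_cvg.
  have qle n x : `|W x * q n x| <= `|W x|.
    have /andP[q0 q1] := q01 n x.
    by rewrite normrM (ger0_norm q0); apply: ler_piMr.
  have mWq n : measurable_fun setT (fun x => W x * q n x) by exact: measurable_funM.
  have Wq0 n : (\int[L]_x (W x * q n x)%:E = 0)%E.
    have Wqi : L.-integrable setT (fun x => (W x * q n x)%:E).
      apply: le_integrable Wi => //; first exact/measurable_EFinP.
      by move=> x _ /=; rewrite lee_fin.
    have f0 x : ~ core k x -> cutoff k x * q n x = 0.
      by move=> kx; rewrite cutoff_supported// mul0r.
    rewrite -[LHS]fineK ?integrable_fin_num//; congr EFin.
    rewrite -[RHS](weak_div_core (elementary_mul ec (eq n)) f0).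
    rewrite [RHS]Rintegral_mkcond; apply: eq_Rintegral => x _; rewrite patchE /W.
    by case: ifP => _; rewrite ?mul0r// mulrA.
  have [] := @dominated_convergence _ _ _ L setT measurableT
    (fun n x => (W x * q n x)%:E) (fun x => (W x * \1_(cylinder S c) x)%:E)
    (abse \o (EFin \o W)).
  - by move=> n; exact/measurable_EFinP.
  - apply/measurable_EFinP; apply: measurable_funM => //.
    by apply: measurable_indic; exact: measurable_cylinder.
  - apply: aeW => x _; apply: cvg_EFin; first exact: nearW.
    by apply: cvgM; [exact: cvg_cst|exact: qcvg].
  - exact: integrable_abse.
  - by apply: aeW => x n _; rewrite /= lee_fin.
  move=> _ _; rewrite /= => cv.
  rewrite integral_mkcond.
  transitivity (\int[L]_x (W x * \1_(cylinder S c) x)%:E)%E.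
    apply: eq_integral => x _; rewrite patchE indicE.
    by case: ifP => _; rewrite ?mulr1 ?mulr0.
  have {cv} : (fun _ : nat => 0%E : \bar R) @ \oo -->
      (\int[L]_x (W x * \1_(cylinder S c) x)%:E)%E.
    by move: cv; under eq_fun do rewrite Wq0.
  by move/cvg_lim => <-//; rewrite lim_cst.
apply: filterS => x Wx Ox kx; apply/eqP; rewrite -subr_eq0.
move: Wx; rewrite /W mem_set// => /eqP.
by rewrite mulf_eq0 (gt_eqF kx) orbF.
Qed.

(** Exhaust the open simplex by the cores on which all barycentric coordinates
    exceed 1 / (k + 1). *)
Lemma divergence_on_simplex : exists N, [/\ measurable N, L N = 0%E &
  forall x, (simplex P)° x -> ~ N x -> g x = b * d%:R].
Proof.
pose B k := ~` [set x | Omega x -> 0 < cutoff k x -> g x = b * d%:R].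
have /negligible_bigcup[N [mN N0 BN]] : forall k, L.-negligible (B k).
  by move=> k; exact: ae_divergence_core.
exists N; split=> // x Px Nx.
have [k kx] : exists k : nat, forall j, k.+1%:R^-1 < bary P x ord0 j.
  have x0' := (interior_simplex Pf x).1 Px.
  have : \forall k \near \oo, forall j : 'I_d.+1, k.+1%:R^-1 < bary P x ord0 j.
    apply: (@filter_forall _ 'I_d.+1 (fun j (k : nat) => k.+1%:R^-1 < bary P x ord0 j)) => j.
    exact: (cvgr_lt 0 (@cvg_harmonic R)).
  by move=> [k _ /(_ k (leqnn k))]; exists k.
apply: contrapT => gx; apply/Nx/BN; exists k => //= /(_ (PO Px)) h; apply: gx.
by apply: h; apply: prodr_gt0 => j _; apply: rho_gt0; rewrite subr_gt0.
Qed.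

End divergence_on_simplex.

(** * Continuity of the normal component *)

Section interface.
Context {R : realType} {d : nat}.
Local Notation L := (lebesgue_rV (R := R) d).
Variables (c : R) (gam w x0 : 'rV[R]_d) (e : R).
Hypotheses (wg : dot w gam = 1) (x0g : c + dot x0 gam = 0) (e0 : 0 < e).

Let lam (x : 'rV[R]_d) := c + dot x gam.
Let mg k : 'rV[R]_d := delta_mx ord0 k - w ord0 k *: gam.
Let mc k : R := - x0 ord0 k - c * w ord0 k.
Let m k (x : 'rV[R]_d) := mc k + dot x (mg k).

Let plateau (a : R) := rho 0 (e + a) * rho 0 (e - a).
Let F2 (x : 'rV[R]_d) := \prod_(k < d) plateau (m k x).
(** A product bump around x0 in the coordinates lam (the affine function that
    cuts out the interface) and m_k, the coordinates of x - x0 - lam(x) w. The m_k are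
    constant along w, so the derivative along w acts on the factor in lam only,
    where its sign is known. *)
Definition interface_bump (x : 'rV[R]_d) : R := plateau (lam x) * F2 x.

Definition interface_box : set 'rV[R]_d :=
  [set x | `|lam x| <= e /\ forall k, `|m k x| <= e].

Let coordE x k : (x - x0) ord0 k = m k x + lam x * w ord0 k.
Proof.
rewrite /m /mc /mg /lam !mxE dotDr dotNr dotZr (dotC x (delta_mx _ _)) dot_delta.
by ring.
Qed.

Let elementary_plateau c' (g' : 'rV[R]_d) :
  elementary (fun x => plateau (c' + dot x g')).
Proof.
apply: elementary_mul; apply: elementary_rho.
  have := elementary_affine (e + c') g'; congr elementary.
  by apply/funext => x; rewrite addrA.
have := elementary_affine (e - c') (- g'); congr elementary.
by apply/funext => x; rewrite dotNr opprD addrA.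
Qed.

Lemma elementary_interface_bump : elementary interface_bump.
Proof.
apply: elementary_mul; first exact: elementary_plateau.
by apply: elementary_prod => k; exact: elementary_plateau.
Qed.

Let plateau0 a : ~ `|a| <= e -> plateau a = 0.
Proof.
rewrite /plateau ler_norml => /negP; rewrite negb_and -!ltNge => /orP[h|h].
  by rewrite (rho_le0 0 (t := e + a)) ?mul0r//; lra.
by rewrite (rho_le0 0 (t := e - a)) ?mulr0//; lra.
Qed.

Lemma interface_bump_supported x : ~ interface_box x -> interface_bump x = 0.
Proof.
move=> /not_andP[|/existsNP[k]] h; first by rewrite /interface_bump plateau0 ?mul0r.
by rewrite /interface_bump /F2 (bigD1 k)//= (plateau0 h) mul0r mulr0.
Qed.

Let closed_affine_le c' (g' : 'rV[R]_d) : closed [set x | `|c' + dot x g'| <= e].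
Proof.
apply: (closed_comp (f := fun x : 'rV[R]_d => `|c' + dot x g'|)) (@closed_le R e) => x _.
apply: cvg_norm; apply: cvgD; first exact: cvg_cst.
exact: continuous_dot.
Qed.

Lemma closed_interface_box : closed interface_box.
Proof.
have -> : interface_box = [set x | `|lam x| <= e] `&`
    \bigcap_(k in [set: 'I_d]) [set x | `|m k x| <= e].
  by apply/seteqP; split=> x /= [h1 h2]; split=> // k; [move=> _|]; apply: h2.
by apply: closedI; [|apply: closed_bigI => k _]; exact: closed_affine_le.
Qed.

Lemma interface_box_near x : interface_box x -> `|x - x0| <= e * (1 + `|w|).
Proof.
move=> [hl hm]; apply: norm_le_coord; first by rewrite mulr_ge0 ?addr_ge0// ltW.
move=> k; rewrite coordE mulrDr mulr1; apply: (le_trans (ler_normD _ _)).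
apply: lerD => //; rewrite normrM; apply: ler_pM => //.
exact: coord_le_norm.
Qed.

Lemma bounded_interface_box : bounded_set interface_box.
Proof.
exists (`|x0| + e * (1 + `|w|)); split; first exact: num_real.
move=> s hs x /interface_box_near xx0; apply: (le_trans _ (ltW hs)).
by rewrite -[x](subrK x0) addrC; apply: (le_trans (ler_normD _ _)); rewrite lerD.
Qed.

Let rho2E t : 0 < t -> rho 2 t = t^-1 ^+ 2 * rho 0 t :> R.
Proof. by move=> t0; rewrite /rho t0 expr0 mul1r. Qed.

(* derivative of plateau *)
Let D a := rho 2 (e + a) * rho 0 (e - a) - rho 0 (e + a) * rho 2 (e - a).

Let D_lt0 a : 0 < a -> a < e -> D a < 0.
Proof.
move=> a0 ae; have h1 : 0 < e + a by lra.
have h2 : 0 < e - a by lra.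
rewrite /D !rho2E// (_ : _ - _ =
  rho 0 (e + a) * rho 0 (e - a) * ((e + a)^-1 ^+ 2 - (e - a)^-1 ^+ 2)); last by ring.
rewrite pmulr_rlt0; last by rewrite mulr_gt0// rho_gt0.
rewrite subr_lt0 ltr_pXn2r// ?nnegrE ?invr_ge0 ?ltW//.
by rewrite ltf_pV2 ?posrE//; lra.
Qed.

Let D_le0 a : 0 <= a -> D a <= 0.
Proof.
rewrite le_eqVlt => /predU1P[<-|a0].
  by rewrite /D addr0 subr0 mulrC subrr.
have [ae|ae] := ltP a e; first exact/ltW/D_lt0.
by rewrite /D !(rho_le0 _ (t := e - a)) ?mulr0 ?subrr//; lra.
Qed.

Let F2_ge0 x : 0 <= F2 x.
Proof. by apply: prodr_ge0 => k _; rewrite mulr_ge0// rho_ge0. Qed.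

Let dwm k : dot w (mg k) = 0.
Proof.
by rewrite /mg dotDr dotNr dotZr wg mulr1 dotC dot_delta subrr.
Qed.

Let derive_F2 x : 'D_w F2 x = 0.
Proof.
rewrite /derive (_ : (fun h : R => _) = cst 0); first exact: lim_cst.
apply/funext => h /=; have -> : F2 (h *: w + x) = F2 x.
  by apply: eq_bigr => k _; rewrite /m dotDl dotZl dwm mulr0 add0r.
by rewrite subrr scaler0.
Qed.

Let derive_bump x : 'D_w interface_bump x = D (lam x) * F2 x.
Proof.
have ea s : elementary (fun y => e + s * lam y).
  have := elementary_affine (e + s * c) (s *: gam); congr elementary.
  by apply/funext => y; rewrite dotZr /lam mulrDr addrA.
have da s y : 'D_w (fun y => e + s * lam y) y = s.
  have -> : (fun y => e + s * lam y) = (fun y => (e + s * c) + dot y (s *: gam)).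
    by apply/funext => z; rewrite dotZr /lam mulrDr addrA.
  rewrite deriveD ?derive_cst ?add0r ?derive_dot ?dotZr ?wg ?mulr1//.
  by apply: diff_derivable; exact: differentiable_dot.
have [e1 d1] := derive_rho_comp 0 w (elementary_differentiable x (ea 1)).
have [e2 d2] := derive_rho_comp 0 w (elementary_differentiable x (ea (-1))).
have -> : interface_bump = (fun y => rho 0 (e + 1 * lam y)) *
    (fun y => rho 0 (e + -1 * lam y)) * F2.
  by apply/funext => y; rewrite !mulrfctE mul1r mulN1r.
have eF2 : elementary F2 by apply: elementary_prod => k; exact: elementary_plateau.
rewrite deriveM; [|by apply: diff_derivable; exact: differentiableM|
  by apply: diff_derivable; exact: elementary_differentiable].
rewrite derive_F2 scaler0 add0r deriveM; [|exact: diff_derivable|exact: diff_derivable].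
rewrite d1 d2 !da /GRing.scale /= (_ : e + 1 * lam x = e + lam x); last by rewrite mul1r.
rewrite (_ : e + -1 * lam x = e - lam x); last by rewrite mulN1r.
by rewrite /D; ring.
Qed.

(** On the positive side of the interface the bump decreases along w, strictly
    inside its support, so the integral is negative. *)
Lemma interface_bump_not_zero_integral :
  ~ zero_integral (fun x => (0 <= lam x)%R%:R * 'D_w interface_bump x).
Proof.
move=> [ki k0]; pose k x : R := (0 <= lam x)%R%:R * 'D_w interface_bump x.
have kle0 x : k x <= 0.
  rewrite /k derive_bump; have [h|h] := boolP (0 <= lam x); rewrite ?mul1r ?mul0r//.
  by apply: mulr_le0_ge0; [exact: D_le0|exact: F2_ge0].
pose U : set 'rV[R]_d := [set x | 0 < lam x < e /\ forall k, `|m k x| < e].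
have klt0 x : U x -> k x != 0.
  move=> [/andP[l0 le] hm]; rewrite /k (ltW l0) mul1r derive_bump.
  apply: mulf_neq0; first by rewrite lt_eqF// D_lt0.
  rewrite gt_eqF//.
  apply: prodr_gt0 => j _; have := hm j; rewrite ltr_norml => /andP[h1 h2].
  by rewrite mulr_gt0// rho_gt0//; lra.
have cl c' (g' : 'rV[R]_d) : continuous (fun x : 'rV[R]_d => c' + dot x g').
  by move=> x; apply: cvgD; [exact: cvg_cst|exact: continuous_dot].
have oU : open U.
  rewrite openE => x [/andP[l0 le] hm].
  have n1 : \forall y \near x, 0 < lam y by exact: (cvgr_gt _ (cl _ _ x) _ l0).
  have n2 : \forall y \near x, lam y < e by exact: (cvgr_lt _ (cl _ _ x) _ le).
  have n3 : \forall y \near x, forall j, `|m j y| < e.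
    apply: (@filter_forall _ 'I_d (fun j y => `|m j y| < e) (nbhs x)) => j.
    by apply: (cvgr_lt `|m j x|) (hm j); apply: cvg_norm; exact: cl.
  near=> y; split; last by near: y.
  by apply/andP; split; near: y.
have U0 : U !=set0.
  exists (x0 + (e / 2) *: w).
  have lx : lam (x0 + (e / 2) *: w) = e / 2.
    by rewrite /lam dotDl dotZl wg mulr1 addrA x0g add0r.
  split; first by rewrite lx divr_gt0// ltr_pdivrMr// ltr_pMr// ltr1n.
  move=> j; have := coordE (x0 + (e / 2) *: w) j.
  rewrite lx addrC addKr !mxE -[LHS]add0r => /addIr <-.
  by rewrite normr0.
have mU := open_measurable_rV oU.
have mk : measurable_fun setT (EFin \o k) by case/integrableP: ki.
have : (\int[L]_x `|(EFin \o k) x| = 0)%E.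
  rewrite -[LHS]oppeK -integral_ge0N; last by move=> x _; exact: abse_ge0.
  rewrite (_ : \int[L]_x _ = 0)%E ?oppe0// -[RHS]k0.
  by apply: eq_integral => x _ /=; rewrite ler0_norm// opprK.
move=> /(ae_eq_integral_abs L measurableT mk)[N [mN N0 kN]].
have : (L U <= L N)%E.
  apply: le_measure; rewrite ?inE// => x Ux; apply: kN => /= /(_ I) [] h.
  by have := klt0 x Ux; rewrite h eqxx.
by rewrite N0 leNgt lebesgue_rV_open.
Unshelve. all: by end_near.
Qed.

End interface.

Section normal_trace.
Context {R : realType} {d : nat}.
Local Notation L := (lebesgue_rV (R := R) d).

(** The coefficient a is the value at the centre, so recentring at a point of
    the interface exposes the trace there. *)
Lemma affine_field_recenter (a x0 x1 x : 'rV[R]_d) b :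
  affine_field a b x1 x = affine_field (affine_field a b x1 x0) b x0 x.
Proof.
by rewrite /affine_field -addrA -scalerDr; congr (_ + _ *: _); rewrite [RHS]addrC addrA subrK.
Qed.

(** Near x0 the field y is one affine field where c + x . gam > 0 and another
    where it is < 0, with divergences b1 d and b2 d by [divergence_on_simplex].
    Test the weak divergence with the interface bump f. Subtract
    [zero_integral_affine_field] for the second field on the whole space and
    [zero_integral_half_affine_field] for the difference of the two on the
    half-space: all that remains is the jump of the normal component times the
    half-space integral of the derivative of f along w, which is not 0. *)
Lemma normal_trace_continuous (Omega : set 'rV[R]_d) (P Q : 'M[R]_(d.+1, d)) i x0 r
    (y : 'rV[R]_d -> 'rV[R]_d) g (a1 x1 a2 x2 : 'rV[R]_d) (b1 b2 : R) :
  (0 < d)%N -> open Omega -> bounded_set Omega ->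
  affinely_independent P -> affinely_independent Q ->
  (simplex P)° `<=` Omega -> (simplex Q)° `<=` Omega -> weak_div Omega y g ->
  (forall x, (simplex P)° x -> y x = affine_field a1 b1 x1 x) ->
  (forall x, (simplex Q)° x -> y x = affine_field a2 b2 x2 x) ->
  bary P x0 ord0 i = 0 -> 0 < r -> (forall x, `|x - x0| <= r -> Omega x) ->
  (forall x, `|x - x0| <= r -> 0 < bary P x ord0 i -> (simplex P)° x) ->
  (forall x, `|x - x0| <= r -> bary P x ord0 i < 0 -> (simplex Q)° x) ->
  dot (affine_field a1 b1 x1 x0) (bgrad P i) =
  dot (affine_field a2 b2 x2 x0) (bgrad P i).
Proof.
move=> d0 oO bO Pf Qf PO QO yg yP yQ x0i r0 rO rP rQ.
have mO := open_measurable_rV oO.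
pose gam := bgrad P i; have gam0 : gam != 0 by exact: bgrad_neq0.
pose w := (dot gam gam)^-1 *: gam.
have wg : dot w gam = 1 by rewrite dotZl mulVf// gt_eqF// dot_gt0.
pose c := invmx (augmented P) (lshift d ord0) i.
have lamE x : bary P x ord0 i = c + dot x gam by exact: bary_affine.
have x0g : c + dot x0 gam = 0 by rewrite -lamE.
(* the support of the bump of size e lies in the ball of radius r *)
pose e := r / (1 + `|w|).
have w1 : 0 < 1 + `|w| by rewrite ltr_pwDl.
have e0 : 0 < e by exact: divr_gt0.
pose f := interface_bump c gam w x0 e; pose F := interface_box c gam w x0 e.
have ef : elementary f by exact: elementary_interface_bump.
have f0 : forall x, ~ F x -> f x = 0 by exact: interface_bump_supported.
have cF : closed F by exact: closed_interface_box.
have bF : bounded_set F by exact: bounded_interface_box.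
have Fr x : F x -> `|x - x0| <= r.
  by move=> /(interface_box_near e0); rewrite /e divfK// gt_eqF.
have FO : F `<=` Omega by move=> x /Fr; exact: rO.
have [s s0 fs] := bounded_supported bF f0.
have [N1 [mN1 N10 gP]] := divergence_on_simplex oO bO Pf PO yg yP.
have [N2 [mN2 N20 gQ]] := divergence_on_simplex oO bO Qf QO yg yQ.
pose z1 := affine_field a1 b1 x1 x0; pose z2 := affine_field a2 b2 x2 x0.
pose N0 := [set x | dot x gam = - c].
have mN0 : measurable N0 by exact: measurable_hyperplane.
have N00 : L N0 = 0%E by exact: null_hyperplane.
pose N := N0 `|` N1 `|` N2.
have mN : measurable N by apply: measurableU => //; exact: measurableU.
have LN : L N = 0%E by rewrite !null_set_setU//; exact: measurableU.
pose H x := 0 <= c + dot x gam.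
pose Y x := if H x then affine_field z1 b1 x0 x else affine_field z2 b2 x0 x.
pose G x : R := if H x then b1 * d%:R else b2 * d%:R.
have sides x : F x -> ~ N x -> y x = Y x /\ g x = G x.
  move=> Fx Nx; rewrite /Y /G /H.
  have [lx|lx|lx] := ltrgtP 0 (c + dot x gam).
  - have Px : (simplex P)° x by apply: rP; [exact: Fr|rewrite lamE].
    rewrite yP// -affine_field_recenter; split=> //; apply: gP => // N1x.
    by apply: Nx; left; right.
  - have Qx : (simplex Q)° x by apply: rQ; [exact: Fr|rewrite lamE].
    rewrite yQ// -affine_field_recenter; split=> //; apply: gQ => // N2x.
    by apply: Nx; right.
  - by exfalso; apply: Nx; left; left; rewrite /N0 /=; lra.
have W := weak_div_test yg ef cF bF FO f0 mN LN (fun x Fx Nx => (sides x Fx Nx).1).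
have WG : \int[L]_(x in Omega) (g x * f x) = \int[L]_x (G x * f x).
  rewrite Rintegral_mkcond; apply: (Rintegral_congr_null mN LN) => x _ Nx.
  rewrite patchE; have [Fx|Fx] := pselect (F x).
    by rewrite mem_set ?(sides x Fx Nx).2//; exact: FO.
  by rewrite f0// !mulr0; case: ifP.
have [df dfe] := elementary_derive ef.
have Z2 := zero_integral_affine_field z2 b2 x0 ef s0 fs.
have Z12 := zero_integral_half_affine_field (z1 - z2) (b1 - b2) ef s0 fs wg x0g.
(* the jump of the normal component *)
pose kap := dot (z1 - z2) gam.
have split_ x : dot (Y x) (grad f x) + G x * f x - kap * ((H x)%:R * 'D_w f x) =
   (dot (affine_field z2 b2 x0 x) (grad f x) + b2 * d%:R * f x) +
   (0 <= c + dot x gam)%R%:R * (dot (affine_field (z1 - z2) (b1 - b2) x0 x) (grad f x) +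
     (b1 - b2) * d%:R * f x - dot (z1 - z2) gam * 'D_w f x).
  rewrite /Y /G /H -/kap; case: (0 <= c + dot x gam); rewrite ?mul1r ?mul0r ?mulr0 ?subr0 ?addr0//.
  by rewrite /affine_field !(dotDl, dotZl, dotNl); ring.
have [ZZi ZZ0] := eq_zero_integral (fun x => esym (split_ x)) (zero_integralD Z2 Z12).
have mH : measurable_fun setT (fun x => (H x)%:R : R).
  have mHs : measurable [set x | H x].
    rewrite (_ : [set x | H x] = (fun x => dot x gam) @^-1` `[- c, +oo[%classic).
      by rewrite -[X in measurable X]setTI; apply: measurable_dot => //; exact: measurable_itv.
    by apply/seteqP; split=> x /=; rewrite /H in_itv /= andbT => h; lra.
  rewrite (_ : (fun x => _) = \1_[set x | H x]); first exact: measurable_indic.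
  by apply/funext => x; rewrite indicE; congr (nat_of_bool _)%:R; apply/idP/idP; rewrite inE.
have mel h : elementary h -> measurable_fun setT h.
  by move=> eh; apply: continuous_measurable_rV; exact: elementary_continuous.
have k1i : L.-integrable setT (EFin \o (fun x => (H x)%:R * 'D_w f x)).
  have Df0 := derive_supported w fs.
  have bs : bounded_set (@cube R d s).
    exists s; split; first exact: num_real.
    by move=> t st x /(cubeP _ s0) xs; exact: le_trans xs (ltW st).
  have [M M0 DM] := elementary_bounded (dfe w) bs Df0.
  apply: (@integrable_supported _ _ _ s M) => //.
  - by apply: measurable_funM => //; exact: mel.
  - by move=> x xs; rewrite Df0// mulr0.
  - by move=> x; case: (H x); rewrite ?mul1r// mul0r normr0.
have Gf0 x : ~ F x -> G x * f x = 0 by move=> /f0 ->; rewrite mulr0.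
have k2i : L.-integrable setT (EFin \o (fun x => G x * f x)).
  have [M M0 fM] := elementary_bounded ef bF f0.
  apply: (@integrable_supported _ _ _ s ((`|b1 * d%:R| + `|b2 * d%:R|) * M)) => //.
  - apply: measurable_funM; last exact: mel.
    rewrite (_ : G = (fun x => b2 * d%:R + (b1 - b2) * d%:R * (H x)%:R)).
      by apply: measurable_funD; [exact: measurable_cst|
        apply: measurable_funM => //; exact: measurable_cst].
    by apply/funext => x; rewrite /G; case: (H x); rewrite /= ?mulr1 ?mulr0; ring.
  - by move=> x xs; rewrite fs// mulr0.
  - move=> x; rewrite normrM; apply: ler_pM => //.
    by rewrite /G; case: (H x); rewrite ?lerDl ?lerDr.
have kk1i := integrableZl measurableT kap k1i.
have dYE x : dot (Y x) (grad f x) =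
    dot (Y x) (grad f x) + G x * f x - kap * ((H x)%:R * 'D_w f x) +
    kap * ((H x)%:R * 'D_w f x) - G x * f x by ring.
have key : kap * \int[L]_x ((H x)%:R * 'D_w f x) = 0.
  move: W; rewrite WG; under eq_Rintegral do rewrite dYE.
  rewrite RintegralB//; last exact: (integrableD measurableT ZZi kk1i).
  rewrite RintegralD// RintegralZl//.
  rewrite (_ : \int[L]_x (_ - _) = 0); last by rewrite /Rintegral ZZ0.
  by rewrite add0r => h; lra.
have : kap = 0.
  move/eqP: key; rewrite mulf_eq0 => /orP[/eqP//|/eqP k10]; exfalso.
  apply: (interface_bump_not_zero_integral wg x0g e0); split; first exact: k1i.
  by rewrite -[LHS]fineK ?integrable_fin_num//; congr EFin.
by rewrite /kap dotBl => /eqP; rewrite subr_eq0 => /eqP.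
Qed.

End normal_trace.

(** * Traces of piecewise affine functions *)

Section traces.
Context {R : realType} {d : nat} {E : finType}.
Implicit Types (Th : E -> 'M[R]_(d.+1, d)).

Lemma within_interior_proper (P : 'M[R]_(d.+1, d)) x : affinely_independent P ->
  simplex P x -> ProperFilter (within (simplex P)° (nbhs x)).
Proof.
by move=> Pf Px; apply: within_nbhs_proper; exact: simplex_closure_interior.
Qed.

Lemma trace_eq (V : normedModType R) Th (w p : 'rV[R]_d -> V) e x :
  affinely_independent (Th e) -> simplex (Th e) x ->
  (forall y, (simplex (Th e))° y -> w y = p y) -> p @ x --> p x ->
  trace Th w e x = p x.
Proof.
move=> Pf Px wp px; have PF := within_interior_proper Pf Px.
apply: cvg_lim; first exact: norm_hausdorff.
have : p y @[y --> within (simplex (Th e))° (nbhs x)] --> p x.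
  exact: cvg_within_filter.
apply: cvg_trans; apply: near_eq_cvg; rewrite near_withinE.
by apply: nearW => y Py; rewrite wp.
Qed.

Lemma trace_affine Th (v : 'rV[R]_d -> R) e x c g :
  affinely_independent (Th e) -> simplex (Th e) x ->
  (forall y, (simplex (Th e))° y -> v y = c + dot y g) ->
  trace Th v e x = c + dot x g.
Proof.
move=> Pf Px vE; apply: (@trace_eq R^o Th v (fun x => c + dot x g)) => //.
by apply: cvgD; [exact: cvg_cst|exact: continuous_dot].
Qed.

Lemma trace_affine_field Th (y : 'rV[R]_d -> 'rV[R]_d) e x a b x0 :
  affinely_independent (Th e) -> simplex (Th e) x ->
  (forall z, (simplex (Th e))° z -> y z = affine_field a b x0 z) ->
  trace Th y e x = affine_field a b x0 x.
Proof.
move=> Pf Px yE; apply: (@trace_eq 'rV[R]_d Th y (affine_field a b x0)) => //.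
apply: cvgD; first exact: cvg_cst.
apply: cvgZ; first exact: cvg_cst.
by apply: cvgB; [exact: cvg_id|exact: cvg_cst].
Qed.

Definition is_affine (p : 'rV[R]_d -> R) := exists c g, forall x, p x = c + dot x g.

Lemma is_affine_cst c : is_affine (cst c).
Proof. by exists c, 0 => x; rewrite dot0r addr0. Qed.

Lemma is_affineD p q : is_affine p -> is_affine q -> is_affine (fun x => p x + q x).
Proof.
move=> [c [g pE]] [c' [g' qE]]; exists (c + c'), (g + g') => x.
by rewrite pE qE dotDr addrACA.
Qed.

Lemma is_affineZ a p : is_affine p -> is_affine (fun x => a * p x).
Proof.
by move=> [c [g pE]]; exists (a * c), (a *: g) => x; rewrite pE dotZr mulrDr.
Qed.

Lemma is_affine_sum (I : Type) (r : seq I) (Q : pred I) (F : I -> 'rV[R]_d -> R) :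
  (forall i, Q i -> is_affine (F i)) -> is_affine (fun x => \sum_(i <- r | Q i) F i x).
Proof.
move=> FA; elim: r => [|i r IH].
  under eq_fun do rewrite big_nil.
  exact: is_affine_cst.
under eq_fun do rewrite big_cons.
case Qi : (Q i) => //.
by apply: is_affineD; [exact: FA|exact: IH].
Qed.

Lemma poly_degree_le1 (p : 'rV[R]_d -> R) : poly_degree_le 1 p -> is_affine p.
Proof.
move=> [c pE]; have -> : p = fun x => \sum_(m : {ffun 'I_d -> 'I_2} | (\sum_i m i <= 1)%N)
   c m * \prod_i x ord0 i ^+ m i by apply/funext.
apply: is_affine_sum => m m1; apply: is_affineZ.
have [[i mi]|m0] := pselect (exists i, (0 < m i)%N); last first.
  have -> : (fun x : 'rV[R]_d => \prod_i x ord0 i ^+ m i) = cst 1.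
    apply/funext => x; apply: big1 => i _; have [->//|] := posnP (m i).
    by move=> mi; exfalso; apply: m0; exists i.
  exact: is_affine_cst.
exists 0, (delta_mx ord0 i) => x; rewrite add0r dotC dot_delta.
have mj : forall j, j != i -> m j = 0%N :> nat.
  move=> j ji; apply/eqP; rewrite -leqn0 -(leq_add2l (m i)) addn0.
  apply: (@leq_trans 1) => //; apply: leq_trans m1.
  by rewrite (bigD1 i)//= (bigD1 j)//= addnA leq_addr.
rewrite (bigD1 i)//= big1 ?mulr1 => [|j ji]; last by rewrite mj.
have -> : m i = 1%N :> nat by apply/eqP; rewrite eqn_leq mi andbT -ltnS.
by rewrite expr1.
Qed.

Lemma elementwise_at (V : lmodType R) Th (f : E -> 'rV[R]_d -> V) e x :
  (forall e', e' != e -> ~ (simplex (Th e'))° x) ->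
  (simplex (Th e))° x -> elementwise Th f x = f e x.
Proof.
move=> dis Px; rewrite /elementwise (bigD1 e)//= big1 ?addr0.
  by rewrite indicE mem_set// scale1r.
by move=> e' e'e; rewrite indicE memNset ?scale0r//; exact: dis.
Qed.

End traces.

(** * Faces determine their vertices *)

Section faces.
Context {R : realType} {d : nat}.
Implicit Types (P Q : 'M[R]_(d.+1, d)) (I J : {set 'I_d.+1}).

Lemma bary_le1 P x j : affinely_independent P -> simplex P x -> bary P x ord0 j <= 1.
Proof.
move=> Pf /(simplex_bary Pf) x0; rewrite -(sum_bary Pf x) (bigD1 j)//= lerDl.
exact: sumr_ge0.
Qed.

Lemma face_simplex P I x : affinely_independent P -> face P I x -> simplex P x.
Proof. by move=> Pf /(face_bary Pf)[x0 _]; exact/(simplex_bary Pf). Qed.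

Lemma vertex_face P (I : {set 'I_d.+1}) j : affinely_independent P -> j \in I -> face P I (row j P).
Proof.
move=> Pf jI; apply/(face_bary Pf); split=> [k|k kI]; rewrite bary_vertex//.
by case: eqP => // jk; rewrite jk in jI; rewrite jI in kI.
Qed.

Lemma bary_eq1 P x j : affinely_independent P -> simplex P x ->
  bary P x ord0 j = 1 -> x = row j P.
Proof.
move=> Pf /(simplex_bary Pf) x0 x1; apply: (bary_inj Pf); apply/rowP => k.
rewrite bary_vertex//; case: eqP => [<-//|/eqP jk].
have : \sum_(l | l != j) bary P x ord0 l = 0.
  by have := sum_bary Pf x; rewrite (bigD1 j)//= x1 => h; lra.
move/psumr_eq0P => h; apply: h => //; by rewrite eq_sym.
Qed.

(** The j-th barycentric coordinate of P is at most 1 on the face, with value 1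
    only at the j-th vertex. That vertex is a convex combination of vertices of Q
    that lie in the face; a vertex that enters with a positive weight must
    therefore have j-th coordinate 1. *)
Lemma face_vertices P Q (I J : {set 'I_d.+1}) j : affinely_independent P -> affinely_independent Q ->
  face P I = face Q J -> j \in I -> exists2 k, k \in J & row j P = row k Q.
Proof.
move=> Pf Qf PQ jI.
have pF : face Q J (row j P) by rewrite -PQ; exact: vertex_face.
have [p0 pJ] := (face_bary Qf J _).1 pF.
pose mu k := bary Q (row j P) ord0 k.
have qP k : k \in J -> simplex P (row k Q).
  by move=> kJ; apply: (@face_simplex _ I) => //; rewrite PQ; exact: vertex_face.
have S1 : \sum_k mu k * bary P (row k Q) ord0 j = 1.
  transitivity (bary P (row j P) ord0 j); last by rewrite bary_vertex// eqxx.
  have Ex x : bary P x ord0 j = invmx (augmented P) (lshift d ord0) j + dot x (bgrad P j).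
    exact: bary_affine.
  rewrite Ex [RHS](affine_bary Qf); apply: eq_bigr => k _.
  by rewrite -Ex.
have [k muk] : exists k, 0 < mu k.
  apply: contrapT => /forallNP h; have : \sum_k mu k = 0.
    apply: big1 => k _; apply/eqP; rewrite eq_le p0 andbT leNgt.
    exact/negP/h.
  by rewrite sum_bary// => /eqP; rewrite oner_eq0.
have kJ : k \in J.
  by apply: contraT => /pJ; rewrite -/(mu k) => mk0; rewrite mk0 ltxx in muk.
exists k => //; apply/esym/bary_eq1 => //; first exact: qP.
have S2 : \sum_l mu l * (1 - bary P (row l Q) ord0 j) = 0.
  by under eq_bigr do rewrite mulrBr mulr1; rewrite sumrB S1 sum_bary// subrr.
have : mu k * (1 - bary P (row k Q) ord0 j) = 0.
  move/psumr_eq0P: S2; apply=> // l _.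
  have [lJ|/pJ ml] := boolP (l \in J); last by rewrite /mu ml mul0r.
  by rewrite mulr_ge0 ?p0// subr_ge0 bary_le1//; exact: qP.
by move=> /eqP; rewrite mulf_eq0 gt_eqF//= subr_eq0 => /eqP.
Qed.

Lemma row_injective P j k : affinely_independent P -> row j P = row k P -> j = k.
Proof.
move=> Pf jk; have := bary_vertex Pf j k; rewrite jk bary_vertex// eqxx.
by case: eqP => // _ /eqP; rewrite oner_eq0.
Qed.

Lemma face_card P Q I J : affinely_independent P -> affinely_independent Q ->
  face P I = face Q J -> (#|I| <= #|J|)%N.
Proof.
move=> Pf Qf PQ.
pose f j := if pselect (j \in I) is left jI then
  s2val (cid2 (face_vertices Pf Qf PQ jI)) else j.
have fP j : j \in I -> f j \in J /\ row j P = row (f j) Q.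
  by move=> jI; rewrite /f; case: pselect => // jI'; case: cid2.
have fI : {in I &, injective f}.
  move=> j k jI kI fjk; apply: (row_injective Pf).
  by rewrite (fP j jI).2 (fP k kI).2 fjk.
rewrite -(card_in_imset fI); apply: subset_leq_card.
by apply/fintype.subsetP => _ /imsetP[j jI ->]; exact: (fP j jI).1.
Qed.

(** The matching of the common vertices is injective, so it extends to a
    permutation by sending i to the vertex of Q that is opposite to the common
    side. Adjacent elements can thus be assumed to list common vertices in the
    same order. *)
Lemma face_match P Q i J : affinely_independent P -> affinely_independent Q ->
  face P [set~ i]%SET = face Q J -> exists s : {perm 'I_d.+1},
    J = [set~ s i]%SET /\ forall j, j != i -> row (s j) Q = row j P.
Proof.
move=> Pf Qf PQ.
have cI : #|[set~ i]%SET| = d by rewrite cardsC1 card_ord.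
have cJ : #|J| = d.
  have := face_card Qf Pf (esym PQ); have := face_card Pf Qf PQ.
  by rewrite cI => h1 h2; apply/eqP; rewrite eqn_leq h1 h2.
have [i' JE] : exists i', J = [set~ i']%SET.
  have : #|~: J|%SET = 1%N.
    by apply/eqP; rewrite -(eqn_add2l #|J|) cardsC card_ord cJ addn1.
  by move=> /eqP/cards1P[i' Ji']; exists i'; rewrite -Ji' finset.setCK.
pose f j := if pselect (j \in [set~ i]%SET) is left jI then
  s2val (cid2 (face_vertices Pf Qf PQ jI)) else i'.
have fP j : j != i -> f j \in J /\ row j P = row (f j) Q.
  move=> ji; have jI : j \in [set~ i]%SET by rewrite !finset.inE.
  by rewrite /f; case: pselect => // jI'; case: cid2.
have fi : f i = i'.
  by rewrite /f; case: pselect => // iI; exfalso; move: iI; rewrite !finset.inE eqxx.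
have fne j : j != i -> f j != i'.
  by move=> /fP[]; rewrite JE !finset.inE.
have f_inj : injective f.
  move=> j k fjk; have [ji|ji] := eqVneq j i; have [ki|ki] := eqVneq k i.
  - by rewrite ji ki.
  - by move: (fne k ki); rewrite -fjk ji fi eqxx.
  - by move: (fne j ji); rewrite fjk ki fi eqxx.
  - by apply: (row_injective Pf); rewrite (fP j ji).2 (fP k ki).2 fjk.
exists (perm f_inj); split; first by rewrite permE fi.
by move=> j ji; rewrite permE; have [_ ->] := fP j ji.
Qed.

End faces.

(** * Sides of a regular triangulation *)

Section common_side.
Context {R : realType} {d : nat}.
Variables (P Q : 'M[R]_(d.+1, d)) (i : 'I_d.+1).
Hypotheses (Pf : affinely_independent P) (Qf : affinely_independent Q).
Hypothesis PQ : forall j, j != i -> row j P = row j Q.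
Let delta := bary P (row i Q) ord0 i.

Definition side_interior (P : 'M[R]_(d.+1, d)) i y :=
  bary P y ord0 i = 0 /\ forall j, j != i -> 0 < bary P y ord0 j.

Lemma bary_common_side y : bary P y ord0 i = 0 -> bary Q y = bary P y.
Proof.
move=> y0; have E : y = bary P y *m Q.
  rewrite -{1}(bary_mulmx Pf y) !mulmx_sum_row; apply: eq_bigr => j _.
  have [->|ji] := eqVneq j i; first by rewrite y0 !scale0r.
  by rewrite PQ.
by rewrite {1}E bary_unique// sum_bary.
Qed.

(** Near an interior point of the common side all other coordinates stay
    positive, so the sign of the i-th one decides. *)
Lemma near_common_side y : side_interior P i y -> \forall z \near y,
  (0 < bary P z ord0 i * delta -> (simplex Q)° z) /\
  (0 <= bary P z ord0 i * delta -> simplex Q z).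
Proof.
move=> [y0 yp]; have d0 : 0 < delta ^+ 2.
  by rewrite exprn_even_gt0//= (delta_neq0 Pf Qf PQ).
have : \forall z \near y, forall j, j != i -> 0 < bary Q z ord0 j.
  apply: (@filter_forall _ 'I_d.+1 (fun j z => j != i -> 0 < bary Q z ord0 j) (nbhs y)) => j.
  have [->|ji] := eqVneq j i; first by apply: nearW.
  have h : 0 < bary Q y ord0 j by rewrite bary_common_side// yp.
  by apply: filterS (cvgr_gt _ (@continuous_bary _ _ Q j y) _ h) => z + _.
apply: filterS => z zp; rewrite (bary_adjacent Pf Qf PQ) -/delta -mulrA -expr2.
split.
  rewrite (pmulr_lgt0 _ d0) => zi; apply/(interior_simplex Qf) => j.
  by have [->|/zp] := eqVneq j i.
rewrite (pmulr_lge0 _ d0) => zi; apply/(simplex_bary Qf) => j.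
by have [->|/zp/ltW] := eqVneq j i.
Qed.

End common_side.

Section domain_geometry.
Context {R : realType} {d : nat}.
Variable Omega : set 'rV[R]_d.
Hypothesis Omega_domain : polyhedral_lipschitz_domain Omega.

(** Near a boundary point the domain is a strict epigraph, so the points slightly
    below the boundary point along the direction u have neighbourhoods free of the
    domain, and they are not in its closure. This excludes slits: a side whose
    neighbourhood is covered by elements is in the domain. *)
Lemma interior_closure_domain : (closure Omega)° `<=` Omega.
Proof.
move=> x xi; have cx : closure Omega x by exact: interior_subset.
apply: contrapT => Ox.
have bx : boundary Omega x.
  by split=> // /interior_subset.
have [_ _ _ /(_ x bx)[r [u [gam [r0 uu [k gk] gO]]]]] := Omega_domain.
have c1 : x - t *: u @[t --> (0 : R)^'+] --> x.
  rewrite -[X in _ --> X]subr0 -(scale0r u).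
  apply: cvg_at_right_filter; apply: cvgB; first exact: cvg_cst.
  by apply: cvgZr_tmp; exact: cvg_id.
have gc : continuous gam.
  move=> y; apply/cvgrPdist_lt => e e0; near=> z.
  have kk : 0 < `|k| + 1 by rewrite ltr_wpDl.
  apply: (@le_lt_trans _ _ ((`|k| + 1) * `|y - z|)).
    apply: (le_trans (gk (y, z) _)) => //=; apply: ler_wpM2r => //.
    by rewrite (le_trans (ler_norm _))// lerDl.
  rewrite mulrC -ltr_pdivlMr//; near: z.
  have : id @ y --> y by exact: cvg_id.
  by move=> /cvgrPdist_lt; apply; rewrite divr_gt0// ltr_wpDl.
(* Omega is the set where h < 0, and h grows along - u *)
pose h z := gam (z - dot z u *: u) - dot z u.
have hE t : h (x - t *: u) = h x + t.
  rewrite /h dotBl dotZl uu mulr1.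
  have -> : x - t *: u - (dot x u - t) *: u = x - dot x u *: u.
    by rewrite scalerBl opprB addrA addrNK.
  by rewrite opprB addrCA addrC.
have hc : continuous h.
  move=> z; apply: cvgB; last exact: continuous_dot.
  apply: (cvg_comp (fun z => z - dot z u *: u) gam); last exact: gc.
  apply: cvgB; first exact: cvg_id.
  by apply: cvgZr_tmp; exact: continuous_dot.
have hx : 0 <= h x.
  rewrite leNgt; apply/negP => hx; apply: Ox; apply/gO; first exact: ballxx.
  by move: hx; rewrite /h subr_lt0.
have [t [t0 [xt cxt]]] : exists t : R, 0 < t /\ ball x r (x - t *: u) /\ closure Omega (x - t *: u).
  have n1 : \forall t \near (0 : R)^'+, ball x r (x - t *: u).
    by apply: (c1 (ball x r)); exact: nbhsx_ballx.
  have n2 : \forall t \near (0 : R)^'+, closure Omega (x - t *: u) by exact: (c1 _ xi).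
  near (0 : R)^'+ => t; exists t; split; first by near: t; exact: nbhs_right_gt.
  by split; near: t.
have := cxt (ball x r `&` [set z | 0 < h z]).
case.
  apply: filterI; first by apply: open_nbhs_nbhs; split=> //; exact: ball_open.
  by apply: (cvgr_gt _ (hc _)); rewrite hE ltr_wpDl.
move=> z [Oz [bz hz]]; have /gO := bz; move=> /iffLR/(_ Oz).
by rewrite -subr_lt0 -/(h z) ltNge ltW.
Unshelve. all: by end_near.
Qed.

End domain_geometry.

Section mesh_sides.
Context {R : realType} {d : nat} {E : finType}.
Variables (Omega : set 'rV[R]_d) (Th : E -> 'M[R]_(d.+1, d)).
Hypotheses (d0 : (0 < d)%N) (Omega_domain : polyhedral_lipschitz_domain Omega).
Hypothesis Th_regular : regular_triangulation Omega Th.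

Let oO : open Omega. Proof. by case: Omega_domain => -[]. Qed.
Let Tf e : affinely_independent (Th e). Proof. by case: Th_regular. Qed.
Arguments Tf : clear implicits.
Let cOE : closure Omega = \bigcup_e simplex (Th e). Proof. by case: Th_regular. Qed.

Lemma simplex_closure e : simplex (Th e) `<=` closure Omega.
Proof. by move=> x xe; rewrite cOE; exists e. Qed.

Lemma element_interior_domain e : (simplex (Th e))° `<=` Omega.
Proof.
move=> x xe; apply: (interior_closure_domain Omega_domain).
by apply: filterS xe; exact: simplex_closure.
Qed.

(** The intersection of the two elements is a common face. As it contains an
    interior point of Th e, it is Th e itself; as a proper face of Th e' has no
    interior points, it is Th e' as well. *)
Lemma interior_subset_simplex e e' x : (simplex (Th e))° x ->
  simplex (Th e') x -> e = e'.
Proof.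
move=> xe xe'; have [_ _ Tinj /(_ e e')[I [J [IE IJ]]]] := Th_regular.
have IT : I = [set: 'I_d.+1]%SET.
  apply/setP => j; rewrite finset.inE; apply: contraT => jI.
  have : face (Th e) I x by rewrite -IE; split=> //; exact: interior_subset.
  move/(face_bary (Tf e)) => [_ /(_ j jI) xj].
  by have := (interior_simplex (Tf e) x).1 xe j; rewrite xj ltxx.
have TJ : simplex (Th e) = face (Th e') J by rewrite -IJ IT.
have [JT|/eqP JT] := eqVneq J [set: 'I_d.+1]%SET.
  by apply: Tinj; rewrite TJ JT.
have [j jJ] : exists j, j \notin J.
  apply: contrapT => /forallNP h; apply: JT; apply/setP => j.
  by rewrite finset.inE; apply/negPn/negP; exact: h.
have : (simplex (Th e'))° x.
  apply: filterS xe => z; rewrite TJ; exact: (face_simplex (Tf e')).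
move/(interior_simplex (Tf e')) => /(_ j).
have : face (Th e') J x by rewrite -TJ; exact: interior_subset.
by move/(face_bary (Tf e')) => [_ /(_ j jJ) ->]; rewrite ltxx.
Qed.

Lemma side_interior_side e i y : side_interior (Th e) i y -> side Th e i y.
Proof.
move=> [y0 yp]; apply/(face_bary (Tf e)); split=> j.
  by have [->|/yp/ltW] := eqVneq j i; rewrite ?y0.
by rewrite !finset.inE negbK => /eqP ->.
Qed.

(** s lists the vertices of Th e' in the order of those of Th e; the sign of the
    coordinate says that the two elements are on opposite sides of the common
    side. *)
Definition neighbors e i e' (s : {perm 'I_d.+1}) :=
  [/\ side Th e i = side Th e' (s i),
      forall j, j != i -> row j (Th e) = row j (row_perm s (Th e')) &
      bary (Th e) (row i (row_perm s (Th e'))) ord0 i < 0].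

Let perm_free (s : {perm 'I_d.+1}) e : affinely_independent (row_perm s (Th e)).
Proof. exact: affinely_independent_perm. Qed.

Arguments perm_free : clear implicits.

Let row_permE (s : {perm 'I_d.+1}) (P : 'M[R]_(d.+1, d)) j :
  row j (row_perm s P) = row (s j) P.
Proof. by apply/rowP => k; rewrite !mxE. Qed.

(** Step from y across the side: the points y - t v are outside Th e but in the
    domain, hence in another element, and that element contains y as it is
    closed. By regularity the two meet in a common face, which contains the
    relative interior point y and so the whole side. *)
Lemma exists_neighbor e i y : side_interior (Th e) i y -> Omega y ->
  exists e' s, neighbors e i e' s.
Proof.
move=> [y0 yp] Oy; pose v := row i (Th e) - y.
have vi : dot v (bgrad (Th e) i) = 1.
  by rewrite -bary_sub [X in X - _]bary_vertex// eqxx y0 subr0.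
have cv : y - t *: v @[t --> (0 : R)^'+] --> y.
  rewrite -[X in _ --> X]subr0 -(scale0r v).
  apply: cvg_at_right_filter; apply: cvgB; first exact: cvg_cst.
  by apply: cvgZr_tmp; exact: cvg_id.
have n1 : \forall t \near (0 : R)^'+, Omega (y - t *: v).
  exact: (cv Omega (open_nbhs_nbhs (conj oO Oy))).
(* the finitely many elements without y stay away from y *)
have n2 : \forall t \near (0 : R)^'+, forall e', simplex (Th e') (y - t *: v) -> simplex (Th e') y.
  apply: (@filter_forall _ E (fun e' t => simplex (Th e') (y - t *: v) -> simplex (Th e') y)) => e'.
  have [ye|ye] := pselect (simplex (Th e') y); first by apply: nearW.
  have oc : open (~` simplex (Th e')) by apply: closed_openC; exact: closed_simplex.
  have n : \forall t \near (0 : R)^'+, ~ simplex (Th e') (y - t *: v).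
    exact: (cv (~` simplex (Th e')) (open_nbhs_nbhs (conj oc ye))).
  by apply: filterS n => t h /h.
have [t [t0 Ot Tt]] : exists t : R, [/\ 0 < t, Omega (y - t *: v) &
    forall e', simplex (Th e') (y - t *: v) -> simplex (Th e') y].
  near (0 : R)^'+ => t; exists t; split; [near: t; exact: nbhs_right_gt|by near: t..].
set q := y - t *: v in Ot Tt.
have qi : bary (Th e) q ord0 i < 0.
  by rewrite /q -scaleNr bary_shift// y0 vi mulr1 add0r oppr_lt0.
have : closure Omega q by exact: subset_closure.
rewrite cOE => -[e' _ qe']; have ye' := Tt _ qe'.
have ye : simplex (Th e) y.
  by apply: (@face_simplex _ _ _ [set~ i]%SET) => //; exact: side_interior_side.
have [_ _ _ /(_ e e')[I [J [IE IJ]]]] := Th_regular.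
have Iy : face (Th e) I y by rewrite -IE.
(* the common face has the vertices of the side: if it had more, Th e would be
   contained in Th e' *)
have Ii : [set~ i]%SET = I.
  apply/eqP; rewrite finset.eqEsubset; apply/andP; split.
    apply/fintype.subsetP => j; rewrite !finset.inE => ji; apply: contraT => jI.
    have [_ /(_ j jI) yj] := (face_bary (Tf e) I y).1 Iy.
    by have := yp j ji; rewrite yj ltxx.
  apply/fintype.subsetP => j jI; rewrite !finset.inE; apply/eqP => ji.
  have IT : I = [set: 'I_d.+1]%SET.
    apply/setP => k; rewrite finset.inE; apply: contraT => kI.
    have ki : k != i by apply: contraNneq kI => ->; rewrite -ji.
    have [_ /(_ k kI) yk] := (face_bary (Tf e) I y).1 Iy.
    by have := yp k ki; rewrite yk ltxx.
  have sub : simplex (Th e) `<=` simplex (Th e').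
    move=> z ze; have : face (Th e) I z by rewrite IT.
    by rewrite -IE => -[].
  have [z ze] := interior_simplex_neq0 (Tf e).
  have ee' := interior_subset_simplex ze (sub _ (interior_subset ze)).
  move: qe'; rewrite -ee' => /(simplex_bary (Tf e)) /(_ i).
  by rewrite leNgt qi.
have [s [Js sP]] : exists s : {perm 'I_d.+1},
    J = [set~ s i]%SET /\ forall j, j != i -> row (s j) (Th e') = row j (Th e).
  by apply: face_match => //; rewrite Ii.
exists e', s.
have rows j : j != i -> row j (Th e) = row j (row_perm s (Th e')).
  by move=> /sP <-; rewrite row_permE.
split=> //; first by rewrite /side Ii IJ Js.
move: qi; rewrite (bary_adjacent (Tf e) (perm_free s e') rows).
have : 0 <= bary (row_perm s (Th e')) q ord0 i.
  by apply: (simplex_bary (perm_free s e') q).1; rewrite simplex_perm.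
move=> h; rewrite !ltNge => /negP hh; apply/negP => h2; apply: hh.
exact: mulr_ge0.
Unshelve. all: by end_near.
Qed.

Lemma near_side e i y : side_interior (Th e) i y -> \forall z \near y,
  (0 < bary (Th e) z ord0 i -> (simplex (Th e))° z) /\
  (0 <= bary (Th e) z ord0 i -> simplex (Th e) z).
Proof.
move=> yi; have := near_common_side (Tf e) (Tf e) (fun j _ => erefl) yi.
by apply: filterS => z; rewrite bary_vertex// eqxx mulr1.
Qed.

Lemma near_neighbor e i e' s y : side_interior (Th e) i y -> neighbors e i e' s ->
  \forall z \near y,
  (bary (Th e) z ord0 i < 0 -> (simplex (Th e'))° z) /\
  (bary (Th e) z ord0 i <= 0 -> simplex (Th e') z).
Proof.
move=> yi [_ rows del].
have := near_common_side (Tf e) (perm_free s e') rows yi.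
apply: filterS => z; rewrite simplex_perm// => -[h1 h2].
by split=> zi; [apply: h1; rewrite nmulr_lgt0|apply: h2; rewrite nmulr_lge0].
Qed.

Lemma side_inj e i i' : side Th e i = side Th e i' -> i = i'.
Proof.
move=> ii'; apply/eqP; apply: contraT => ne.
have : side Th e i' (row i (Th e)).
  by apply: vertex_face => //; rewrite !finset.inE.
rewrite -ii' => /(face_bary (Tf e))[_ /(_ i)].
by rewrite !finset.inE eqxx => /(_ isT); rewrite bary_vertex// eqxx => /eqP; rewrite oner_eq0.
Qed.

Lemma side_mid_interior e i : side_interior (Th e) i (side_mid Th e i).
Proof.
split=> [|j ji]; rewrite bary_side_mid ?eqxx ?mulr0// ji mulr1 invr_gt0.
by rewrite ltr0n.
Qed.

Lemma near_side_points e i y (N : set 'rV[R]_d) : side_interior (Th e) i y ->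
  nbhs y N -> (exists2 z, N z & 0 < bary (Th e) z ord0 i) /\
              (exists2 z, N z & bary (Th e) z ord0 i < 0).
Proof.
move=> [y0 yp] Ny; pose v := row i (Th e) - y.
have vi : dot v (bgrad (Th e) i) = 1.
  by rewrite -bary_sub [X in X - _]bary_vertex// eqxx y0 subr0.
have cv u : y + t *: u @[t --> (0 : R)^'+] --> y.
  rewrite -[X in _ --> X]addr0 -(scale0r u).
  apply: cvg_at_right_filter; apply: cvgD; first exact: cvg_cst.
  by apply: cvgZr_tmp; exact: cvg_id.
have n u : \forall t \near (0 : R)^'+, N (y + t *: u) by exact: (cv u _ Ny).
split.
  near (0 : R)^'+ => t; exists (y + t *: v); first by near: t; exact: n.
  by rewrite bary_shift// y0 vi mulr1 add0r; near: t; exact: nbhs_right_gt.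
near (0 : R)^'+ => t; exists (y + t *: - v); first by near: t; exact: n.
rewrite bary_shift// y0 dotNl vi mulrN1 add0r oppr_lt0; near: t.
exact: nbhs_right_gt.
Unshelve. all: by end_near.
Qed.

(** Of three elements that meet in a side, two lie on the same side of it, so an
    interior point of one belongs to the other. *)
Lemma neighbor_unique e i e' s e'' i'' : neighbors e i e' s ->
  side Th e i = side Th e'' i'' -> (e'', i'') <> (e, i) -> (e'', i'') = (e', s i).
Proof.
move=> nb side'' ne.
have ee'' : e'' <> e.
  by move=> ee; apply: ne; rewrite ee in side'' *; rewrite (side_inj side'').
have [s'' [_ sP]] := face_match (Tf e) (Tf e'') side''.
have rows j : j != i -> row j (Th e) = row j (row_perm s'' (Th e'')).
  by move=> /sP <-; rewrite row_permE.
have yi := side_mid_interior e i.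
have n'' := near_common_side (Tf e) (perm_free s'' e'') rows yi.
have [[z [[zP _] [[_ zQ1] zQ2]] zi] _] :=
  near_side_points yi (filterI (near_side yi) (filterI (near_neighbor yi nb) n'')).
have [_ [z' [_ [[z'P _] z'Q]] z'i]] :=
  near_side_points yi (filterI (near_side yi) (filterI (near_neighbor yi nb) n'')).
have := delta_neq0 (Tf e) (perm_free s'' e'') rows.
rewrite neq_lt => /orP[dl|dg].
  have e'e'' : e' = e''.
    apply: (interior_subset_simplex (z'P z'i)).
    have := z'Q.2; rewrite simplex_perm//; apply.
    by rewrite nmulr_lge0// ltW.
  rewrite -e'e''; congr pair; apply: (@side_inj e'); rewrite e'e'' -side''.
  by have [-> _ _] := nb; rewrite e'e''.
exfalso; apply: ee''; apply/esym/(interior_subset_simplex (zP zi)).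
have := zQ2.2; rewrite simplex_perm//; apply.
by rewrite mulr_ge0// ltW.
Qed.

Lemma side_mid_eq e i e' i' : side Th e i = side Th e' i' ->
  side_mid Th e i = side_mid Th e' i'.
Proof.
move=> ss; have [s [si sP]] := face_match (Tf e) (Tf e') ss.
rewrite /side_mid /barycenter !cardsC1; congr (_ *: _).
rewrite si [RHS](reindex_inj (@perm_inj _ s)) /=.
apply: eq_big => j; first by rewrite !finset.inE (inj_eq (@perm_inj _ s)).
by rewrite !finset.inE => /sP.
Qed.

(** The two elements cover a neighbourhood of y. *)
Lemma neighbor_interior e i e' s y : neighbors e i e' s ->
  side_interior (Th e) i y -> Omega y.
Proof.
move=> nb yi; apply: (interior_closure_domain Omega_domain).
apply: filterS (filterI (near_side yi) (near_neighbor yi nb)) => z [[_ h1] [_ h2]].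
by have [/h1|/ltW/h2] := leP 0 (bary (Th e) z ord0 i); exact: simplex_closure.
Qed.

(** If some point of the side were in the domain, so would be a nearby relative
    interior point; then the side has a neighbor and its midpoint is in the
    domain. *)
Lemma boundary_side e i : ~ Omega (side_mid Th e i) ->
  boundary_sides Omega Th (side Th e i).
Proof.
move=> Om; split; first by exists e, i.
have SO x : side Th e i x -> ~ Omega x.
  move=> Sx Ox; apply: Om.
  have [y yi Oy] : exists2 y, side_interior (Th e) i y & Omega y.
    pose u := side_mid Th e i - x.
    have cv : x + t *: u @[t --> (0 : R)^'+] --> x.
      rewrite -[X in _ --> X]addr0 -(scale0r u).
      apply: cvg_at_right_filter; apply: cvgD; first exact: cvg_cst.
      by apply: cvgZr_tmp; exact: cvg_id.
    have n : \forall t \near (0 : R)^'+, Omega (x + t *: u).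
      exact: (cv Omega (open_nbhs_nbhs (conj oO Ox))).
    have [t [t0 t1 Ot]] : exists t : R, [/\ 0 < t, t <= 1 & Omega (x + t *: u)].
      near (0 : R)^'+ => t; exists t; split; near: t;
        [exact: nbhs_right_gt|exact: nbhs_right_le|exact: n].
    exists (x + t *: u) => //.
    have [x0 xI] := (face_bary (Tf e) _ x).1 Sx.
    have [m0 mp] := side_mid_interior e i.
    split=> [|j ji]; rewrite bary_shift// -bary_sub.
      by rewrite m0 xI ?subr0 ?mulr0 ?addr0// !finset.inE eqxx.
    have := mulr_gt0 t0 (mp j ji); have := x0 j.
    have : 0 <= (1 - t) * bary (Th e) x ord0 j by rewrite mulr_ge0 ?subr_ge0.
    rewrite mulrBl mul1r mulrBr => h1 h2 h3; lra.
  have [e' [s nb]] := exists_neighbor yi Oy.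
  exact: neighbor_interior nb (side_mid_interior e i).
move=> x Sx; split; last by move=> /interior_subset; exact: SO.
by apply: (@simplex_closure e); exact: (face_simplex (Tf e)) Sx.
Unshelve. all: by end_near.
Qed.

End mesh_sides.

(** * Balance of the fluxes *)

Section element_flux.
Context {R : realType} {d : nat}.
Variables (P : 'M[R]_(d.+1, d)) (d0 : (0 < d)%N) (Pf : affinely_independent P).

Lemma affine_grad_dot c g a :
  dot a g = \sum_j dot a (bgrad P j) * (c + dot (row j P) g).
Proof.
have := affine_bary Pf (0 + a) c g; rewrite dotDl addrA (affine_bary Pf 0 c g) => /eqP.
rewrite eq_sym addrC -subr_eq => /eqP <-; rewrite -sumrB; apply: eq_bigr => j _.
by rewrite -mulrBl bary_sub addrAC subrr add0r.
Qed.

(** The divergence theorem on one element. The normal component of the affine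
    field is constant on each side and the integral of an affine function over a
    side is given by its midpoint value; with area times outer normal equal to
    - d |P| grad(lambda_i), the boundary integral divided by |P| is the right-hand
    side. The identity itself is linear algebra in the vertex values V_j: the
    midpoint value opposite to vertex i is (S - V_i) / d with S the sum of the
    V_j, and the barycenter value is S / (d + 1). *)
Lemma element_flux c g a b (xT := barycenter P [set: 'I_d.+1]%SET)
    (m := fun i => barycenter P [set~ i]%SET) :
  dot g a + b * d%:R * (c + dot xT g) =
  - d%:R * \sum_i (c + dot (m i) g) * dot (affine_field a b xT (m i)) (bgrad P i).
Proof.
have dn0 : d%:R != 0 :> R by rewrite pnatr_eq0 -lt0n.
have d1n0 : d.+1%:R != 0 :> R by rewrite pnatr_eq0.
pose V j := c + dot (row j P) g; pose S := \sum_j V j.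
have mE i : c + dot (m i) g = d%:R^-1 * (S - V i).
  rewrite (affine_bary Pf) /S [in RHS](bigD1 i)//= addrAC subrr add0r mulr_sumr.
  rewrite (bigD1 i)//= bary_side_mid// eqxx mulr0 mul0r add0r.
  by apply: eq_bigr => j ji; rewrite bary_side_mid// ji mulr1.
have TE : c + dot xT g = d.+1%:R^-1 * S.
  rewrite (affine_bary Pf) /S mulr_sumr; apply: eq_bigr => j _.
  by rewrite bary_elt_mid.
have zE i : dot (affine_field a b xT (m i)) (bgrad P i) =
    dot a (bgrad P i) - b * d.+1%:R^-1.
  rewrite /affine_field dotDl dotZl -bary_sub bary_side_mid// eqxx mulr0.
  by rewrite sub0r bary_elt_mid// mulrN.
have aS : \sum_j dot a (bgrad P j) = 0.
  by under eq_bigr do rewrite dotC; rewrite -dot_suml sum_bgrad// dot0l.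
rewrite TE (eq_bigr (fun i => d%:R^-1 * (S * dot a (bgrad P i) - dot a (bgrad P i) * V i
  - b * d.+1%:R^-1 * (S - V i)))) => [|i _]; last by rewrite mE zE; ring.
rewrite -mulr_sumr !sumrB -mulr_sumr aS mulr0 -affine_grad_dot -mulr_sumr sumrB.
rewrite sumr_const card_ord -/S (dotC g a) -mulr_natr.
have -> : d.+1%:R = d%:R + 1 :> R by rewrite -natr1.
by field; rewrite dn0 natr1 d1n0.
Qed.

End element_flux.

Section flux_balance.
Context {R : realType} {d : nat} {E : finType}.
Variables (Omega : set 'rV[R]_d) (Th : E -> 'M[R]_(d.+1, d)).
Variables (GammaD GammaN : set 'rV[R]_d).
Hypotheses (d0 : (0 < d)%N) (Omega_domain : polyhedral_lipschitz_domain Omega).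
Hypothesis Th_regular : regular_triangulation Omega Th.
Hypothesis Gamma_partition : boundary_partition Omega Th GammaD GammaN.

Let oO : open Omega. Proof. by case: Omega_domain => -[]. Qed.
Let bO : bounded_set Omega. Proof. by case: Omega_domain. Qed.
Let Tf e : affinely_independent (Th e). Proof. by case: Th_regular. Qed.
Arguments Tf : clear implicits.

Lemma neighbors_neq e i e' s : neighbors Th e i e' s -> (e', s i) != (e, i).
Proof.
move=> [_ _]; apply: contraTneq => -[-> si].
have -> : row i (row_perm s (Th e)) = row i (Th e).
  by apply/rowP => k; rewrite !mxE si.
by rewrite bary_vertex// eqxx ltNge ler01.
Qed.

Let mid (p : E * 'I_d.+1) := side_mid Th p.1 p.2.

(** The same side seen from the other element, or p itself for a boundary side:
    an involution of the pairs (element, side) that pairs up the fluxes. *)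
Definition across (p : E * 'I_d.+1) : E * 'I_d.+1 :=
  if `[< Omega (mid p) >] then
    odflt p [pick q | (q != p) && `[< side Th p.1 p.2 = side Th q.1 q.2 >]]
  else p.

Lemma across_boundary p : ~ Omega (mid p) -> across p = p.
Proof. by rewrite /across => Op; case: asboolP. Qed.

Lemma across_unique p q : Omega (mid p) -> q != p ->
  side Th p.1 p.2 = side Th q.1 q.2 -> across p = q.
Proof.
move=> Op qp pq.
have [e' [s nb]] := exists_neighbor Omega_domain Th_regular
  (side_mid_interior d0 Th_regular p.1 p.2) Op.
have uniq r : r != p -> side Th p.1 p.2 = side Th r.1 r.2 -> r = (e', s p.2).
  move=> rp pr; rewrite [LHS]surjective_pairing.
  apply: (neighbor_unique d0 Th_regular nb pr).
  by rewrite -!surjective_pairing; exact/eqP.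
rewrite /across asboolT//; case: pickP => /= [r /andP[rp /asboolP pr]|/(_ q)].
  by rewrite (uniq r)// (uniq q).
by rewrite qp pq asboolT.
Qed.

Lemma across_neighbor p e' s : neighbors Th p.1 p.2 e' s -> across p = (e', s p.2).
Proof.
move=> nb; have [ss _ _] := nb; apply: across_unique => //.
  exact: (neighbor_interior Omega_domain Th_regular nb (side_mid_interior d0 Th_regular _ _)).
by have := neighbors_neq nb; rewrite -surjective_pairing.
Qed.

Lemma acrossK : involutive across.
Proof.
move=> p; have [Op|Op] := pselect (Omega (mid p)); last by rewrite !across_boundary.
have [e' [s nb]] := exists_neighbor Omega_domain Th_regular
  (side_mid_interior d0 Th_regular p.1 p.2) Op.
have [ss _ _] := nb.
rewrite (across_neighbor nb); apply: across_unique => //.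
  by rewrite /mid /= -(side_mid_eq Th_regular ss).
by have := neighbors_neq nb; rewrite -surjective_pairing eq_sym.
Qed.

Variables (u : 'rV[R]_d -> R) (c : E -> R) (G : E -> 'rV[R]_d).
Hypothesis uD : CR_D Omega Th GammaD u.
Hypothesis uE : forall e x, (simplex (Th e))° x -> u x = c e + dot x (G e).
Variables (z : 'rV[R]_d -> 'rV[R]_d) (a : E -> 'rV[R]_d) (b : E -> R).
Hypothesis zN : RT_N Omega Th GammaN z.
Hypothesis zE : forall e x, (simplex (Th e))° x ->
  z x = affine_field (a e) (b e) (elt_mid Th e) x.

Let U e x := c e + dot x (G e).
Let Z e x := affine_field (a e) (b e) (elt_mid Th e) x.
Let flux p := volume (Th p.1) * (U p.1 (mid p) * dot (Z p.1 (mid p)) (bgrad (Th p.1) p.2)).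

Let mid_simplex e i : simplex (Th e) (side_mid Th e i).
Proof.
apply: (@face_simplex _ _ _ [set~ i]%SET) => //; apply: (side_interior_side Th_regular).
exact: (side_mid_interior d0 Th_regular).
Qed.

Let trace_u e x : simplex (Th e) x -> trace Th u e x = U e x.
Proof. by move=> xe; apply: trace_affine => // y; exact: uE. Qed.

(** On an interior side the midpoint values of u agree, the normal components of
    z agree, and the scaled normals are opposite. On a boundary side p is its own
    image, so the claim is that its flux vanishes: either the midpoint value of u
    or the normal component of z is 0. *)
Lemma flux_across p : flux (across p) = - flux p.
Proof.
have mi := side_mid_interior d0 Th_regular p.1 p.2.
have [Op|Op] := pselect (Omega (mid p)); last first.
  rewrite across_boundary//; have bs := boundary_side d0 Omega_domain Th_regular Op.
  suff -> : flux p = 0 by rewrite oppr0.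
  have [D [DB GD GN]] := Gamma_partition.
  have [DS|DS] := pselect (D (side Th p.1 p.2)).
    have [_ /(_ p.1 p.2)] := uD.
    rewrite trace_u; last exact: mid_simplex.
    by move=> u0; rewrite /flux u0 ?mul0r ?mulr0// GD => x Sx; exists (side Th p.1 p.2).
  pose g := bgrad (Th p.1) p.2; pose k := (Num.sqrt (dot g g))^-1.
  have gg : 0 < dot g g by apply: dot_gt0; exact: bgrad_neq0.
  have [_ /(_ p.1 p.2 (- k *: g) (mid p))] := zN.
  rewrite (trace_affine_field (Tf _) (mid_simplex _ _) (zE (e := p.1))).
  have SN : side Th p.1 p.2 `<=` GammaN.
    by rewrite GN => x Sx; exists (side Th p.1 p.2).
  have k0 : 0 < k by rewrite invr_gt0 sqrtr_gt0.
  move=> /(_ SN) h; have : dot (Z p.1 (mid p)) (- k *: g) = 0.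
    apply: h; last exact: (side_interior_side Th_regular).
    split=> [|x y xe yS].
      rewrite dotZl dotZr mulrA mulrNN -expr2 exprVn sqr_sqrtr ?ltW//.
      by rewrite mulVf// gt_eqF.
    rewrite dotZl dotC -bary_sub mulNr oppr_le0 mulr_ge0 ?(ltW k0)//.
    have [_ /(_ p.2)] := (face_bary (Tf _) _ _).1 yS.
    rewrite !finset.inE eqxx => /(_ isT) ->; rewrite subr0.
    exact: (simplex_bary (Tf _) x).1.
  rewrite dotZr => /eqP; rewrite mulf_eq0 oppr_eq0 gt_eqF//= => /eqP.
  by rewrite /flux => ->; rewrite !mulr0.
have [e' [s nb]] := exists_neighbor Omega_domain Th_regular mi Op.
rewrite (across_neighbor nb) /flux /=; have [ss rows neg] := nb.
have mm : mid (e', s p.2) = mid p by rewrite /mid /= -(side_mid_eq Th_regular ss).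
have UU : U e' (mid p) = U p.1 (mid p).
  have [[_ /(_ _ _ _ _ ss)]] := uD.
  rewrite !trace_u//.
  by rewrite (side_mid_eq Th_regular ss); exact: mid_simplex.
have ZZ : dot (Z p.1 (mid p)) (bgrad (Th p.1) p.2) = dot (Z e' (mid p)) (bgrad (Th p.1) p.2).
  have [[[_ [g yg]] _] _] := zN.
  pose N : set 'rV[R]_d := [set x | Omega x /\
    (0 < bary (Th p.1) x ord0 p.2 -> (simplex (Th p.1))° x) /\
    (bary (Th p.1) x ord0 p.2 < 0 -> (simplex (Th e'))° x)].
  have Nm : nbhs (mid p) N.
    have ns := near_side Th_regular mi; have nn := near_neighbor Th_regular mi nb.
    apply: filterS2 (open_nbhs_nbhs (conj oO Op)) (filterI ns nn) => x Ox.
    by move=> [[h1 _] [h2 _]].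
  have [r /= r0 rs] : nbhs_ball (mid p) N by apply/nbhs_ballP.
  have rs' x : `|x - mid p| <= r / 2 -> N x.
    move=> xr; apply: rs; rewrite -ball_normE /ball_ /= distrC.
    by apply: le_lt_trans xr _; rewrite ltr_pdivrMr// mulr_natr mulr2n ltrDl.
  have r20 : 0 < r / 2 by rewrite divr_gt0.
  apply: (@normal_trace_continuous _ _ Omega (Th p.1) (Th e') p.2 (mid p) (r / 2) z g) => //.
  - exact: (element_interior_domain Omega_domain Th_regular).
  - exact: (element_interior_domain Omega_domain Th_regular).
  - by move=> x; exact: zE.
  - by move=> x; exact: zE.
  - exact: mi.1.
  - by move=> x xr; exact: (rs' x xr).1.
  - by move=> x xr; exact: (rs' x xr).2.1.
  - by move=> x xr; exact: (rs' x xr).2.2.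
have sf : affinely_independent (row_perm s (Th e')) by exact: affinely_independent_perm.
have := volume_bgrad_adjacent (Tf p.1) sf rows d0 neg.
rewrite bgrad_perm// /volume simplex_perm// -!/(volume _) => vv.
have vZ : volume (Th e') * dot (Z e' (mid p)) (bgrad (Th e') (s p.2)) =
    - (volume (Th p.1) * dot (Z p.1 (mid p)) (bgrad (Th p.1) p.2)).
  by rewrite ZZ -!dotZr vv dotNr opprK.
by rewrite mm UU mulrCA vZ mulrN [in LHS]mulrCA.
Qed.

(** Element by element the sum is the total of the fluxes by [element_flux], and
    the involution [across] changes their signs. *)
Lemma flux_balance :
  \sum_e volume (Th e) * (dot (G e) (a e) + b e * d%:R * (c e + dot (elt_mid Th e) (G e))) = 0.
Proof.
have -> : \sum_e volume (Th e) * (dot (G e) (a e) + b e * d%:R * (c e + dot (elt_mid Th e) (G e)))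
    = - d%:R * \sum_p flux p.
  rewrite -(pair_bigA _ (fun e i => flux (e, i))) mulr_sumr; apply: eq_bigr => e _.
  by rewrite element_flux// mulrCA [X in _ * X]mulr_sumr.
have : \sum_p flux p = - \sum_p flux p.
  rewrite [LHS](reindex_inj (inv_inj acrossK)) -sumrN.
  by apply: eq_bigr => p _; exact: flux_across.
move=> h; have -> : \sum_p flux p = 0 by lra.
by rewrite mulr0.
Qed.

End flux_balance.

(** * Energies as finite sums over the elements *)

Section element_values.
Context {R : realType} {d : nat} {E : finType}.
Notation L := (@lebesgue_rV R d).
Variables (Omega : set 'rV[R]_d) (Th : E -> 'M[R]_(d.+1, d)).
Hypotheses (d0 : (0 < d)%N) (Omega_domain : polyhedral_lipschitz_domain Omega).
Hypothesis Th_regular : regular_triangulation Omega Th.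

Let oO : open Omega. Proof. by case: Omega_domain => -[]. Qed.
Let bO : bounded_set Omega. Proof. by case: Omega_domain. Qed.
Let Tf e : affinely_independent (Th e). Proof. by case: Th_regular. Qed.
Arguments Tf : clear implicits.

Lemma elementwise_element (V : lmodType R) (f : E -> 'rV[R]_d -> V) e x :
  (simplex (Th e))° x -> elementwise Th f x = f e x.
Proof.
move=> xe; apply: elementwise_at => // e' /eqP e'e xe'; apply: e'e.
exact: (interior_subset_simplex Th_regular xe' (interior_subset xe)).
Qed.

Lemma elt_grad_affine (u : 'rV[R]_d -> R) e c g x :
  (forall y, (simplex (Th e))° y -> u y = c + dot y g) ->
  (simplex (Th e))° x -> elt_grad Th u x = g.
Proof.
move=> uE xe; rewrite /elt_grad (elementwise_element _ xe); apply/rowP => i; rewrite mxE.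
have n : \forall y \near x, u y = c + dot y g.
  have xi : nbhs x (simplex (Th e))° by exact: open_nbhs_nbhs (conj (open_interior _) xe).
  by apply: filterS xi => y; exact: uE.
rewrite (near_eq_derive _ n) -[g ord0 i]dot_delta -(derive_dot _ _ x).
have dc : derivable (cst c : 'rV[R]_d -> R) x (delta_mx ord0 i) by exact: derivable_cst.
have dg : derivable (fun y : 'rV[R]_d => dot y g) x (delta_mx ord0 i).
  by apply: diff_derivable; exact: differentiable_dot.
by have := deriveD dc dg; rewrite derive_cst add0r.
Qed.

Lemma elt_mean_affine (u : 'rV[R]_d -> R) e c g x :
  (forall y, (simplex (Th e))° y -> u y = c + dot y g) ->
  (simplex (Th e))° x -> elt_mean Th u x = c + dot (elt_mid Th e) g.
Proof.
move=> uE xe; rewrite /elt_mean (elementwise_element _ xe).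
have [N [mN N0 sN]] := negligible_skeleton d0 (Tf e).
rewrite (Rintegral_congr_null (h := fun y => c + dot y g) mN N0).
  by rewrite integral_affine// mulKf// gt_eqF// volume_gt0.
move=> y ye Ny; apply: uE; apply: contrapT => yi; apply: Ny; exact: sN.
Qed.

Lemma elt_mean_vec_affine (z : 'rV[R]_d -> 'rV[R]_d) e a b x :
  (forall y, (simplex (Th e))° y -> z y = affine_field a b (elt_mid Th e) y) ->
  (simplex (Th e))° x -> elt_mean_vec Th z x = a.
Proof.
move=> zE xe; apply/rowP => j; rewrite mxE.
have zj y : (simplex (Th e))° y ->
    z y ord0 j = a ord0 j - b * elt_mid Th e ord0 j + dot y (b *: delta_mx ord0 j).
  move=> /zE ->; rewrite !mxE dotZr dotC dot_delta; ring.
rewrite (elt_mean_affine zj xe) dotZr dotC dot_delta; ring.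
Qed.

Lemma negligible_bigcup_fin (F : E -> set 'rV[R]_d) :
  (forall e, L.-negligible (F e)) -> L.-negligible (\bigcup_e F e).
Proof.
move=> nF; rewrite (_ : \bigcup_e F e = \big[setU/set0]_(e : E) F e).
  by elim/big_ind : _ => [|A B|e _]; [exact: negligible_set0|exact: negligibleU|].
apply/seteqP; split=> x.
  by move=> [e _ Fx]; rewrite (bigD1 e)//=; left.
by elim/big_ind : _ => [//|A B hA hB [/hA|/hB]//|e _ Fx]; exists e.
Qed.

(** The domain is covered by the open elements up to the null set formed by the
    boundaries of the simplices. *)
Lemma domain_skeleton : exists N, [/\ measurable N, L N = 0%E &
  forall x, Omega x -> ~ N x -> exists e, (simplex (Th e))° x].
Proof.
have [N [mN N0 sN]] := negligible_bigcup_fin (fun e => negligible_skeleton d0 (Tf e)).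
exists N; split=> // x Ox Nx; have : closure Omega x by exact: subset_closure.
have [_ -> _ _] := Th_regular => -[e _ xe]; exists e; apply: contrapT => xi.
by apply: Nx; apply: sN; exists e.
Qed.

Lemma div_affine (z : 'rV[R]_d -> 'rV[R]_d) (a : E -> 'rV[R]_d) (b : E -> R) :
  Hdiv Omega z ->
  (forall e y, (simplex (Th e))° y -> z y = affine_field (a e) (b e) (elt_mid Th e) y) ->
  exists N, [/\ measurable N, L N = 0%E &
    forall e x, (simplex (Th e))° x -> ~ N x -> div Omega z x = b e * d%:R].
Proof.
move=> [_ zd] zE; have wd : weak_div Omega z (div Omega z) by exact: xgetPex.
have nF e : L.-negligible [set x | (simplex (Th e))° x /\ div Omega z x <> b e * d%:R].
  have [N [mN N0 NE]] := divergence_on_simplex oO bO (Tf e)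
    (element_interior_domain Omega_domain Th_regular (e := e)) wd (zE e).
  exists N; split=> // x [xe ne]; apply: contrapT => Nx; apply: ne; exact: NE.
have [N [mN N0 sN]] := negligible_bigcup_fin nF.
exists N; split=> // e x xe Nx; apply: contrapT => ne; apply: Nx; apply: sN.
by exists e.
Qed.

Lemma lebesgue_interior_simplex e : L (simplex (Th e))° = (volume (Th e))%:E.
Proof.
rewrite /volume fineK ?simplex_fin//; apply/eqP; rewrite eq_le; apply/andP; split.
  apply: le_measure; rewrite ?inE; [exact: measurable_interior_simplex|
    exact: measurable_simplex|exact: interior_subset].
have [N [mN N0 sN]] := negligible_skeleton d0 (Tf e).
have mi : measurable (simplex (Th e))° by exact: measurable_interior_simplex.
rewrite -[leRHS]adde0 -N0; apply: le_trans (measureU2 L mi mN).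
apply: le_measure; rewrite ?inE; [exact: measurable_simplex|exact: measurableU|].
by move=> x xe; have [|xi] := pselect ((simplex (Th e))° x); [left|right; exact: sN].
Qed.

Local Open Scope ereal_scope.

Lemma ge0_integral_piecewise (f : 'rV[R]_d -> \bar R) (A : E -> \bar R) N :
  measurable N -> L N = 0 -> (forall e, 0 <= A e) ->
  (forall e x, (simplex (Th e))° x -> ~ N x -> f x = A e) ->
  \int[L]_(x in Omega) f x = \sum_e A e * (volume (Th e))%:E.
Proof.
move=> mN N0 A0 fA; have [M [mM M0 OM]] := domain_skeleton.
have mi e : measurable (simplex (Th e))° by exact: measurable_interior_simplex.
pose h e := (cst (A e) : 'rV[R]_d -> \bar R) \_ (simplex (Th e))°.
have h0 e x : 0 <= h e x by rewrite /h patchE; case: (x \in _) => /=.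
have NM0 : L (N `|` M) = 0.
  by rewrite measureU0.
rewrite (integral_congr_null (h := fun x => \sum_e h e x) (measurableU _ _ mN mM) NM0).
  rewrite ge0_integral_sum//.
  - apply: eq_bigr => e _; rewrite -integral_mkcondr setIidr; last first.
      exact: (element_interior_domain Omega_domain Th_regular).
    by rewrite integral_cst//; congr (_ * _); exact: lebesgue_interior_simplex.
  - exact: open_measurable_rV.
  - move=> e; apply: measurable_funTS.
    by apply/(measurable_restrictT _ (mi e)); exact: measurable_cst.
move=> x Ox NMx; have [|e xe] := OM x Ox; first by move=> Mx; apply: NMx; right.
rewrite (fA e)//; last by move=> Nx; apply: NMx; left.
rewrite (bigD1 e)//= big1 ?adde0 => [|e' e'e].
  by rewrite /h patchE mem_set.
rewrite /h patchE memNset// => xe'; move/eqP: e'e; apply.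
exact: (interior_subset_simplex Th_regular xe' (interior_subset xe)).
Qed.

(** The positive and negative parts are piecewise constant and nonnegative, and
    excluding -oo makes the integral of the negative part finite. *)
Lemma integral_piecewise (f : 'rV[R]_d -> \bar R) (A : E -> \bar R) N :
  measurable N -> L N = 0 -> (forall e, A e != -oo) ->
  (forall e x, (simplex (Th e))° x -> ~ N x -> f x = A e) ->
  \int[L]_(x in Omega) f x = \sum_e A e * (volume (Th e))%:E.
Proof.
move=> mN N0 Any fA; rewrite integralE.
rewrite (ge0_integral_piecewise (A := fun e => maxe (A e) 0) mN N0); first last.
- by move=> e x xe Nx; rewrite funeposE (fA e).
- by move=> e; rewrite le_max lexx orbT.
rewrite (ge0_integral_piecewise (A := fun e => maxe (- A e) 0) mN N0); first last.
- by move=> e x xe Nx; rewrite funenegE (fA e).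
- by move=> e; rewrite le_max lexx orbT.
have finN e : maxe (- A e) 0 * (volume (Th e))%:E \is a fin_num.
  apply: fin_numM => //; have := Any e; case: (A e) => [r||]//= _.
    by rewrite -EFin_max.
  by rewrite maxNye.
rewrite -fin_num_sumeN//.
rewrite -big_split /=; apply: eq_bigr => e _.
have v0 := volume_gt0 (Tf e); have := Any e; case: (A e) => [r||]//= _.
  rewrite -!EFin_max -!EFinM -EFinN -EFinD; congr (_%:E).
  rewrite -mulNr -mulrDl; congr (_ * _)%R.
  by case: (leP r 0%R) => r0; case: (leP (- r)%R 0%R) => nr0; lra.
by rewrite maxye maxNye mul0e oppe0 adde0.
Qed.

End element_values.

(** * Weak duality *)

Section weak_duality.
Context {R : realType} {d : nat} {E : finType}.
Variables (Omega : set 'rV[R]_d) (Th : E -> 'M[R]_(d.+1, d)).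
Variables (GammaD GammaN : set 'rV[R]_d).
Variables (phi : 'rV[R]_d -> R) (psi : 'rV[R]_d -> R -> \bar R).
Local Open Scope ereal_scope.

Lemma fenchel_phi s r : (dot s r - phi r)%:E <= conj_phi phi s.
Proof. by apply: ereal_sup_ubound; exists r. Qed.

Lemma fenchel_psi x s r : (s * r)%:E - psi x r <= conj_psi psi x s.
Proof. by apply: ereal_sup_ubound; exists r. Qed.

Lemma fenchel_young x s t r q : psi x q \is a fin_num ->
  (dot s r + t * q)%:E - ((phi r)%:E + psi x q) <= conj_phi phi s + conj_psi psi x t.
Proof.
move=> psiq; apply: le_trans (leeD (fenchel_phi s r) (fenchel_psi x t q)).
rewrite -(fineK psiq) -!EFinN -!EFinD lee_fin; lra.
Qed.

Hypotheses (d0 : (0 < d)%N) (Omega_domain : polyhedral_lipschitz_domain Omega).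
Hypothesis Th_regular : regular_triangulation Omega Th.
Hypothesis Gamma_partition : boundary_partition Omega Th GammaD GammaN.
Hypothesis psi_gtNy : forall x r, Omega x -> psi x r != -oo.
Hypothesis psi_constant : elementwise_constant Th psi.

(** If the primal density is +oo on some element, the primal energy is +oo. If
    not, all primal densities A_e are finite, and Fenchel's inequality bounds the
    dual densities B_e below by finite numbers whose sum with the A_e is the flux
    term; so B_e may be +oo but not -oo. Weighting with the volumes and summing,
    [flux_balance] gives sum A_e |T_e| + sum B_e |T_e| >= 0. *)
Lemma weak_duality u z : CR_D Omega Th GammaD u -> RT_N Omega Th GammaN z ->
  D_h Omega Th phi psi z <= I_h Omega Th phi psi u.
Proof.
move=> uD zN.
have Tf e : affinely_independent (Th e) by case: Th_regular.
have [c [G uE]] : exists (c : E -> R) (G : E -> 'rV[R]_d),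
    forall e x, (simplex (Th e))° x -> u x = (c e + dot x (G e))%R.
  have /choice[cG cGE] : forall e, exists cg : R * 'rV[R]_d,
      forall x, (simplex (Th e))° x -> u x = (cg.1 + dot x cg.2)%R.
    move=> e; have [[[_ /(_ e)[p pd up]] _] _] := uD.
    have [c [g pE]] := poly_degree_le1 pd.
    by exists (c, g) => x xe; rewrite up// pE.
  by exists (fun e => (cG e).1), (fun e => (cG e).2).
have [a [b zE]] : exists (a : E -> 'rV[R]_d) (b : E -> R), forall e x,
    (simplex (Th e))° x -> z x = affine_field (a e) (b e) (elt_mid Th e) x.
  have /choice[ab abE] : forall e, exists ab : 'rV[R]_d * R, forall x,
      (simplex (Th e))° x -> z x = affine_field ab.1 ab.2 (elt_mid Th e) x.
    by move=> e; have [[_ /(_ e)[a [b zE]]] _] := zN; exists (a, b).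
  by exists (fun e => (ab e).1), (fun e => (ab e).2).
have /choice[p pe] : forall e, exists x, (simplex (Th e))° x.
  by move=> e; exact: (interior_simplex_neq0 (Tf e)).
pose m e := (c e + dot (elt_mid Th e) (G e))%R.
pose A e := (phi (G e))%:E + psi (p e) (m e).
pose B e := conj_phi phi (a e) + conj_psi psi (p e) (b e * d%:R)%R.
have ANy e : A e != -oo.
  have := psi_gtNy (m e) (element_interior_domain Omega_domain Th_regular (pe e)).
  by rewrite /A; case: (psi _ _).
have IE : I_h Omega Th phi psi u = \sum_e A e * (volume (Th e))%:E.
  apply: (integral_piecewise d0 Omega_domain Th_regular measurable0 (measure0 _)) => //.
  move=> e x xe _; rewrite (elt_grad_affine Th_regular (uE e) xe).
  rewrite (elt_mean_affine d0 Th_regular (uE e) xe).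
  by rewrite (psi_constant _ xe (pe e)).
have [[e Ae]|Afin] := pselect (exists e, A e = +oo).
  suff -> : I_h Omega Th phi psi u = +oo by exact: leey.
  rewrite IE; apply/esum_eqyP => [e' _|].
    have := ANy e'; have := volume_gt0 (Tf e').
    by case: (A e') => [r||]//= v0 _; rewrite gt0_mulye// lte_fin.
  by exists e; split=> //; rewrite Ae gt0_mulye// lte_fin volume_gt0.
have {}Afin e : A e \is a fin_num.
  by rewrite fin_numE ANy; apply/eqP => Ae; apply: Afin; exists e.
have AB e : (dot (a e) (G e) + b e * d%:R * m e)%:E - A e <= B e.
  apply: fenchel_young; have := Afin e.
  by rewrite /A; case: (psi _ _).
have BNy e : B e != -oo.
  rewrite -ltNye; apply: lt_le_trans (AB e).
  by rewrite -(fineK (Afin e)) -EFinN -EFinD ltNyr.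
have DE : D_h Omega Th phi psi z = - \sum_e B e * (volume (Th e))%:E.
  have [[zH _] _] := zN.
  have [N [mN N0 NE]] := div_affine Omega_domain Th_regular zH zE.
  congr (- _).
  apply: (integral_piecewise d0 Omega_domain Th_regular mN N0) => // e x xe Nx.
  rewrite (elt_mean_vec_affine d0 Th_regular (zE e) xe) (NE e x)//.
  congr (_ + _); congr ereal_sup; apply: eq_imagel => r _.
  by rewrite (psi_constant _ xe (pe e)).
rewrite DE IE leeNl -fin_num_sumeN => [|e _]; last exact: fin_numM.
have flux0 : \sum_e (volume (Th e) * (dot (G e) (a e) + b e * d%:R * m e))%:E = 0.
  rewrite sumEFin; congr EFin.
  exact: (flux_balance d0 Omega_domain Th_regular Gamma_partition uD uE zN zE).
pose F e := (volume (Th e) * (dot (G e) (a e) + b e * d%:R * m e))%R.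
have -> : \sum_e - (A e * (volume (Th e))%:E) =
    \sum_e (- (A e * (volume (Th e))%:E) + (F e)%:E).
  by rewrite big_split /= flux0 adde0.
apply: lee_sum => e _; have v0 := volume_gt0 (Tf e).
apply: le_trans (lee_wpmul2r _ (AB e)); last by rewrite lee_fin ltW.
rewrite /F -(fineK (Afin e)) -EFinM -!EFinN -!EFinD -EFinM lee_fin dotC; nra.
Qed.

End weak_duality.

Theorem corollary3p6 (R : realType) (d : nat) (d_gt0 : (0 < d)%N)
    (Omega : set 'rV[R]_d) (E : finType) (Th : E -> 'M[R]_(d.+1, d))
    (GammaD GammaN : set 'rV[R]_d)
    (phi : 'rV[R]_d -> R) (psi : 'rV[R]_d -> R -> \bar R)
    (Omega_domain : polyhedral_lipschitz_domain Omega)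
    (Th_regular : regular_triangulation Omega Th)
    (Gamma_partition : boundary_partition Omega Th GammaD GammaN)
    (phi_continuous : continuous phi)
    (phi_convex : convex_function (E := 'rV[R]_d) setT phi)
    (psi_gtNy : forall x r, Omega x -> psi x r != -oo%E)
    (psi_constant : elementwise_constant Th psi)
    (psi_convex : forall x, Omega x -> convex_ereal (psi x)) :
  (ereal_inf [set I_h Omega Th phi psi u | u in CR_D Omega Th GammaD] >=
   ereal_sup [set D_h Omega Th phi psi z | z in RT_N Omega Th GammaN])%E.
Proof.
apply: ge_ereal_sup => _ [z zN <-]; apply: le_ereal_inf_tmp => _ [u uD <-].
exact: (weak_duality phi d_gt0 Omega_domain Th_regular Gamma_partition psi_gtNy psi_constant uD zN).
Qed.
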